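(* For every $n\ge0$, $$\mathrm{ch}\,L(n)=[n]!\,\xi^n\Big/\prod_{\substack{1\le k\le n+1\\ k\equiv t\ (\mathrm{mod}\ 2)}}\big(1-[k]^2\xi^2\big)\ \in\ \mathbb N[q,q^{-1}][\![\xi]\!].$$
   Context: Let $\Bbbk$ be a field of characteristic $\neq2$, $t\in\{0,1\}$, and let $\mathcal{NB}_t$ be the nil-Brauer category: the strict graded $\Bbbk$-linear monoidal category (tensor $\star$, unit $\mathbb1$, composition $\circ$) generated by an object $B$ and morphisms $x:B\to B$ (degree 2), $\tau:B\star B\to B\star B$ (degree $-2$), $\cap:B\star B\to\mathbb1$, $\cup:\mathbb1\to B\star B$ (degree 0), with relations ($1=1_B$): $\tau\circ\tau=0$; $(\tau\star1)\circ(1\star\tau)\circ(\tau\star1)=(1\star\tau)\circ(\tau\star1)\circ(1\star\tau)$; $\cap\circ\cup=t1_{\mathbb1}$; $(\cap\star1)\circ(1\star\cup)=1=(1\star\cap)\circ(\cup\star1)$; $\cap\circ\tau=0$; $(1\star\cap)\circ(\tau\star1)=(\cap\star1)\circ(1\star\tau)$; $(x\star1)\circ\tau-\tau\circ(1\star x)=1\star1-\cup\circ\cap$; $\cap\circ(1\star x)=-\cap\circ(x\star1)$. Path algebra $\mathrm{NB}=\bigoplus_{m,n}1_m\mathrm{NB}1_n$ with $1_m\mathrm{NB}1_n=\mathrm{Hom}(B^{\star n},B^{\star m})$; graded modules are locally unital graded left modules; $q$ denotes the downward grading shift $(qV)_k=V_{k+1}$. For $n\ge0$, $\mathrm{NB}_{\ge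 n}$ is the quotient of $\mathrm{NB}$ by the two-sided ideal generated by $1_m$, $m<n$ (images written $\bar u$), $\tau_i=1^{\star(i-1)}\star\tau\star1^{\star(n-i-1)}\in1_n\mathrm{NB}1_n$, and $\Delta(n):=q^{\frac12n(n-1)}\mathrm{NB}_{\ge n}\bar1_n/\sum_{i=1}^{n-1}\mathrm{NB}_{\ge n}\bar\tau_i$; $L(n)$ denotes the unique irreducible graded quotient of $\Delta(n)$. For a graded vector space $W$ with finite-dimensional pieces, $\dim_qW=\sum_d(\dim W_d)q^{-d}$; the graded character of a graded $\mathrm{NB}$-module $V$ is $\mathrm{ch}\,V=\sum_{n\ge0}(\dim_q1_nV)\xi^n$ for a formal variable $\xi$. $[n]=(q^n-q^{-n})/(q-q^{-1})$ and $[n]!=[1][2]\cdots[n]$; the quotient is expanded as a power series in $\xi$. *)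

(* Defs.v *)
From HB Require Import structures.
From mathcomp Require Import all_boot all_order all_algebra.
From Stdlib Require List.
Set Implicit Arguments. Unset Strict Implicit. Unset Printing Implicit Defensive.
Import Order.TTheory GRing.Theory Num.Theory.
Local Open Scope ring_scope.

(* The nil-Brauer category NB_t, presented by generators and relations.    *)
(* Objects are B^{*m}, identified with m : nat.                            *)

Inductive gen := GX | GT | GCap | GCup.

Definition gen_code (g : gen) : nat :=
  match g with GX => 0 | GT => 1 | GCap => 2 | GCup => 3 end%N.
Definition gen_decode (n : nat) : option gen :=
  match n with 0 => Some GX | 1 => Some GT | 2 => Some GCap | 3 => Some GCup
  | _ => None end%N.
Lemma gen_codeK : pcancel gen_code gen_decode. Proof. by case. Qed.
HB.instance Definition _ := Equality.copy gen (pcan_type gen_codeK).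

Definition gsrc (g : gen) : nat := match g with GX => 1 | GT => 2 | GCap => 2 | GCup => 0 end%N.
Definition gtgt (g : gen) : nat := match g with GX => 1 | GT => 2 | GCap => 0 | GCup => 2 end%N.
Definition gdeg (g : gen) : int := match g with GX => 2 | GT => -2 | GCap => 0 | GCup => 0 end.

(* An elementary morphism (a, g, b) is 1^{*a} * g * 1^{*b}. *)
Definition elem := (nat * gen * nat)%type.
(* A path is a composable sequence of elementary morphisms, listed in the
   order of application (the head is applied first). *)
Definition path := seq elem.

Fixpoint ptgt (s : nat) (p : path) : option nat :=
  match p with
  | [::] => Some s
  | (a, g, b) :: p' => if s == (a + gsrc g + b)%N then ptgt (a + gtgt g + b) p' else None
  end.

Fixpoint pobjs (s : nat) (p : path) : seq nat :=
  s :: match p with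
       | [::] => [::]
       | (a, g, b) :: p' => pobjs (a + gtgt g + b) p'
       end.

Definition pdeg (p : path) : int := \sum_(e <- p) gdeg e.1.2.

Definition whisk (a b : nat) (p : path) : path :=
  [seq ((a + e.1.1)%N, e.1.2, (e.2 + b)%N) | e <- p].

Section Lin.
Variable K : fieldType.

Definition comb := seq (K * path).
Definition cf (v : comb) (p : path) : K := \sum_(e <- v | e.2 == p) e.1.
Definition ceq (v w : comb) : Prop := forall p, cf v p = cf w p.
Definition scale (c : K) (v : comb) : comb := [seq (c * e.1, e.2) | e <- v].
Definition span (P : comb -> Prop) (v : comb) : Prop :=
  exists ws : seq comb, (forall w, List.In w ws -> P w) /\ ceq v (flatten ws).

(* The defining relations of NB_t, as combinations of paths with source s
   (each relation "lhs = rhs" is written as "lhs - rhs = 0"). *)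
Definition isRel (t : nat) (s : nat) (r : comb) : Prop :=
  (s = 2%N /\ r = [:: (1, [:: (0, GT, 0); (0, GT, 0)]%N)])
  \/ (s = 3%N /\ r = [:: (1, [:: (0, GT, 1); (1, GT, 0); (0, GT, 1)]%N);
                         (-1, [:: (1, GT, 0); (0, GT, 1); (1, GT, 0)]%N)])
  \/ (s = 0%N /\ r = [:: (1, [:: (0, GCup, 0); (0, GCap, 0)]%N); (- (t%:R), [::])])
  \/ (s = 1%N /\ r = [:: (1, [:: (1, GCup, 0); (0, GCap, 1)]%N); (-1, [::])])
  \/ (s = 1%N /\ r = [:: (1, [:: (0, GCup, 1); (1, GCap, 0)]%N); (-1, [::])])
  \/ (s = 2%N /\ r = [:: (1, [:: (0, GT, 0); (0, GCap, 0)]%N)])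
  \/ (s = 3%N /\ r = [:: (1, [:: (0, GT, 1); (1, GCap, 0)]%N);
                         (-1, [:: (1, GT, 0); (0, GCap, 1)]%N)])
  \/ (s = 2%N /\ r = [:: (1, [:: (0, GT, 0); (0, GX, 1)]%N);
                         (-1, [:: (1, GX, 0); (0, GT, 0)]%N);
                         (-1, [::]);
                         (1, [:: (0, GCap, 0); (0, GCup, 0)]%N)])
  \/ (s = 2%N /\ r = [:: (1, [:: (1, GX, 0); (0, GCap, 0)]%N);
                         (1, [:: (0, GX, 1); (0, GCap, 0)]%N)])
  (* interchange law of the strict monoidal structure:
     (g * 1^c * 1) o (1 * 1^c * h) = (1 * 1^c * h) o (g * 1^c * 1) *)
  \/ (exists (g h : gen) (c : nat),
        s = (gsrc g + c + gsrc h)%N /\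
        r = [:: (1, [:: (0%N, g, (c + gsrc h)%N); ((gtgt g + c)%N, h, 0%N)]);
                (-1, [:: ((gsrc g + c)%N, h, 0%N); (0%N, g, (c + gtgt h)%N)])]).

Definition typed (n k : nat) (v : comb) : Prop :=
  forall e, List.In e v -> ptgt n e.2 = Some k.

(* Generators of the subspace of  (combinations of paths n -> k)  that is
   killed in 1_k Delta(n):
   (a) the two-sided tensor ideal of relations of NB_t,
   (b) morphisms factoring through some B^m with m < n   (NB -> NB_{>= n}),
   (c) NB_{>= n} tau_i, 1 <= i <= n-1. *)
Definition Rgen (t n k : nat) (w : comb) : Prop :=
  (exists (c : K) (r : comb) (s a b : nat) (p' p : path),
      isRel t s r /\ ptgt n p' = Some (a + s + b)%N /\
      w = [seq (c * e.1, p' ++ whisk a b e.2 ++ p) | e <- r] /\ typed n k w)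
  \/ (exists (c : K) (p : path),
      ptgt n p = Some k /\ has (fun m => m < n)%N (pobjs n p) /\ w = [:: (c, p)])
  \/ (exists (c : K) (i : nat) (p : path),
      (1 <= i < n)%N /\ ptgt n (((i - 1)%N, GT, (n - i - 1)%N) :: p) = Some k /\
      w = [:: (c, ((i - 1)%N, GT, (n - i - 1)%N) :: p)]).

Definition Rsub (t n k : nat) (v : comb) : Prop := typed n k v /\ span (Rgen t n k) v.

Definition act (v : comb) (p : path) : comb := [seq (e.1, e.2 ++ p) | e <- v].
Definition hcomp (v : comb) (e : int) : comb := [seq x <- v | pdeg x.2 == e].

(* W k = (preimage of) a subspace of 1_k Delta(n); W is a proper graded
   NB-submodule of Delta(n). *)
Definition proper_graded_submod (t n : nat) (W : nat -> comb -> Prop) : Prop :=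
  (forall k v, Rsub t n k v -> W k v) /\
      (forall k v, W k v -> typed n k v) /\
      (forall k v w, W k v -> W k w -> W k (v ++ w)) /\
      (forall k c v, W k v -> W k (scale c v)) /\
      (forall k v w, typed n k w -> ceq v w -> W k v -> W k w) /\
      (forall k k' v p, W k v -> ptgt k p = Some k' -> W k' (act v p)) /\
      (forall k v e, W k v -> W k (hcomp v e))
    /\ ~ W n [:: (1, [::])].

(* The maximal graded submodule of Delta(n) (the sum of all proper graded
   submodules); L(n) = Delta(n) / rad. *)
Definition rad (t n k : nat) (v : comb) : Prop :=
  typed n k v /\
  exists l : seq ((nat -> comb -> Prop) * comb),
    (forall x, List.In x l -> proper_graded_submod t n x.1 /\ x.1 k x.2) /\
    ceq v (flatten [seq x.2 | x <- l]).

(* Delta(n) = q^{n(n-1)/2} ( ... ), and (q^s V)_d = V_{d+s}: the degree-d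
   piece of 1_k Delta(n) consists of classes of paths of degree d + s. *)
Definition shiftn (n : nat) : int := ('C(n, 2))%:Z.

Definition homog (n k : nat) (d : int) (v : comb) : Prop :=
  typed n k v /\ forall x, List.In x v -> pdeg x.2 = d + shiftn n.

Definition lincomb (c : seq K) (vs : seq comb) : comb :=
  flatten [seq scale x.1 x.2 | x <- zip c vs].

Definition indep_mod (t n k : nat) (vs : seq comb) : Prop :=
  forall c : seq K, size c = size vs -> rad t n k (lincomb c vs) ->
    forall i, nth 0 c i = 0.

Definition has_dim (t n k : nat) (d : int) (N : nat) : Prop :=
  (exists vs : seq comb, size vs = N /\ (forall v, List.In v vs -> homog n k d v)
                          /\ indep_mod t n k vs)
  /\ (forall ws : seq comb, size ws = N.+1 -> (forall v, List.In v ws -> homog n k d v)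
                          -> ~ indep_mod t n k ws).

End Lin.

Definition qF : {fraction {poly int}} := FracField.tofrac 'X.
Definition qint (k : nat) : {fraction {poly int}} :=
  (qF ^+ k - qF ^- k) / (qF - qF^-1).
Definition qfact (n : nat) : {fraction {poly int}} := \prod_(1 <= i < n.+1) qint i.

Definition denom (t n : nat) : {poly {fraction {poly int}}} :=
  \prod_(1 <= k < n.+2 | (k %% 2 == t)%N) (1 - (qint k ^+ 2) *: 'X^2).

(* dim_q of 1_k L(n), given the dimension function and a support bound D k:
   sum_d dim (1_k L(n))_d q^{-d} *)
Definition chcoef (dimf : nat -> int -> nat) (D : nat -> nat) (k : nat)
  : {fraction {poly int}} :=
  \sum_(i < (D k).*2.+1)
     (dimf k (i%:Z - (D k)%:Z))%:R * qF ^ (- (i%:Z - (D k)%:Z)).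

(* Main.v *)
Require Import Defs.
From HB Require Import structures.
From mathcomp Require Import all_boot all_order all_algebra.
From mathcomp Require Import boolp functions generic_quotient ring_quotient zify ring.
Set Implicit Arguments. Unset Strict Implicit. Unset Printing Implicit Defensive.
Import Order.TTheory GRing.Theory Num.Theory.
Local Open Scope ring_scope.

(** In any module, a vector [u] of weight [n] that is killed by the crossings modulo a
submodule containing all lower weights can be straightened: a word [n -> n] of negative
degree kills [u], and a word of degree 0 multiplies it by an integer which does not depend
on the module.  These integers form a functional [lambda] on words, and [L(n)] is the module
generated by [lambda] among functions on words.

An explicit module of functions on words in [N] letters, [N = n] or [n + 1] congruent to [t]
modulo 2, bounds [dim 1_k L(n)] by the number of walks of length [k] on an [N]-dimensional
hypercube between two vertices at distance [n].  For the converse bound, forget the leftmost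
strand: the powers of the leftmost dot filter [L(n)] with [n] shifted copies of [L(n - 1)] and,
when [n] is not congruent to [t], [n + 1] shifted copies of [L(n + 1)], where the existence
of the latter is forced by the upper bound.  The resulting recursive lower bound has the
same total as the upper bound, so both are equalities in every degree, and the recursion
sums to the product formula. *)

(** * Modules over the nil-Brauer relations *)

(** Modules live on bare abelian groups and relations have integer coefficients, so that modules
    over different fields can be multiplied together. Straightening in a product yields one integer
    valid in both factors; this is why [lambda] gives the action of closed words on any lowest
    vector of weight [n], in particular in [Delta(n)] modulo any proper graded submodule.
    Integrality forces the bubble slides to be solved with unit coefficients. In the explicit module
    the dots act by scalars [+- a_i] with all [a_i + a_j] and, for distinct [i] and [j], [a_i - a_j]
    nonzero. A small field has too few such scalars, so the module is built over [K(X)]. The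
    obstacle is the existence of the copies of [L(n + 1)], whose generators might vanish. For [n]
    not congruent to [t], the bound for [L(n - 1)] is already exhausted by copies of [L(n - 2)], and
    a vanishing generator would give [L(n - 1)] one vector too many. Hence the induction on the
    weight [k] for all [n] at once: saturation of [L(n - 1)] in weight [n + 1] follows from the
    lower bound in weight [n]. *)

Definition word := seq (nat * gen).

Definition shiftw (a : nat) (p : word) : word := [seq ((a + e.1)%N, e.2) | e <- p].

(** Words forget the number of strands on the right, which the source object determines. A relation
    is therefore valid with any number of strands added on the right, and only the shift [shiftw] on
    the left appears in [op_rel]. *)
Inductive zrel (t : nat) : nat -> seq (int * word) -> Prop :=
| ZTT : zrel t 2 [:: (1, [:: (0, GT); (0, GT)]%N)]
| ZTTT : zrel t 3 [:: (1, [:: (0, GT); (1, GT); (0, GT)]%N);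
                      (-1, [:: (1, GT); (0, GT); (1, GT)]%N)]
| ZAU : zrel t 0 [:: (1, [:: (0, GCup); (0, GCap)]%N); (- t%:Z, [::])]
| ZL : zrel t 1 [:: (1, [:: (1, GCup); (0, GCap)]%N); (-1, [::])]
| ZR : zrel t 1 [:: (1, [:: (0, GCup); (1, GCap)]%N); (-1, [::])]
| ZAT : zrel t 2 [:: (1, [:: (0, GT); (0, GCap)]%N)]
| ZP : zrel t 3 [:: (1, [:: (0, GT); (1, GCap)]%N);
                    (-1, [:: (1, GT); (0, GCap)]%N)]
| ZXT : zrel t 2 [:: (1, [:: (0, GT); (0, GX)]%N);
                     (-1, [:: (1, GX); (0, GT)]%N);
                     (-1, [::]);
                     (1, [:: (0, GCap); (0, GCup)]%N)]
| ZAX : zrel t 2 [:: (1, [:: (1, GX); (0, GCap)]%N);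
                     (1, [:: (0, GX); (0, GCap)]%N)]
| ZI g h c : zrel t (gsrc g + c + gsrc h)
               [:: (1, [:: (0, g); (gtgt g + c, h)]%N);
                   (-1, [:: (gsrc g + c, h); (0, g)]%N)].

Section Eval.
Variables (E : zmodType) (o : gen -> nat -> E -> E).
Definition ev (p : word) (v : E) : E := foldl (fun v e => o e.2 e.1 v) v p.
Lemma ev_cat p q v : ev (p ++ q) v = ev q (ev p v).
Proof. by rewrite /ev foldl_cat. Qed.
End Eval.

(* An NB-module on an abelian group [E]: [wt k] is the weight space [1_k V], strands are
   numbered from 0 on the left, and an operator with too few strands to act on is 0. *)
Record nbmod (t : nat) (E : zmodType) := NbMod {
  op : gen -> nat -> E -> E;
  wt : nat -> E -> Prop;
  opB : forall g i v w, op g i (v - w) = op g i v - op g i w;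
  wt_0 : forall k, wt k 0;
  wt_B : forall k v w, wt k v -> wt k w -> wt k (v - w);
  wt_op0 : forall g i k v, wt k v -> (i + gsrc g <= k)%N ->
             wt (k - gsrc g + gtgt g) (op g i v);
  op_inv : forall g i k v, wt k v -> (k < i + gsrc g)%N -> op g i v = 0;
  op_rel : forall s r a k v, zrel t s r -> wt k v -> (a + s <= k)%N ->
             \sum_(e <- r) ev op (shiftw a e.2) v *~ e.1 = 0
}.

Section Theory.
Variables (t : nat) (E : zmodType) (M : nbmod t E).

Class inw (k : nat) (v : E) : Prop := Inw { inwP : wt M k v }.
Hint Mode inw - ! : typeclass_instances.

Local Notation X := (op M GX).
Local Notation T := (op M GT).
Local Notation A := (op M GCap).
Local Notation U := (op M GCup).

Lemma op0 g i : op M g i 0 = 0.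
Proof. by have := opB M g i 0 0; rewrite !subrr. Qed.
Lemma opN g i v : op M g i (- v) = - op M g i v.
Proof. by rewrite -sub0r opB op0 sub0r. Qed.
Lemma opD g i v w : op M g i (v + w) = op M g i v + op M g i w.
Proof. by rewrite -{1}[w]opprK opB opN opprK. Qed.

HB.instance Definition _ g i := GRing.isZmodMorphism.Build E E (op M g i) (opB M g i).

Lemma op_sum g i (I : Type) (s : seq I) (F : I -> E) :
  op M g i (\sum_(x <- s) F x) = \sum_(x <- s) op M g i (F x).
Proof. exact: raddf_sum. Qed.
Lemma opMz g i v m : op M g i (v *~ m) = op M g i v *~ m.
Proof. exact: raddfMz. Qed.

Lemma inw0 k : inw k 0. Proof. by constructor; apply: wt_0. Qed.
Lemma inwB k v w : inw k v -> inw k w -> inw k (v - w).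
Proof. by case=> hv [hw]; constructor; apply: wt_B. Qed.
Lemma inwN k v : inw k v -> inw k (- v).
Proof. by move=> hv; rewrite -sub0r; apply: inwB => //; apply: inw0. Qed.
Lemma inwD k v w : inw k v -> inw k w -> inw k (v + w).
Proof. by move=> hv hw; rewrite -[w]opprK; apply: inwB => //; apply: inwN. Qed.

Lemma op_out k g i v {hv : inw k v} : (k < i + gsrc g)%N -> op M g i v = 0.
Proof. by case: hv => hv; apply: op_inv hv. Qed.

Lemma inw_op k g i v : inw k v -> inw (k - gsrc g + gtgt g) (op M g i v).
Proof.
case=> hv; case: (leqP (i + gsrc g) k) => h; first by constructor; apply: wt_op0.
by rewrite (op_inv hv h); apply: inw0.
Qed.
Lemma inwX k i v : inw k v -> inw k (X i v).
Proof.
move=> hv; case: (leqP (i + 1) k) => h; last first.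
  by rewrite (op_out (g := GX) h); apply: inw0.
have := @inw_op _ GX i _ hv => /=; rewrite subnK //; lia.
Qed.
Lemma inwT k i v : inw k v -> inw k (T i v).
Proof.
move=> hv; case: (leqP (i + 2) k) => h; last first.
  by rewrite (op_out (g := GT) h); apply: inw0.
have := @inw_op _ GT i _ hv => /=; rewrite subnK //; lia.
Qed.
Lemma inwA k i v : inw k v -> inw (k - 2) (A i v).
Proof. by move=> hv; have := @inw_op _ GCap i _ hv; rewrite /= addn0. Qed.
Lemma inwU k i v : inw k v -> inw k.+2 (U i v).
Proof. by move=> hv; have := @inw_op _ GCup i _ hv; rewrite /= subn0 addn2. Qed.

Existing Instance inw0.
Existing Instance inwN.
Existing Instance inwB.
Existing Instance inwD.
Existing Instance inwX.
Existing Instance inwT.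
Existing Instance inwA.
Existing Instance inwU.

(** Beyond the interchange relation itself, positions out of range make both sides vanish, so
    commutations hold with no upper bound on the positions. *)
Lemma far0 g h i j k v {hv : inw k v} : (i + gsrc g <= j)%N ->
  op M h (j - gsrc g + gtgt g) (op M g i v) = op M g i (op M h j v).
Proof.
move=> hij; case: (leqP (j + gsrc h) k) => hk; last first.
  rewrite (op_out hk) op0.
  case: (leqP (i + gsrc g) k) => hi; last by rewrite (op_out hi) op0.
  by have hw := @inw_op _ g i _ hv; rewrite (op_out (k := k - gsrc g + gtgt g)) //; lia.
case: hv => hv.
have hs : (i + (gsrc g + (j - i - gsrc g) + gsrc h) <= k)%N by lia.
have := op_rel (ZI t g h (j - i - gsrc g)) hv hs.
rewrite !big_cons big_nil addr0 /= mulrNz mulr1z addn0.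
have -> : (i + (gsrc g + (j - i - gsrc g)) = j)%N by lia.
have -> : (i + (gtgt g + (j - i - gsrc g)) = j - gsrc g + gtgt g)%N by lia.
by move/eqP; rewrite subr_eq0 => /eqP.
Qed.

Lemma far g h i j j' k v {hv : inw k v} : (i + gsrc g <= j)%N -> (j' + gsrc g = j + gtgt g)%N ->
  op M h j' (op M g i v) = op M g i (op M h j v).
Proof. by move=> hij hj; have -> : j' = (j - gsrc g + gtgt g)%N by [lia]; apply: far0. Qed.

Lemma XX i j k v {hv : inw k v} : X i (X j v) = X j (X i v).
Proof.
case: (ltngtP i j) => [h|h|-> //]; first by rewrite [RHS](@far _ _ _ j) //=; lia.
by rewrite (@far _ _ _ i) //=; lia.
Qed.
Lemma XT_far i j k v {hv : inw k v} : (i < j)%N || (j.+1 < i)%N -> X i (T j v) = T j (X i v).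
Proof.
case/orP=> h; last by rewrite (@far _ _ _ i) //=; lia.
by rewrite [RHS](@far _ _ _ j) //=; lia.
Qed.
Lemma AX_lo i j k v {hv : inw k v} : (j < i)%N -> A i (X j v) = X j (A i v).
Proof. by move=> h; rewrite (@far _ _ _ i) //=; lia. Qed.
Lemma AX_hi i j k v {hv : inw k v} : (i.+1 < j)%N -> A i (X j v) = X (j - 2) (A i v).
Proof. by move=> h; rewrite [RHS](@far _ _ _ j) //=; lia. Qed.
Lemma XU_lo i j k v {hv : inw k v} : (j < i)%N -> X j (U i v) = U i (X j v).
Proof. by move=> h; rewrite [RHS](@far _ _ _ i) //=; lia. Qed.
Lemma XU_hi i j k v {hv : inw k v} : (i <= j)%N -> X (j.+2) (U i v) = U i (X j v).
Proof. by move=> h; rewrite (@far _ _ _ j) //=; lia. Qed.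
Lemma TT_far i j k v {hv : inw k v} : (i.+1 < j)%N || (j.+1 < i)%N -> T i (T j v) = T j (T i v).
Proof.
case/orP=> h; last by rewrite (@far _ _ _ i) //=; lia.
by rewrite [RHS](@far _ _ _ j) //=; lia.
Qed.
Lemma AT_lo i j k v {hv : inw k v} : (j.+1 < i)%N -> A i (T j v) = T j (A i v).
Proof. by move=> h; rewrite (@far _ _ _ i) //=; lia. Qed.
Lemma AT_hi i j k v {hv : inw k v} : (i.+1 < j)%N -> A i (T j v) = T (j - 2) (A i v).
Proof. by move=> h; rewrite [RHS](@far _ _ _ j) //=; lia. Qed.
Lemma TU_lo i j k v {hv : inw k v} : (j.+1 < i)%N -> T j (U i v) = U i (T j v).
Proof. by move=> h; rewrite [RHS](@far _ _ _ i) //=; lia. Qed.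
Lemma TU_hi i j k v {hv : inw k v} : (i <= j)%N -> T (j.+2) (U i v) = U i (T j v).
Proof. by move=> h; rewrite (@far _ _ _ j) //=; lia. Qed.
Lemma AU_lo i j k v {hv : inw k v} : (i.+1 < j)%N -> A i (U j v) = U (j - 2) (A i v).
Proof. by move=> h; rewrite [RHS](@far _ _ _ j) //=; lia. Qed.
Lemma AU_hi i j k v {hv : inw k v} : (i <= j)%N -> A (j.+2) (U i v) = U i (A j v).
Proof. by move=> h; rewrite (@far _ _ _ j) //=; lia. Qed.
Lemma UU i j k v {hv : inw k v} : (i <= j)%N -> U i (U j v) = U (j.+2) (U i v).
Proof. by move=> h; rewrite [RHS](@far _ _ _ j) //=; lia. Qed.

Lemma TT0 i k v {hv : inw k v} : T i (T i v) = 0.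
Proof.
case: (leqP (i + 2) k) => h; last by rewrite (op_out (g := GT) h) ?op0.
by case: hv => hv; have := op_rel (ZTT t) hv h; rewrite big_cons big_nil /= addr0 addn0 mulr1z.
Qed.
Lemma braid i k v {hv : inw k v} : T i (T i.+1 (T i v)) = T i.+1 (T i (T i.+1 v)).
Proof.
case: (leqP (i + 3) k) => h; last first.
  rewrite [in LHS](@op_out k _ i.+1); last by move=> /=; lia.
  by rewrite [in RHS](@op_out k _ i.+1) ?op0 //=; lia.
case: hv => hv; have := op_rel (ZTTT t) hv h.
rewrite !big_cons big_nil /= addr0 addn0 mulr1z mulrNz mulr1z addn1.
by move/eqP; rewrite subr_eq0 => /eqP.
Qed.
Lemma AUt i k v {hv : inw k v} : (i <= k)%N -> A i (U i v) = v *+ t.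
Proof.
move=> h; case: hv => hv; have := op_rel (a := i) (ZAU t) hv; rewrite addn0 => /(_ h).
rewrite !big_cons big_nil /= addr0 addn0 mulr1z mulrNz.
by move/eqP; rewrite subr_eq0 => /eqP.
Qed.
Lemma zzl i k v {hv : inw k v} : (i < k)%N -> A i (U i.+1 v) = v.
Proof.
move=> h; case: hv => hv; have := op_rel (a := i) (ZL t) hv; rewrite addn1 => /(_ h).
rewrite !big_cons big_nil /= addr0 addn0 addn1 mulr1z mulrNz mulr1z.
by move/eqP; rewrite subr_eq0 => /eqP.
Qed.
Lemma zzr i k v {hv : inw k v} : (i < k)%N -> A i.+1 (U i v) = v.
Proof.
move=> h; case: hv => hv; have := op_rel (a := i) (ZR t) hv; rewrite addn1 => /(_ h).
rewrite !big_cons big_nil /= addr0 addn0 addn1 mulr1z mulrNz mulr1z.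
by move/eqP; rewrite subr_eq0 => /eqP.
Qed.
Lemma AT0 i k v {hv : inw k v} : A i (T i v) = 0.
Proof.
case: (leqP (i + 2) k) => h; last by rewrite (op_out (g := GT) h) ?op0.
by case: hv => hv; have := op_rel (ZAT t) hv h; rewrite big_cons big_nil /= addr0 addn0 mulr1z.
Qed.
Lemma pitch i k v {hv : inw k v} : A i.+1 (T i v) = A i (T i.+1 v).
Proof.
case: (leqP (i + 3) k) => h; last first.
  rewrite (@op_out k); last by move=> /=; lia.
  by rewrite [in RHS](@op_out k GT) ?op0 //=; lia.
case: hv => hv; have := op_rel (ZP t) hv h.
rewrite !big_cons big_nil /= addr0 addn0 mulr1z mulrNz mulr1z addn1.
by move/eqP; rewrite subr_eq0 => /eqP.
Qed.
Lemma XT i k v {hv : inw k v} : (i.+1 < k)%N ->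
  X i (T i v) = T i (X i.+1 v) + v - U i (A i v).
Proof.
move=> h; case: hv => hv; have := op_rel (a := i) (ZXT t) hv; rewrite addn2 => /(_ h).
rewrite !big_cons big_nil /= addr0 addn0 addn1 mulr1z !mulrNz !mulr1z.
set a := X i _; set b := T i (X _ _); set c := U i _ => e.
by rewrite -[LHS]subr0 -e !opprD !opprK !addrA subrr add0r.
Qed.
Lemma AXs i k v {hv : inw k v} : A i (X i.+1 v) = - A i (X i v).
Proof.
case: (leqP (i + 2) k) => h; last first.
  rewrite (@op_out k); last by move=> /=; lia.
  by rewrite [in RHS](@op_out k GCap) ?op0 ?oppr0 //=; lia.
case: hv => hv; have := op_rel (ZAX t) hv h.
rewrite !big_cons big_nil /= addr0 addn0 mulr1z addn1.
by move/eqP; rewrite addr_eq0 => /eqP.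
Qed.

(** Rotation of [AXs]: a zigzag turns the cup into a cap, where the dot changes legs. The lemmas on
    cups that follow rotate the other cap relations in the same way. *)
Lemma XUs i k v {hv : inw k v} : X i.+1 (U i v) = - X i (U i v).
Proof.
case: (leqP i k) => h; last by rewrite !(@op_out k GCup) ?op0 ?oppr0 //=; lia.
rewrite -[LHS](zzl (i := i.+1)); last by lia.
rewrite -XU_lo // -[LHS]opprK -AXs; congr (- _).
by rewrite -UU // XU_hi // zzr //; lia.
Qed.
Lemma pitchU i k v {hv : inw k v} : T i (U i.+1 v) = T i.+1 (U i v).
Proof.
case: (leqP i.+1 k) => h; last first.
  have [h1|h1] : (k < i \/ k = i)%N by lia.
    by rewrite !(@op_out k GCup) ?op0 //=; lia.
  rewrite (@op_out k GCup i.+1) ?op0 //=; last by lia.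
  by rewrite (@op_out k.+2 GT) //=; lia.
rewrite -[RHS](zzl (i := i.+2)); last by lia.
rewrite -TU_lo // pitch; rewrite -UU; last by lia.
by rewrite TU_hi // zzr //; lia.
Qed.
Lemma TU0 i k v {hv : inw k v} : T i (U i v) = 0.
Proof.
case: (leqP i k) => h; last by rewrite (@op_out k GCup) ?op0 //=; lia.
rewrite -[U i v](zzr (i := i.+1)); last by lia.
by rewrite -AT_lo // pitchU UU // pitchU AT0.
Qed.
Lemma TA2 i k v {hv : inw k v} : (i.+1 < k)%N -> T i v = A i.+2 (T i.+1 (U i v)).
Proof.
by move=> h; rewrite -pitchU AT_lo // zzr.
Qed.
(** The dot slide on the other strand is [XT] rotated by means of [TA2]. *)
Lemma XTs i k v {hv : inw k v} : (i.+1 < k)%N ->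
  X i.+1 (T i v) = T i (X i v) - v + U i (A i v).
Proof.
move=> h; rewrite [in LHS]TA2 // -AX_lo // XT; last by lia.
rewrite XU_hi // zzr; last by lia.
rewrite raddfB raddfD /= -TA2 // zzr; last by lia.
by rewrite AU_hi // addrAC.
Qed.

Definition Xp i r v := iter r (X i) v.

Lemma XpB i r v w : Xp i r (v - w) = Xp i r v - Xp i r w.
Proof. by elim: r => //= r ->; rewrite raddfB. Qed.
HB.instance Definition _ i r := GRing.isZmodMorphism.Build E E (Xp i r) (XpB i r).
Lemma XpAdd i r v w : Xp i r (v + w) = Xp i r v + Xp i r w.
Proof. exact: raddfD. Qed.
Lemma Xp_sum i r (I : Type) (s : seq I) (F : I -> E) :
  Xp i r (\sum_(x <- s) F x) = \sum_(x <- s) Xp i r (F x).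
Proof. exact: raddf_sum. Qed.
Lemma XpMz i r v m : Xp i r (v *~ m) = Xp i r v *~ m.
Proof. exact: raddfMz. Qed.
Lemma XpS i r v : Xp i r.+1 v = Xp i r (X i v).
Proof. exact: iterSr. Qed.
Lemma Xp0 i v : Xp i 0 v = v. Proof. by []. Qed.
Lemma XpE i r v : Xp i r.+1 v = X i (Xp i r v). Proof. by []. Qed.
Lemma XpD i r s v : Xp i r (Xp i s v) = Xp i (r + s) v.
Proof. by rewrite /Xp iterD. Qed.
Lemma inwXp k i r v : inw k v -> inw k (Xp i r v).
Proof. by move=> h; elim: r => //= r hr; apply: inwX. Qed.
Existing Instance inwXp.

Lemma XXp i j r k v {hv : inw k v} : X j (Xp i r v) = Xp i r (X j v).
Proof. by elim: r => //= r <-; rewrite XX. Qed.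
Lemma XpXp i j r s k v {hv : inw k v} : Xp j s (Xp i r v) = Xp i r (Xp j s v).
Proof. by elim: s => //= s ->; rewrite XXp. Qed.
Lemma XpT_far i j r k v {hv : inw k v} : (i < j)%N || (j.+1 < i)%N ->
  Xp i r (T j v) = T j (Xp i r v).
Proof. by move=> h; elim: r => //= r ->; rewrite XT_far. Qed.
Lemma AXp_lo i j r k v {hv : inw k v} : (j < i)%N -> A i (Xp j r v) = Xp j r (A i v).
Proof. by move=> h; elim: r => //= r <-; rewrite AX_lo. Qed.
Lemma AXp_hi i j r k v {hv : inw k v} : (i <= j)%N -> A i (Xp j.+2 r v) = Xp j r (A i v).
Proof. by move=> h; elim: r => //= r <-; rewrite AX_hi ?subn2 //; lia. Qed.
Lemma XpU_lo i j r k v {hv : inw k v} : (j < i)%N -> Xp j r (U i v) = U i (Xp j r v).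
Proof. by move=> h; elim: r => //= r ->; rewrite XU_lo. Qed.
Lemma XpU_hi i j r k v {hv : inw k v} : (i <= j)%N -> Xp (j.+2) r (U i v) = U i (Xp j r v).
Proof. by move=> h; elim: r => //= r ->; rewrite XU_hi. Qed.
Lemma AXps i r k v {hv : inw k v} : A i (Xp i.+1 r v) = A i (Xp i r v) *~ (-1) ^+ r.
Proof.
elim: r v hv => [|r IH] v hv; first by rewrite mulr1z.
by rewrite XpS IH -XXp AXs exprS mulN1r mulrNz mulNrz.
Qed.
Lemma XpUs i r k v {hv : inw k v} : Xp i.+1 r (U i v) = Xp i r (U i v) *~ (-1) ^+ r.
Proof.
elim: r v hv => [|r IH] v hv; first by rewrite mulr1z.
by rewrite XpE IH raddfMz /= XXp XUs raddfN /= -XpS exprS mulN1r mulrNz mulNrz.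
Qed.

Lemma XpT i r k v {hv : inw k v} : (i.+1 < k)%N ->
  Xp i r (T i v) = T i (Xp i.+1 r v) +
    \sum_(b < r) (Xp i (r - b.+1) (Xp i.+1 b v)
                  - Xp i (r - b.+1) (U i (A i (Xp i.+1 b v)))).
Proof.
move=> h; elim: r v hv => [|r IH] v hv; first by rewrite big_ord0 addr0.
rewrite XpS XT // raddfB raddfD /= IH // -XpS big_ord_recl /= subSS subn0 -!addrA.
congr (_ + _); rewrite [LHS]addrC -!addrA; do 2 congr (_ + _).
by apply: eq_bigr => b _; rewrite /bump /= add1n subSS -!XpS.
Qed.

Lemma XpTs i r k v {hv : inw k v} : (i.+1 < k)%N ->
  Xp i.+1 r (T i v) = T i (Xp i r v) -
    \sum_(b < r) (Xp i.+1 (r - b.+1) (Xp i b v)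
                  - Xp i.+1 (r - b.+1) (U i (A i (Xp i b v)))).
Proof.
move=> h; elim: r v hv => [|r IH] v hv; first by rewrite big_ord0 subr0.
rewrite XpS XTs // raddfD raddfB /= IH // -XpS big_ord_recl /= subSS subn0 !opprD opprK -!addrA.
congr (_ + _); rewrite addrC -!addrA; do 2 congr (_ + _).
by congr (- _); apply: eq_bigr => b _; rewrite /bump /= add1n subSS -!XpS.
Qed.

Lemma TXp i r k v {hv : inw k v} : (i.+1 < k)%N ->
  T i (Xp i r v) = Xp i.+1 r (T i v) +
    \sum_(b < r) (Xp i.+1 (r - b.+1) (Xp i b v)
                  - Xp i.+1 (r - b.+1) (U i (A i (Xp i b v)))).
Proof. by move=> h; rewrite XpTs // subrK. Qed.

Lemma TXps i r k v {hv : inw k v} : (i.+1 < k)%N ->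
  T i (Xp i.+1 r v) = Xp i r (T i v) -
    \sum_(b < r) (Xp i (r - b.+1) (Xp i.+1 b v)
                  - Xp i (r - b.+1) (U i (A i (Xp i.+1 b v)))).
Proof. by move=> h; rewrite XpT // addrK. Qed.
End Theory.
#[global] Hint Mode inw - - - - ! : typeclass_instances.
#[global] Existing Instances inw0 inwN inwB inwD inwX inwT inwA inwU inwXp.
#[global] Arguments Xp : simpl never.

(** * Straightening *)

Section Slide.
Variables (t : nat) (E : zmodType) (M : nbmod t E).
Local Notation X := (op M GX).
Local Notation T := (op M GT).
Local Notation A := (op M GCap).
Local Notation U := (op M GCup).
Local Notation Xp := (Xp M).

(** The bubble with [r] dots, inserted just to the left of strand [i]. *)
Definition bub i r v := A i (Xp i r (U i v)).

Lemma bubB i r v w : bub i r (v - w) = bub i r v - bub i r w.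
Proof. by rewrite /bub !raddfB. Qed.
HB.instance Definition _ i r := GRing.isZmodMorphism.Build E E (bub i r) (bubB i r).

Lemma inw_bub k i r v : inw M k v -> inw M k (bub i r v).
Proof. by move=> h; rewrite /bub; have := inwA i (inwXp i r (inwU i h)); rewrite subn2. Qed.

Variables (i k : nat) (Z : int -> E -> Prop).
Hypothesis ik : (i < k)%N.
Hypothesis ZB : forall d v w, Z d v -> Z d w -> Z d (v - w).
Hypothesis Zw : forall d v, Z d v -> inw M k v.
Hypothesis ZX : forall d v, Z d v -> Z (d + 2) (X i v).
Hypothesis ZL : forall d v r, Z d v -> Z (d + 2 * r.+1%:Z) (bub i r.+1 v).
Hypothesis Z0 : forall d, Z d 0.

Let ZN d v : Z d v -> Z d (- v).
Proof. by move=> h; rewrite -sub0r; apply: ZB. Qed.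
Let ZD d v w : Z d v -> Z d w -> Z d (v + w).
Proof. by move=> h h'; rewrite -[w]opprK; apply: ZB => //; apply: ZN. Qed.
Let ZMn d v m : Z d v -> Z d (v *+ m).
Proof. by move=> h; elim: m => [|m IH]; rewrite ?mulr0n // mulrS; apply: ZD. Qed.
Let ZMz d v m : Z d v -> Z d (v *~ m).
Proof. by move=> h; case: m => m; rewrite ?NegzE ?mulrNz; [|apply: ZN]; apply: ZMn. Qed.
Let Zsum d (I : Type) (s : seq I) (F : I -> E) :
  (forall x, Z d (F x)) -> Z d (\sum_(x <- s) F x).
Proof. by move=> h; elim/big_ind: _ => //; apply: ZD. Qed.
Let Zc d d' v : Z d v -> d = d' -> Z d' v. Proof. by move=> h <-. Qed.
Let ZXp d r v : Z d v -> Z (d + 2 * r%:Z) (Xp i r v).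
Proof.
move=> h; elim: r => [|r IH]; first by rewrite mulr0 addr0.
by apply: Zc (ZX IH) _; lia.
Qed.
Let ZLb d v r : Z d v -> Z (d + 2 * r%:Z) (bub i r v).
Proof.
case: r => [|r] h; last exact: ZL.
have hw := Zw h; rewrite /bub Xp0 (@AUt _ _ M _ k) //; last by apply: ltnW.
by rewrite mulr0 addr0; apply: ZMn.
Qed.

Let slideJ d b z : Z d z -> Z (d + 2 * b%:Z - 2) (A i (T i.+1 (Xp i.+1 b (U i z)))).
Proof.
move=> h; have hw := Zw h.
rewrite TXp // opD AXp_hi // -pitch TU0 op0 raddf0 add0r op_sum.
apply: Zsum => c; have hc := ltn_ord c.
rewrite opB !AXp_hi //; apply: ZB.
  rewrite XpUs opMz XpMz; apply: ZMz.
  by apply: Zc (ZXp _ (ZLb c h)) _; lia.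
rewrite zzl; last by lia.
rewrite XpUs opMz XpMz AXp_lo // zzr //; apply: ZMz.
by apply: Zc (ZXp _ (ZXp c h)) _; lia.
Qed.

Let slideK_term d r c y : Z d y -> (c <= r)%N -> Z (d + 2 * c%:Z) (bub i.+1 c y) ->
  Z (d + 2 * r%:Z) (A i (Xp i.+1 (r.+1 - c.+1) (Xp i.+2 c (U i.+1 y))
                  - Xp i.+1 (r.+1 - c.+1) (U i.+1 (A i.+1 (Xp i.+2 c (U i.+1 y)))))).
Proof.
move=> h hc hb; have hw := Zw h; have hbw := inw_bub i.+1 c hw.
rewrite opB !XpUs !(opMz, XpMz); apply: ZB.
  rewrite XpD AXps XpU_lo // zzl //; do 2!apply: ZMz.
  by apply: Zc (ZXp _ h) _; lia.
rewrite -/(bub i.+1 c y) AXps XpU_lo // zzl //; do 2!apply: ZMz.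
by apply: Zc (ZXp _ hb) _; lia.
Qed.

Let slideK_top d r y : Z d y ->
  Z (d + 2 * r%:Z) (A i (Xp i.+1 (r.+1 - r.+1) (Xp i.+2 r (U i.+1 y))
                  - Xp i.+1 (r.+1 - r.+1) (U i.+1 (A i.+1 (Xp i.+2 r (U i.+1 y)))))
                  + bub i.+1 r y *~ (-1) ^+ r).
Proof.
move=> h; have hw := Zw h; have hbw := inw_bub i.+1 r hw.
rewrite subnn !Xp0 opB XpUs !(opMz, XpMz) -/(bub i.+1 r y) zzl // subrK.
by rewrite AXps XpU_lo // zzl //; do 2!apply: ZMz; apply: ZXp.
Qed.

Let slideK d r y : Z d y -> (forall c, (c < r)%N -> Z (d + 2 * c%:Z) (bub i.+1 c y)) ->
   Z (d + 2 * r%:Z) (A i (T i.+1 (Xp i.+2 r.+1 (U i.+1 y))) - bub i.+1 r y *~ (-1) ^+ r).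
Proof.
move=> h hb; have hw := Zw h.
rewrite TXps // TU0 raddf0 sub0r opN op_sum big_ord_recr /= !opprD -addrA; apply: ZD.
  by apply: ZN; apply: Zsum => c; apply: slideK_term => //; [apply: ltnW|apply: hb].
by rewrite -opprD; apply: ZN; apply: slideK_top.
Qed.

Let slideKZ d r y : Z d y -> (forall c, (c <= r)%N -> Z (d + 2 * c%:Z) (bub i.+1 c y)) ->
   Z (d + 2 * r%:Z) (A i (T i.+1 (Xp i.+2 r.+1 (U i.+1 y)))).
Proof.
move=> h hb; rewrite -[A i _](subrK (bub i.+1 r y *~ (-1) ^+ r)); apply: ZD.
  by apply: slideK => // c hc; apply: hb; apply: ltnW.
by apply: ZMz; apply: hb.
Qed.

(** Consider a circle on the right of strand [i], with [r + 2] dots on its right leg, whose left leg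
    crosses strand [i] twice: it is 0 because the crossing squares to 0. Sliding the dots through a
    crossing after a pitchfork move produces the bubble with [r] dots on the right of the strand,
    with coefficient [+-1]; all other terms are dots on strand [i], left bubbles, or right bubbles
    with fewer dots. *)
Lemma slide d r v : Z d v -> Z (d + 2 * r%:Z) (bub i.+1 r v).
Proof.
elim/ltn_ind: r d v => r IH d v h; have hw := Zw h.
have H : A i.+1 (T i (Xp i.+2 r.+2 (T i (U i.+1 v)))) = 0.
  by rewrite XpT_far ?TT0 ?op0 //; lia.
move: H; rewrite pitch pitchU XpTs // opB TT0 sub0r opN 2!op_sum => /eqP.
rewrite oppr_eq0 big_ord_recl subn1 /=.
set S := \sum_(b < _) _.
have hS : Z (d + 2 * r%:Z) S.
  apply: Zsum => b; have hb := ltn_ord b; rewrite /bump /= add1n !opB; apply: ZB.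
    rewrite XpXp XpU_hi //.
    by apply: Zc (slideJ b.+1 (ZXp (r.+2 - b.+2) h)) _; lia.
  rewrite [in A i.+1 _]XpUs !(opMz, XpMz) AXp_lo // zzr; last by lia.
  apply: ZMz; rewrite !subSS.
  have [hbr|hbr] : (b < r \/ b = r :> nat)%N by lia.
    2: by rewrite hbr subnn Xp0 TU0 op0.
  have -> : (r - b = (r - b.+1).+1)%N by lia.
  apply: Zc (slideKZ (ZXp b.+1 h) _) _; last by lia.
  by move=> c hc; apply: IH; [lia|apply: ZXp].
rewrite !opB Xp0 zzr; last by lia.
have hP : Z (d + 2 * r%:Z) (A i (T i.+1 (Xp i.+2 r.+1 (U i v)))).
  by rewrite XpU_hi //; apply: Zc (slideJ 0 (ZXp r.+1 h)) _; lia.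
have hK := slideK h (fun c hc => IH c hc d v h).
set P := A i (T i.+1 (Xp i.+2 r.+1 (U i v))) in hP *.
set Q := A i (T i.+1 (Xp i.+2 r.+1 (U i.+1 v))) in hK *.
move/eqP => e.
have e2 : bub i.+1 r v *~ (-1) ^+ r = P + S - (Q - bub i.+1 r v *~ (-1) ^+ r).
  have -> : P + S = Q by apply/eqP; rewrite -subr_eq0 addrAC; apply/eqP.
  by rewrite opprB addrC subrK.
have -> : bub i.+1 r v = bub i.+1 r v *~ (-1) ^+ r *~ (-1) ^+ r.
  by rewrite -mulrzA -expr2 sqrr_sign mulr1z.
apply: ZMz; rewrite e2; apply: ZB => //; exact: ZD.
Qed.
End Slide.

Record submodule t E (M : nbmod t E) (D : nat -> E -> Prop) : Prop := Submodule {
  sub_wt : forall k v, D k v -> wt M k v;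
  sub_0 : forall k, D k 0;
  sub_B : forall k v w, D k v -> D k w -> D k (v - w);
  sub_op : forall g i k v, D k v -> D (k - gsrc g + gtgt g)%N (op M g i v)
}.

Section Submodule.
Variables (t : nat) (E : zmodType) (M : nbmod t E) (D : nat -> E -> Prop).
Hypothesis DM : submodule M D.
Lemma sub_inw k v : D k v -> inw M k v.
Proof. by move/(sub_wt DM). Qed.
Lemma sub_N k v : D k v -> D k (- v).
Proof. by move=> h; rewrite -sub0r; apply: (sub_B DM) => //; apply: (sub_0 DM). Qed.
Lemma sub_D k v w : D k v -> D k w -> D k (v + w).
Proof. by move=> h h'; rewrite -[w]opprK; apply: (sub_B DM) => //; apply: sub_N. Qed.
Lemma sub_X k i v : D k v -> D k (op M GX i v).
Proof.
move=> h; have hv := sub_inw h; case: (leqP (i + 1) k) => hi; last first.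
  by rewrite (@op_out _ _ _ k) //; apply: (sub_0 DM).
by have := sub_op DM GX i h => /=; rewrite subnK //; lia.
Qed.
Lemma sub_T k i v : D k v -> D k (op M GT i v).
Proof.
move=> h; have hv := sub_inw h; case: (leqP (i + 2) k) => hi; last first.
  by rewrite (@op_out _ _ _ k) //; apply: (sub_0 DM).
by have := sub_op DM GT i h => /=; rewrite subnK //; lia.
Qed.
Lemma sub_A k i v : D k v -> D (k - 2) (op M GCap i v).
Proof. by move/(sub_op DM GCap i) => /=; rewrite addn0. Qed.
Lemma sub_U k i v : D k v -> D k.+2 (op M GCup i v).
Proof. by move/(sub_op DM GCup i) => /=; rewrite subn0 addn2. Qed.
Lemma sub_Xp k i r v : D k v -> D k (Xp M i r v).
Proof. by move=> h; elim: r => // r IH; rewrite XpE; apply: sub_X. Qed.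
Lemma sub_bub k i r v : D k v -> D k (bub M i r v).
Proof. by move=> h; have := sub_A i (sub_Xp i r (sub_U i h)); rewrite subn2. Qed.
End Submodule.

(** * Caps crossing several strands *)

Section LongCaps.
Variables (t : nat) (E : zmodType) (M : nbmod t E).
Local Notation X := (op M GX).
Local Notation T := (op M GT).
Local Notation A := (op M GCap).
Local Notation U := (op M GCup).
Local Notation Xp := (Xp M).

Lemma bub_op g j r k v {hv : inw M k v} : op M g j (bub M 0 r v) = bub M 0 r (op M g j v).
Proof.
rewrite /bub (@far _ _ _ GCap g 0 j.+2) //=; last by lia.
congr (A 0 _); have -> : op M g j.+2 (Xp 0 r (U 0 v)) = Xp 0 r (op M g j.+2 (U 0 v)).
  elim: r => // r IH; rewrite !XpE -IH.
  by rewrite (@far _ _ _ GX g 0 j.+2) //=; lia.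
by rewrite (@far _ _ _ GCup g 0 j) //=; lia.
Qed.

(** Carries strand [i] to the right across [m] strands. [taud] below applies the same crossings in
    the opposite order, carrying strand [i + m] to the left. *)
Fixpoint tau (i m : nat) (v : E) : E := if m is m'.+1 then T (i + m') (tau i m' v) else v.

Lemma tauB i m v w : tau i m (v - w) = tau i m v - tau i m w.
Proof. by elim: m => //= m ->; rewrite opB. Qed.
HB.instance Definition _ i m := GRing.isZmodMorphism.Build E E (tau i m) (tauB i m).
Lemma tauS i m v : tau i m.+1 v = tau i.+1 m (T i v).
Proof. by elim: m => [|m IH] /=; rewrite ?addn0 // -IH /= addSnnS. Qed.
Lemma tau_split i m q v : (q < m)%N ->
  tau i m v = tau (i + q).+1 (m - q.+1) (T (i + q) (tau i q v)).
Proof.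
move=> h; have {1}-> : m = (q + (m - q.+1).+1)%N by lia.
rewrite -tauS; elim: (m - q.+1)%N => [|p IH]; first by rewrite addn1 /= addn0.
by rewrite addnS [LHS]/= IH addnA.
Qed.
Lemma inw_tau k i m v : inw M k v -> inw M k (tau i m v).
Proof. by move=> h; elim: m => //= m hm; apply: inwT. Qed.
Existing Instance inw_tau.

Lemma X_tau i m j k v {hv : inw M k v} : (j < i)%N || (i + m < j)%N ->
  X j (tau i m v) = tau i m (X j v).
Proof. by elim: m => //= m IH h; rewrite XT_far ?IH //; lia. Qed.
Lemma Xp_tau i m j r k v {hv : inw M k v} : (j < i)%N || (i + m < j)%N ->
  Xp j r (tau i m v) = tau i m (Xp j r v).
Proof. by move=> h; elim: r => // r IH; rewrite !XpE IH X_tau. Qed.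
Lemma T_tau i m j k v {hv : inw M k v} : (j.+1 < i)%N || (i + m < j)%N ->
  T j (tau i m v) = tau i m (T j v).
Proof. by elim: m => //= m IH h; rewrite TT_far ?IH //; lia. Qed.
Lemma A_tau i m j k v {hv : inw M k v} : (i + m < j)%N -> A j (tau i m v) = tau i m (A j v).
Proof. by elim: m => //= m IH h; rewrite AT_lo ?IH //; lia. Qed.
Lemma U_tau i m j k v {hv : inw M k v} : (i + m < j)%N -> tau i m (U j v) = U j (tau i m v).
Proof. by elim: m => //= m IH h; rewrite IH; [rewrite TU_lo //; lia|lia]. Qed.
Lemma U_tau_hi i m j k v {hv : inw M k v} : (j <= i)%N -> tau i.+2 m (U j v) = U j (tau i m v).
Proof. by elim: m => //= m IH h; rewrite IH // !addSn TU_hi //; lia. Qed.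
Lemma tauT i m j k v {hv : inw M k v} : (i <= j)%N -> (j.+1 < i + m)%N ->
  tau i m (T j.+1 v) = T j (tau i m v).
Proof.
elim: m => [|m IH] h h2; first by lia.
have [h3|h3] : (j.+1 < i + m \/ i + m = j.+1)%N by lia.
  by rewrite /= IH // TT_far //; lia.
case: m IH h2 h3 => [|m] IH h2 h3; first by lia.
have e : (i + m = j)%N by lia.
by rewrite /= h3 e -T_tau ?e //; [rewrite -braid|lia].
Qed.

Fixpoint taud (s m : nat) (v : E) : E := if m is m'.+1 then taud s m' (T (s + m') v) else v.
Lemma taudMz s m v z : taud s m (v *~ z) = taud s m v *~ z.
Proof. by elim: m v => //= m IH v; rewrite opMz IH. Qed.

Lemma T_taud i m j k v {hv : inw M k v} : (i + m < j)%N -> T j (taud i m v) = taud i m (T j v).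
Proof. by elim: m v hv => //= m IH v hv h; rewrite IH; [rewrite TT_far //; lia|lia]. Qed.
Lemma X_taud i m j k v {hv : inw M k v} : (i + m < j)%N -> X j (taud i m v) = taud i m (X j v).
Proof. by elim: m v hv => //= m IH v hv h; rewrite IH; [rewrite XT_far //; lia|lia]. Qed.
Lemma A_taud i m j k v {hv : inw M k v} : (i + m < j)%N -> A j (taud i m v) = taud i m (A j v).
Proof. by elim: m v hv => //= m IH v hv h; rewrite IH; [rewrite AT_lo //; lia|lia]. Qed.
Lemma tauU s m k v {hv : inw M k v} : tau s.+1 m (U s v) = taud s m (U (s + m) v).
Proof.
elim: m => [|m IH]; first by rewrite addn0.
rewrite /= IH addSn T_taud; last by lia.
by rewrite addnS pitchU.
Qed.

(* the cap joining strands [i] and [i + m + 1], crossing the [m] strands in between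
   and carrying [r] dots *)
Definition lcap i m r v := A (i + m) (Xp (i + m) r (tau i m v)).
Lemma lcapB i m r v w : lcap i m r (v - w) = lcap i m r v - lcap i m r w.
Proof. by rewrite /lcap !raddfB. Qed.
HB.instance Definition _ i m r := GRing.isZmodMorphism.Build E E (lcap i m r) (lcapB i m r).
Lemma lcap_out i m r k v {hv : inw M k v} : (k < i + m + 2)%N -> lcap i m r v = 0.
Proof. by move=> h; rewrite /lcap (@op_out _ _ _ k). Qed.

Lemma lcap_at i m q r v : (q < m)%N ->
  A (i + m) (Xp (i + m) r (tau (i + q).+1 (m - q.+1) v)) = lcap (i + q).+1 (m - q.+1) r v.
Proof. by move=> h; rewrite /lcap; have -> : ((i + q).+1 + (m - q.+1) = i + m)%N by lia. Qed.
Lemma sub_lcap D i m r k v : submodule M D -> D k v -> D (k - 2)%N (lcap i m r v).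
Proof.
move=> DM h; apply: (sub_A DM); apply: (sub_Xp DM).
by elim: m => //= m IH; apply: (sub_T DM).
Qed.
Lemma lcap_tau i q m r k v {hv : inw M k v} :
  lcap (i + q).+1 m r (tau i q v) = tau i q (lcap (i + q).+1 m r v).
Proof.
rewrite /lcap.
have -> : tau (i + q).+1 m (tau i q v) = tau i q (tau (i + q).+1 m v).
  by elim: m => //= m ->; rewrite T_tau //; lia.
by rewrite Xp_tau ?A_tau //; lia.
Qed.

(** Pulling this zigzag straight leaves one strand running across the [m] others, whence [taud]; the
    sign comes from moving the dots to the other leg of a cup. *)
Lemma lcapU s m r k v {hv : inw M k v} : (s + m < k)%N ->
  lcap s.+1 m r (U s v) = taud s m (Xp (s + m) r v) *~ (-1) ^+ r.
Proof.
move=> h; rewrite /lcap tauU addSn.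
have -> : Xp (s + m).+1 r (taud s m (U (s + m) v)) = taud s m (Xp (s + m).+1 r (U (s + m) v)).
  by elim: r => // r IH; rewrite !XpE IH X_taud //; lia.
by rewrite A_taud ?XpUs ?opMz ?taudMz ?AXp_lo ?zzr //; lia.
Qed.

Lemma tauX i m k v {hv : inw M k v} : (i + m < k)%N ->
  tau i m (X i v) = X (i + m) (tau i m v) +
   \sum_(s < m) (tau (i + s).+1 (m - s.+1) (tau i s v)
                - tau (i + s).+1 (m - s.+1) (U (i + s) (A (i + s) (tau i s v)))).
Proof.
elim: m => [|m IH] h; first by rewrite big_ord0 addn0 addr0.
rewrite /= IH; last by lia.
set w := tau i m v; have hw : inw M k w by apply: inw_tau.
have -> : T (i + m) (X (i + m) w + \sum_(s < m) (tau (i + s).+1 (m - s.+1) (tau i s v)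
      - tau (i + s).+1 (m - s.+1) (U (i + s) (A (i + s) (tau i s v))))) =
   X (i + m).+1 (T (i + m) w) + (w - U (i + m) (A (i + m) w)) +
   \sum_(s < m) T (i + m) (tau (i + s).+1 (m - s.+1) (tau i s v)
      - tau (i + s).+1 (m - s.+1) (U (i + s) (A (i + s) (tau i s v)))).
  rewrite opD op_sum XTs; last by lia.
  by congr (_ + _); rewrite -[_ - w + _]addrA -[- w + _]opprK opprD opprK subrK.
rewrite -addrA addnS big_ord_recr /= subnn /= -/w; congr (_ + _); rewrite addrC; congr (_ + _).
apply: eq_bigr => s _; have hs := ltn_ord s; rewrite opB.
have -> : (m.+1 - s.+1 = (m - s.+1).+1)%N by lia.
by rewrite /=; have -> : ((i + s).+1 + (m - s.+1) = i + m)%N by lia.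
Qed.
End LongCaps.
#[global] Existing Instances inw_tau.

(** * Elimination of caps *)

Section Straighten.
Variables (t : nat) (E : zmodType) (M : nbmod t E).
Local Notation X := (op M GX).
Local Notation T := (op M GT).
Local Notation A := (op M GCap).
Local Notation U := (op M GCup).
Local Notation Xp := (Xp M).
Local Notation lcap := (lcap M).
Local Notation tau := (tau M).

Variables (n : nat) (u : E) (D : nat -> E -> Prop).
Hypothesis Dsub : submodule M D.
Hypothesis uw : inw M n u.
Hypothesis uT : forall i, D n (T i u).
Hypothesis low : forall k v, (k < n)%N -> inw M k v -> D k v.

(* left bubbles replace the caps: the point of the next lemmas is that this set is stable
   under caps *)
Inductive capfree : nat -> int -> E -> Prop :=
| CFu : capfree n 0 u
| CFD k d v : D k v -> capfree k d v
| CFB k d v w : capfree k d v -> capfree k d w -> capfree k d (v - w)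
| CFX k d i v : capfree k d v -> capfree k (d + 2) (X i v)
| CFT k d i v : capfree k d v -> capfree k (d - 2) (T i v)
| CFU k d i v : capfree k d v -> capfree k.+2 d (U i v)
| CFb k d r v : capfree k d v -> capfree k (d + 2 * r.+1%:Z) (bub M 0 r.+1 v).
Local Notation Y := capfree.

Lemma CFw k d v : Y k d v -> inw M k v.
Proof.
elim=> {k d v}; first by [].
- by move=> k d v /(sub_wt Dsub).
- by move=> k d v w _ h _ h'; apply: inwB.
- by move=> k d i v _ h; apply: inwX.
- by move=> k d i v _ h; apply: inwT.
- by move=> k d i v _ h; apply: inwU.
- by move=> k d r v _ h; apply: inw_bub.
Qed.
Lemma CF0 k d : Y k d 0. Proof. by apply: CFD; apply: (sub_0 Dsub). Qed.
Lemma CFN k d v : Y k d v -> Y k d (- v).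
Proof. by move=> h; rewrite -sub0r; apply: CFB => //; apply: CF0. Qed.
Lemma CFadd k d v w : Y k d v -> Y k d w -> Y k d (v + w).
Proof. by move=> h h'; rewrite -[w]opprK; apply: CFB => //; apply: CFN. Qed.
Lemma CFMn k d v m : Y k d v -> Y k d (v *+ m).
Proof.
by move=> h; elim: m => [|m IH]; [apply: CF0|rewrite mulrS; apply: CFadd].
Qed.
Lemma CFMz k d v m : Y k d v -> Y k d (v *~ m).
Proof. by move=> h; case: m => m; rewrite ?NegzE ?mulrNz; [|apply: CFN]; apply: CFMn. Qed.
Lemma CFsum k d (I : Type) (s : seq I) (F : I -> E) :
  (forall x, Y k d (F x)) -> Y k d (\sum_(x <- s) F x).
Proof. by move=> h; elim/big_ind: _ => //; [apply: CF0|apply: CFadd]. Qed.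
Lemma CFc k d k' d' v : Y k d v -> k = k' -> d = d' -> Y k' d' v.
Proof. by move=> h <- <-. Qed.
Lemma CFXp k d i r v : Y k d v -> Y k (d + 2 * r%:Z) (Xp i r v).
Proof.
move=> h; elim: r => [|r IH]; first by rewrite mulr0 addr0.
by rewrite XpE; apply: CFc (CFX i IH) _ _; lia.
Qed.
Lemma CFtau k d i m v : Y k d v -> Y k (d - 2 * m%:Z) (tau i m v).
Proof.
move=> h; elim: m => [|m IH]; first by rewrite mulr0 subr0.
by apply: CFc (CFT (i + m) IH) _ _; lia.
Qed.
Lemma CFtaud k d i m v : Y k d v -> Y k (d - 2 * m%:Z) (taud M i m v).
Proof.
elim: m d v => [|m IH] d v h; first by rewrite mulr0 subr0.
by apply: CFc (IH _ _ (CFT (i + m) h)) _ _; lia.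
Qed.
Lemma CFbub k d i r v : Y k d v -> Y k (d + 2 * r%:Z) (bub M i r v).
Proof.
move=> h; have hw := CFw h.
case: (leqP i k) => hi; last first.
  by rewrite /bub (@op_out _ _ _ k GCup) ?raddf0 ?op0 ?addn0 //; apply: CF0.
elim: i hi r d v h hw => [|i IH] hi r d v h hw.
  case: r => [|r]; last exact: CFb.
  by rewrite /bub Xp0 (@AUt _ _ _ _ k) // mulr0 addr0; apply: CFMn.
apply: (@slide _ _ M i k (Y k)) => //.
- by move=> *; apply: CFB.
- by move=> d' v'; apply: CFw.
- by move=> d' v'; apply: CFX.
- by move=> d' v' r' h'; apply: IH; [apply: ltnW|exact: h'|apply: CFw h'].
- by move=> d'; apply: CF0.
Qed.

(** All long dotted caps at once: moving a cap past a crossing may lengthen it, and past a dot may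
    decorate it, so the property for [A i] alone would not be inductive. *)
Definition capped k d v := forall i m r, Y (k - 2) (d + 2 * r%:Z - 2 * m%:Z) (lcap i m r v).
Local Notation P := capped.

Section Step.
Variables (k : nat) (d : int) (v : E).
Hypotheses (hY : Y k d v) (hP : P k d v).
Let hw : inw M k v := CFw hY.
Existing Instance hw.

Let corr1 i m r q : (q < m)%N ->
  Y (k - 2) (d + 2 + 2 * r%:Z - 2 * m%:Z) (lcap (i + q).+1 (m - q.+1) r (tau i q v)).
Proof.
by move=> h; rewrite lcap_tau; apply: CFc (CFtau i q (hP (i + q).+1%N (m - q.+1)%N r)) _ _; lia.
Qed.
Let corr2 i m r q : (q < m)%N -> (i + m + 1 < k)%N ->
  Y (k - 2) (d + 2 + 2 * r%:Z - 2 * m%:Z)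
    (lcap (i + q).+1 (m - q.+1) r (U (i + q) (A (i + q) (tau i q v)))).
Proof.
move=> h hk.
have hz : Y (k - 2) (d + 2 * 0 - 2 * q%:Z) (A (i + q) (tau i q v)) := hP i q 0.
have hzw := CFw hz.
rewrite lcapU; last by lia.
by apply: CFMz; apply: CFc (CFtaud _ _ (CFXp _ r hz)) _ _; lia.
Qed.

Lemma cappedX l : P k (d + 2) (X l v).
Proof.
move=> i m r.
case: (leqP (i + m + 2) k) => hk; last by rewrite lcap_out //; apply: CF0.
(* The dot lies to the left of the cap, on its left foot, on a strand that it crosses, on its right
   foot, or to its right. *)
have [hl|[hl|[hl|[hl|hl]]]] : (l < i \/ l = i \/ i < l <= i + m \/ l = (i + m).+1
    \/ i + m + 2 <= l)%N by lia.
- rewrite /lcap -X_tau ?hl // -XXp AX_lo //; last by lia.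
  by apply: CFc (CFX l (hP i m r)) _ _; lia.
- subst l; rewrite /lcap tauX; last by lia.
  rewrite XpAdd opD -XpS; apply: CFadd.
    by apply: CFc (hP i m r.+1) _ _; lia.
  rewrite Xp_sum op_sum; apply: CFsum => q; have hq := ltn_ord q.
  by rewrite XpB opB !lcap_at //; apply: CFB; [apply: corr1|apply: corr2 => //; lia].
- have [q hq] : exists q, l = (i + q).+1 by exists (l - i.+1)%N; lia.
  subst l; have {hl} hq : (q < m)%N by lia.
  have -> : lcap i m r (X (i + q).+1 v) = X (i + q) (lcap i m r v)
        - lcap (i + q).+1 (m - q.+1) r (tau i q v)
        + lcap (i + q).+1 (m - q.+1) r (U (i + q) (A (i + q) (tau i q v))).
    rewrite /lcap -AX_lo; last by lia.
    rewrite XXp !(tau_split M _ _ hq) -/(lcap _ _ _ _) -X_tau; last by lia.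
    have -> : T (i + q) (X (i + q).+1 (tau i q v)) = X (i + q) (T (i + q) (tau i q v))
        - (tau i q v - U (i + q) (A (i + q) (tau i q v))).
      by rewrite XT ?opprB ?addrA ?subrK ?addrK //; lia.
    rewrite !(tauB, XpB, opB) opprB !lcap_at // X_tau; last by lia.
    by rewrite lcap_at // addrA addrAC.
  apply: CFadd; last by apply: corr2 => //; lia.
  apply: CFB; last by apply: corr1.
  by apply: CFc (CFX _ (hP i m r)) _ _; lia.
- subst l; rewrite /lcap -X_tau; last by lia.
  rewrite -XXp AXs; apply: CFN.
  by apply: CFc (hP i m r.+1) _ _; lia.
- rewrite /lcap -X_tau; last by lia.
  rewrite -XXp AX_hi; last by lia.
  by apply: CFc (CFX _ (hP i m r)) _ _; lia.
Qed.

Let capT_low i m r l : (l.+1 < i)%N -> Y (k - 2) (d - 2 + 2 * r%:Z - 2 * m%:Z) (lcap i m r (T l v)).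
Proof.
move=> hl; rewrite /lcap -T_tau; last by lia.
rewrite XpT_far; last by lia.
rewrite AT_lo; last by lia.
by apply: CFc (CFT l (hP i m r)) _ _; lia.
Qed.

Let capT_base i r : Y (k - 2) (d - 2 + 2 * r%:Z) (lcap i 0 r (T i v)).
Proof.
case: (leqP (i + 2) k) => hk; last first.
  by rewrite lcap_out ?addn0 //; apply: CF0.
rewrite /lcap /= addn0 XpT; last by lia.
rewrite opD AT0 add0r op_sum; apply: CFsum => b; have hb := ltn_ord b.
rewrite opB; apply: CFB.
  rewrite XpXp AXps XpD; apply: CFMz.
  have h := hP i 0 (b + (r - b.+1))%N; rewrite /lcap addn0 /= in h.
  by apply: CFc h _ _; lia.
have h := hP i 0 b; rewrite /lcap addn0 /= in h.
rewrite -/(bub M i _ _) AXps; apply: CFc (CFbub i (r - b.+1) (CFMz ((-1) ^+ b) h)) _ _ => //.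
lia.
Qed.

Let capT_right i m r :
  Y (k - 2) (d - 2 + 2 * r%:Z - 2 * m%:Z) (lcap i m r (T (i + m).+1 v)).
Proof.
case: (leqP (i + m + 3) k) => hk; last first.
  by rewrite (@op_out _ _ _ k GT) ?raddf0 //=; [apply: CF0|lia].
rewrite /lcap -T_tau; last by lia.
set s := (i + m)%N in hk *.
rewrite XpT_far; last by lia.
rewrite -pitch TXp; last by lia.
rewrite opD; apply: CFadd.
  have -> : A s.+1 (Xp s.+1 r (T s (tau i m v))) = lcap i m.+1 r v by rewrite /lcap addnS.
  by apply: CFc (hP i m.+1 r) _ _; lia.
rewrite op_sum; apply: CFsum => b; have hb := ltn_ord b.
rewrite opB; apply: CFB.
  rewrite XpXp AXp_lo // Xp_tau; last by lia.
  rewrite A_tau; last by lia.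
  have h := hP s.+1 0 (r - b.+1)%N; rewrite /lcap addn0 /= in h.
  by apply: CFc (CFXp s b (CFtau i m h)) _ _; lia.
rewrite XpUs opMz AXp_lo // zzr; last by lia.
by apply: CFMz; apply: CFc (CFXp s (r - b.+1) (hP i m b)) _ _; lia.
Qed.

Lemma cappedT l : P k (d - 2) (T l v).
Proof.
move=> i m r.
case: (leqP (i + m + 2) k) => hk; last by rewrite lcap_out //; apply: CF0.
(* The crossing lies to the left of the cap; at its left foot from outside, where it lengthens the
   cap; at its left foot from inside, where it doubles a crossing; between two crossed strands,
   where it slides through by a braid move; between the last crossed strand and the right foot; at
   the right foot from outside; or to the right. *)
have [hl|[hl|[hl|[hl|[[hl hm]|[hl|hl]]]]]] : (l.+1 < i \/ l.+1 = i \/ l = i \/ i < l < i + m \/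
   (l = i + m /\ 0 < m) \/ l = (i + m).+1 \/ i + m + 2 <= l)%N by lia.
- exact: capT_low.
- subst i; have -> : lcap l.+1 m r (T l v) = lcap l m.+1 r v.
    by rewrite /lcap addSnnS tauS.
  by apply: CFc (hP l m.+1 r) _ _; lia.
- subst l; case: m hk => [|m] hk; first by rewrite mulr0 subr0; apply: capT_base.
  by rewrite /lcap tauS TT0 raddf0 raddf0 op0; apply: CF0.
- case: l hl => [|l] hl; first by lia.
  rewrite /lcap tauT; [|lia|lia].
  rewrite XpT_far; last by lia.
  rewrite AT_lo; last by lia.
  by apply: CFc (CFT l (hP i m r)) _ _; lia.
- subst l; case: m hm hk => // m _ hk.
  rewrite /lcap /= addnS -T_tau; last by lia.
  set p := (i + m)%N in hk *; set z := tau i m v.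
  have hz : inw M k z by apply: inw_tau.
  rewrite XpTs; last by lia.
  rewrite opB pitch (XpT_far (i := p) (j := p.+1) r (v := z)); last by lia.
  rewrite TT0 op0 sub0r op_sum; apply: CFN; apply: CFsum => b; have hb := ltn_ord b.
  rewrite opB; apply: CFB.
    rewrite XpXp AXp_lo // T_tau; last by lia.
    rewrite Xp_tau; last by lia.
    rewrite A_tau; last by lia.
    have h := capT_base p.+1 (r - b.+1)%N; rewrite /lcap addn0 /= in h.
    by apply: CFc (CFXp p b (CFtau i m h)) _ _; lia.
  rewrite XpUs opMz AXp_lo // zzr; last by lia.
  rewrite T_tau; last by lia.
  by apply: CFMz; apply: CFc (CFXp p (r - b.+1) (capT_right i m b)) _ _; lia.
- by subst l; apply: capT_right.
- rewrite /lcap -T_tau; last by lia.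
  rewrite XpT_far; last by lia.
  rewrite AT_hi; last by lia.
  by apply: CFc (CFT _ (hP i m r)) _ _; lia.
Qed.

(** A dotted curl: without dots it vanishes, and sliding the dots through its crossing leaves dots
    and bubbles beside one strand. *)
Let cappedU_curl p r kz dz z : Y kz dz z -> (p < kz)%N ->
  Y kz (dz + 2 * r%:Z - 2) (A p.+1 (Xp p.+1 r (T p (U p.+1 z)))).
Proof.
move=> hz hp; have hzw := CFw hz.
rewrite XpTs; last by lia.
rewrite opB pitch XpU_lo // TU0 op0 sub0r op_sum; apply: CFN; apply: CFsum => b.
have hb := ltn_ord b.
rewrite opB; apply: CFB.
  by rewrite XpU_lo //; apply: CFc (CFbub p.+1 (r - b.+1) (CFXp p b hz)) _ _; lia.
rewrite XpUs opMz AXp_lo // zzr; last by lia.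
rewrite XpU_lo // zzl //; apply: CFMz.
by apply: CFc (CFXp p (r - b.+1) (CFXp p b hz)) _ _; lia.
Qed.

Lemma cappedU l : P k.+2 d (U l v).
Proof.
move=> i m r; rewrite !subSS subn0.
case: (leqP (i + m) k) => hk; last by rewrite lcap_out; [apply: CF0|lia].
have [hl|[hl|[hl|[hl|[[hl hm]|[hl|hl]]]]]] : (l.+1 < i \/ l.+1 = i \/ l = i \/ i < l < i + m \/
   (l = i + m /\ 0 < m) \/ l = (i + m).+1 \/ i + m + 2 <= l)%N by lia.
- case: i hl hk => [|[|i]] hl hk; try lia.
  rewrite /lcap U_tau_hi; last by lia.
  rewrite !addSn XpU_hi; last by lia.
  rewrite AU_hi; last by lia.
  by apply: CFc (CFU l (hP i m r)) _ _; lia.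
- subst i; case: (leqP k (l + m)) => hk2.
    by rewrite lcap_out; [apply: CF0|lia].
  rewrite lcapU //; apply: CFMz.
  exact: CFtaud (CFXp _ _ hY).
- subst l; case: m hk => [|m] hk.
    by rewrite /lcap /= addn0 mulr0 subr0; apply: CFbub.
  by rewrite /lcap tauS TU0 !raddf0; apply: CF0.
- have hq : ((l - i.+1) < m)%N by lia.
  rewrite /lcap (tau_split M _ _ hq).
  have -> : (m - (l - i.+1).+1 = (m - (l - i.+1).+2).+1)%N by lia.
  rewrite U_tau; last by lia.
  have e : (i + (l - i.+1) = l.-1)%N by lia.
  rewrite tauS e prednK; last by lia.
  case: l hl hq e => // l hl hq e /=.
  by rewrite pitchU TT0 !raddf0; apply: CF0.
- subst l; case: m hm hk => // m _ hk; rewrite /lcap /= addnS U_tau; last by lia.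
  apply: CFc (cappedU_curl r (CFtau i m hY) _) _ _ => //; lia.
- subst l; rewrite /lcap U_tau; last by lia.
  rewrite XpU_lo; last by lia.
  case: (ltnP (i + m) k) => hk2; last first.
    rewrite (@op_out _ _ _ k GCup); last by rewrite /=; lia.
    by rewrite op0; apply: CF0.
  by rewrite zzl //; apply: CFc (CFXp _ r (CFtau i m hY)) _ _; lia.
- case: (leqP l k) => hk2; last first.
    by rewrite (@op_out _ _ _ k GCup) ?raddf0 //=; [apply: CF0|lia].
  rewrite /lcap U_tau; last by lia.
  rewrite XpU_lo; last by lia.
  rewrite AU_lo; last by lia.
  by apply: CFc (CFU _ (hP i m r)) _ _; lia.
Qed.

Lemma cappedb r : P k (d + 2 * r.+1%:Z) (bub M 0 r.+1 v).
Proof.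
move=> i m r'.
have -> : lcap i m r' (bub M 0 r.+1 v) = bub M 0 r.+1 (lcap i m r' v).
  rewrite /lcap; have -> : tau i m (bub M 0 r.+1 v) = bub M 0 r.+1 (tau i m v).
    by elim: m => //= m ->; rewrite bub_op.
  have -> : Xp (i + m) r' (bub M 0 r.+1 (tau i m v)) = bub M 0 r.+1 (Xp (i + m) r' (tau i m v)).
    by elim: r' => // s IH; rewrite !XpE IH bub_op.
  by rewrite bub_op.
by apply: CFc (CFb r (hP i m r')) _ _; lia.
Qed.
End Step.

Lemma CF_capped k d v : Y k d v -> P k d v.
Proof.
elim=> {k d v}.
- move=> i m r; case: (leqP 2 n) => hn.
    by apply: CFD; apply: low; lia.
  by rewrite lcap_out; [apply: CF0|lia].
- by move=> k d v h i m r; apply: CFD; apply: sub_lcap.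
- by move=> k d v w _ h _ h' i m r; rewrite lcapB; apply: CFB.
- by move=> k d i v h h'; apply: cappedX.
- by move=> k d i v h h'; apply: cappedT.
- by move=> k d i v h h'; apply: cappedU.
- by move=> k d r v h h'; apply: cappedb.
Qed.

Lemma CFA k d i v : Y k d v -> Y (k - 2) d (A i v).
Proof.
move=> h; have := CF_capped h i 0 0; rewrite /lcap /= Xp0 addn0.
by move=> h2; apply: CFc h2 _ _; lia.
Qed.
End Straighten.

(** * Targets, validity and degrees of words *)

Definition wend (k : nat) (p : word) : nat :=
  foldl (fun k e => (k - gsrc e.2 + gtgt e.2)%N) k p.
Fixpoint valid (k : nat) (p : word) : bool :=
  if p is (i, g) :: p' then (i + gsrc g <= k)%N && valid (k - gsrc g + gtgt g) p' else true.
Definition wdeg (p : word) : int := \sum_(e <- p) gdeg e.2.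

Lemma wdeg_cat p q : wdeg (p ++ q) = wdeg p + wdeg q.
Proof. by rewrite /wdeg big_cat. Qed.
Lemma wdeg_cons e p : wdeg (e :: p) = gdeg e.2 + wdeg p.
Proof. by rewrite /wdeg big_cons. Qed.
Lemma wdeg_nil : wdeg [::] = 0. Proof. by rewrite /wdeg big_nil. Qed.
Lemma wend_cat k p q : wend k (p ++ q) = wend (wend k p) q.
Proof. by rewrite /wend foldl_cat. Qed.
Lemma valid_cat k p q : valid k (p ++ q) = valid k p && valid (wend k p) q.
Proof. by elim: p k => [|[i g] p IH] k //=; rewrite IH andbA. Qed.
Lemma wdeg_shift a p : wdeg (shiftw a p) = wdeg p.
Proof. by rewrite /wdeg big_map. Qed.
Lemma shiftwD a b p : shiftw a (shiftw b p) = shiftw (a + b) p.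
Proof. by rewrite /shiftw -map_comp; apply: eq_map => e /=; rewrite addnA. Qed.
Lemma valid_shift k a p : valid k p -> valid (a + k) (shiftw a p).
Proof.
elim: p k => [|[i g] p IH] k //= /andP[h1 h2]; apply/andP; split; first by rewrite -addnA leq_add2l.
have -> : (a + k - gsrc g + gtgt g = a + (k - gsrc g + gtgt g))%N by lia.
exact: IH.
Qed.
Lemma wend_shift k a p : valid k p -> wend (a + k) (shiftw a p) = (a + wend k p)%N.
Proof.
elim: p k => [|[i g] p IH] k //= /andP[h1 h2]; rewrite -IH //; congr (wend _ _); lia.
Qed.

Section EvTheory.
Variables (t : nat) (E : zmodType) (M : nbmod t E).
Local Notation evM := (ev (op M)).
Lemma evB p v w : evM p (v - w) = evM p v - evM p w.
Proof. by elim: p v w => //= e p IH v w; rewrite opB IH. Qed.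
HB.instance Definition _ p := GRing.isZmodMorphism.Build E E (evM p) (evB p).
Lemma ev_sum p (I : Type) (s : seq I) (F : I -> E) :
  evM p (\sum_(x <- s) F x) = \sum_(x <- s) evM p (F x).
Proof. exact: raddf_sum. Qed.
Lemma ev0 p : evM p 0 = 0. Proof. exact: raddf0. Qed.
Lemma evMz p v m : evM p (v *~ m) = evM p v *~ m. Proof. exact: raddfMz. Qed.
Lemma inw_ev k p v : inw M k v -> inw M (wend k p) (evM p v).
Proof. by elim: p k v => //= e p IH k v h; apply: IH; apply: inw_op. Qed.
Lemma ev_invalid k p v : inw M k v -> ~~ valid k p -> evM p v = 0.
Proof.
elim: p k v => //= [[i g] p] IH k v h; rewrite negb_and -ltnNge => /orP[h2|h2] /=.
  by rewrite (op_out h2) ev0.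
by apply: IH h2; apply: inw_op.
Qed.
Lemma sub_ev D k p v : submodule M D -> D k v -> D (wend k p) (evM p v).
Proof. by move=> DM; elim: p k v => //= e p IH k v h; apply: IH; apply: (sub_op DM). Qed.
Lemma Xp_is_ev i r v : Xp M i r v = evM (nseq r (i, GX)) v.
Proof. by elim: r v => // r IH v; rewrite XpS IH. Qed.
End EvTheory.
#[global] Existing Instances inw_ev.

Section Lowest.
Variables (t : nat) (E : zmodType) (M : nbmod t E) (n : nat) (u : E) (D : nat -> E -> Prop).
Hypothesis Dsub : submodule M D.
Hypothesis uw : inw M n u.
Hypothesis uT : forall i, D n (op M GT i u).
Hypothesis low : forall k v, (k < n)%N -> inw M k v -> D k v.

Lemma CF_op g i k d v : capfree M n u D k d v ->
  capfree M n u D (k - gsrc g + gtgt g) (d + gdeg g) (op M g i v).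
Proof.
move=> h; have hw := CFw Dsub uw h.
case: (leqP (i + gsrc g) k) => hi; last by rewrite (op_out hi); apply: CF0.
case: g hi => /= hi.
- by apply: CFc (CFX i h) _ _ => //; rewrite subnK //; lia.
- by apply: CFc (CFT i h) _ _ => //; rewrite subnK //; lia.
- by rewrite addr0 addn0; apply: CFA.
- by apply: CFc (CFU i h) _ _; lia.
Qed.
Lemma CF_ev p k d v : capfree M n u D k d v ->
  capfree M n u D (wend k p) (d + wdeg p) (ev (op M) p v).
Proof.
elim: p k d v => [|[i g] p IH] k d v h; first by rewrite wdeg_nil addr0.
by rewrite wdeg_cons addrA; apply: IH; apply: CF_op.
Qed.

(** What remains of [capfree] in weight [n]: cups come from weight [n - 2] and fall into [D], while
    crossings act as divided differences on the dots. *)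
Inductive polys : int -> E -> Prop :=
| PLu : polys 0 u
| PLD d v : D n v -> polys d v
| PLB d v w : polys d v -> polys d w -> polys d (v - w)
| PLX d i v : polys d v -> polys (d + 2) (op M GX i v)
| PLb d r v : polys d v -> polys (d + 2 * r.+1%:Z) (bub M 0 r.+1 v).

Lemma PLw d v : polys d v -> inw M n v.
Proof.
elim=> {d v} //.
- by move=> d v /(sub_wt Dsub).
- by move=> d v w _ h _ h'; apply: inwB.
- by move=> d i v _ h; apply: inwX.
- by move=> d r v _ h; apply: inw_bub.
Qed.
Lemma PL0 d : polys d 0. Proof. by apply: PLD; apply: (sub_0 Dsub). Qed.
Lemma PLadd d v w : polys d v -> polys d w -> polys d (v + w).
Proof.
by move=> h h'; rewrite -[w]opprK; apply: PLB => //; rewrite -sub0r; apply: PLB => //; apply: PL0.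
Qed.
Lemma PLc d d' v : polys d v -> d = d' -> polys d' v. Proof. by move=> h <-. Qed.

Lemma low_UA i v : inw M n v -> D n (op M GCup i (op M GCap i v)).
Proof.
move=> h; case: (leqP (i + 2) n) => hn; last first.
  by rewrite (op_out (g := GCap) hn) op0; apply: (sub_0 Dsub).
have hA : D (n - 2) (op M GCap i v) by apply: low; lia.
by have := sub_U Dsub i hA; have -> : ((n - 2).+2 = n)%N by lia.
Qed.

(** Modulo cup-cap terms, which factor through weight [n - 2], crossings and dots satisfy the
    nilHecke relations; the crossings send [u] into [D] and commute with the leftmost bubbles. *)
Lemma PLT d i v : polys d v -> polys (d - 2) (op M GT i v).
Proof.
move=> h; elim: h i => {d v}.
- by move=> i; apply: PLD; apply: uT.
- by move=> d v h i; apply: PLD; apply: (sub_T Dsub).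
- by move=> d v w _ h _ h' i; rewrite opB; apply: PLB.
- move=> d j v hv h i; have hw := PLw hv; rewrite addrK.
  case: (leqP (i + 2) n) => hn; last first.
    by rewrite (op_out (g := GT) hn); apply: PL0.
  have hUA : polys d (op M GCup i (op M GCap i v)) by apply: PLD; apply: low_UA.
  have [hj|[hj|hj]] : (j = i \/ j = i.+1 \/ ((j < i) || (i.+1 < j)))%N by lia.
  + subst j; have -> : op M GT i (op M GX i v) = op M GX i.+1 (op M GT i v)
                       + (v - op M GCup i (op M GCap i v)).
      rewrite XTs; last by lia.
      by rewrite -[_ - v + _]addrA -[- v + _]opprK opprD opprK subrK.
    by apply: PLadd; [apply: PLc (PLX i.+1 (h i)) _; lia|apply: PLB].
  + subst j; have -> : op M GT i (op M GX i.+1 v) = op M GX i (op M GT i v)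
                       - (v - op M GCup i (op M GCap i v)).
      by rewrite XT ?opprB ?addrA ?subrK ?addrK //; lia.
    by apply: PLB; [apply: PLc (PLX i (h i)) _; lia|apply: PLB].
  + by rewrite -XT_far //; apply: PLc (PLX j (h i)) _; lia.
- move=> d r v hv h i; have hw := PLw hv.
  by rewrite bub_op; apply: PLc (PLb r (h i)) _; lia.
Qed.

Lemma CF_polys k d v : capfree M n u D k d v ->
  (k = n -> polys d v) /\ ((k < n)%N -> D k v).
Proof.
move=> h; split; last by move=> hk; apply: low => //; apply: CFw h.
elim: h => {k d v}.
- by move=> _; apply: PLu.
- by move=> k d v h e; apply: PLD; rewrite -e.
- by move=> k d v w _ h _ h' e; apply: PLB; [apply: h|apply: h'].
- by move=> k d i v _ h e; apply: PLX; apply: h.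
- by move=> k d i v _ h e; apply: PLT; apply: h.
- move=> k d i v hv _ e; apply: PLD; rewrite -e; apply: (sub_U Dsub); apply: low; first by lia.
  exact: CFw hv.
- by move=> k d r v _ h e; apply: PLb; apply: h.
Qed.

Lemma polys_ev p : wend n p = n -> polys (wdeg p) (ev (op M) p u).
Proof.
move=> e; have := CF_polys (CF_ev p (CFu M n u D)); rewrite add0r => -[h _].
exact: h.
Qed.

(** Dots, and bubbles carrying at least one dot, have positive degree; in degree 0 only integer
    multiples of [u] remain. *)
Lemma polys_deg d v : polys d v ->
  (d < 0 -> D n v) /\ (d = 0 -> exists m : int, D n (v - u *~ m)).
Proof.
elim=> {d v}.
- by split=> // _; exists 1; rewrite mulr1z subrr; apply: (sub_0 Dsub).
- by move=> d v h; split=> // _; exists 0; rewrite mulr0z subr0.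
- move=> d v w _ [h1 h2] _ [h3 h4]; split=> hd; first by apply: (sub_B Dsub); [apply: h1|apply: h3].
  have [m hm] := h2 hd; have [m' hm'] := h4 hd; exists (m - m').
  have -> : v - w - u *~ (m - m') = (v - u *~ m) - (w - u *~ m').
    by rewrite mulrzBr !opprB [LHS]addrACA [RHS]addrACA (addrC (- w)).
  exact: (sub_B Dsub).
- move=> d i v _ [h1 h2]; split=> hd; first by apply: (sub_X Dsub); apply: h1; lia.
  by exists 0; rewrite mulr0z subr0; apply: (sub_X Dsub); apply: h1; lia.
- move=> d r v _ [h1 h2]; split=> hd; first by apply: (sub_bub Dsub); apply: h1; lia.
  by exists 0; rewrite mulr0z subr0; apply: (sub_bub Dsub); apply: h1; lia.
Qed.

Lemma ev_neg p : wend n p = n -> wdeg p < 0 -> D n (ev (op M) p u).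
Proof. by move=> e; have [h _] := polys_deg (polys_ev e). Qed.
Lemma ev_zero p : wend n p = n -> wdeg p = 0 -> exists m : int, D n (ev (op M) p u - u *~ m).
Proof. by move=> e; have [_ h] := polys_deg (polys_ev e). Qed.
End Lowest.

(** * Products, shifts and functionals on words *)

Record lowest t E (M : nbmod t E) (n : nat) (u : E) (D : nat -> E -> Prop) : Prop := Lowest {
  lw_sub : submodule M D;
  lw_in : inw M n u;
  lw_T : forall i, D n (op M GT i u);
  lw_low : forall k v, (k < n)%N -> inw M k v -> D k v
}.

Lemma zero_submod t E (M : nbmod t E) : submodule M (fun _ v => v = 0).
Proof.
by split=> // [k v ->|k v w -> ->|g i k v ->]; [exact: wt_0|rewrite subrr|exact: op0].
Qed.

Section Restrict.
Variables (t : nat) (E : zmodType) (M : nbmod t E) (D : nat -> E -> Prop).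
Hypothesis DM : submodule M D.
Definition restrict : nbmod t E.
Proof.
refine (@NbMod t E (op M) D (opB M) (sub_0 DM) (sub_B DM) _ _ _).
- by move=> g i k v h _; apply: (sub_op DM).
- by move=> g i k v h; apply: op_inv; apply: (sub_wt DM h).
- by move=> s r a k v hr h; apply: op_rel hr (sub_wt DM h).
Defined.
End Restrict.

Section Shift.
Variables (t : nat) (E : zmodType) (M : nbmod t E).
Lemma ev_shift p v : ev (fun g i => op M g i.+1) p v = ev (op M) (shiftw 1 p) v.
Proof. by elim: p v => //= e p IH v; rewrite IH. Qed.
(* forgets the leftmost strand: strand [i] of the new module is strand [i + 1] *)
Definition shiftmod : nbmod t E.
Proof.
refine (@NbMod t E (fun g i => op M g i.+1) (fun k => wt M k.+1) (fun g i => opB M g i.+1)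
   (fun k => wt_0 M k.+1) (fun k => @wt_B t E M k.+1) _ _ _).
- move=> g i k v h hi; have := wt_op0 (g := g) (i := i.+1) h; rewrite addSn ltnS => /(_ hi).
  by have -> : (k.+1 - gsrc g + gtgt g = (k - gsrc g + gtgt g).+1)%N by lia.
- by move=> g i k v h hi; apply: op_inv h _; lia.
- move=> s r a k v hr h hk; rewrite -[RHS](op_rel (a := a.+1) hr h); last by lia.
  by apply: eq_bigr => e _; rewrite ev_shift shiftwD.
Defined.
Lemma inw_shiftmod k v : inw shiftmod k v <-> inw M k.+1 v.
Proof. by split=> -[h]; constructor. Qed.
End Shift.

Section Product.
Variables (t : nat) (E1 E2 : zmodType) (M1 : nbmod t E1) (M2 : nbmod t E2).
Definition prod_op g i (v : E1 * E2) : E1 * E2 := (op M1 g i v.1, op M2 g i v.2).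
Lemma ev_prod p v : ev prod_op p v = (ev (op M1) p v.1, ev (op M2) p v.2).
Proof. by elim: p v => [|e p IH] [v1 v2] //=; rewrite IH. Qed.
Lemma fst_sumz (I : Type) (s : seq I) (F : I -> E1 * E2) :
  (\sum_(x <- s) F x) = (\sum_(x <- s) (F x).1, \sum_(x <- s) (F x).2).
Proof. by elim/big_rec3: _ => [|x a b c _ ->]. Qed.
Lemma pairMz (v : E1 * E2) m : v *~ m = (v.1 *~ m, v.2 *~ m).
Proof.
have hn q : v *+ q = (v.1 *+ q, v.2 *+ q).
  by elim: q => [|q IH]; rewrite ?mulr0n // !mulrS IH.
by case: m => m; [exact: hn|rewrite NegzE !mulrNz [v *~ _](hn m.+1)].
Qed.
Definition prodmod : nbmod t (E1 * E2)%type.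
Proof.
refine (@NbMod t (E1 * E2)%type prod_op (fun k v => wt M1 k v.1 /\ wt M2 k v.2) _ _ _ _ _ _).
- by move=> g i v w; rewrite /prod_op !opB.
- by move=> k; split; apply: wt_0.
- by move=> k v w [h1 h2] [h3 h4]; split; apply: wt_B.
- by move=> g i k v [h1 h2] hi; split; apply: wt_op0.
- by move=> g i k v [h1 h2] hi; rewrite /prod_op (op_inv h1 hi) (op_inv h2 hi).
- move=> s r a k v hr [h1 h2] hk.
  rewrite fst_sumz; congr (_, _).
    by rewrite -[RHS](op_rel hr h1 hk); apply: eq_bigr => e _; rewrite ev_prod pairMz.
  by rewrite -[RHS](op_rel hr h2 hk); apply: eq_bigr => e _; rewrite ev_prod pairMz.
Defined.
End Product.

(** The pair [(u1, u2)] is a lowest vector of the product module, so one application of [ev_zero]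
    gives an integer common to both factors. *)
Lemma joint_ev_zero t n p E1 (M1 : nbmod t E1) u1 D1 E2 (M2 : nbmod t E2) u2 D2 :
  lowest M1 n u1 D1 -> lowest M2 n u2 D2 -> wend n p = n -> wdeg p = 0 ->
  exists m : int, D1 n (ev (op M1) p u1 - u1 *~ m) /\ D2 n (ev (op M2) p u2 - u2 *~ m).
Proof.
move=> h1 h2 hp hd.
pose D k (v : E1 * E2) := D1 k v.1 /\ D2 k v.2.
have hs : submodule (prodmod M1 M2) D.
  case: h1 h2 => -[a1 a2 a3 a4] _ _ _ [[b1 b2 b3 b4] _ _ _]; split.
  - by move=> k v [c1 c2]; split; [apply: a1|apply: b1].
  - by move=> k; split; [apply: a2|apply: b2].
  - by move=> k v w [c1 c2] [c3 c4]; split; [apply: a3|apply: b3].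
  - by move=> g i k v [c1 c2]; split; [apply: a4|apply: b4].
case: h1 h2 => _ [u1w] u1T u1l [_ [u2w] u2T u2l].
have := @ev_zero _ _ (prodmod M1 M2) n (u1, u2) D hs _ _ _ p hp hd.
case=> //.
- by move=> i; split; [apply: u1T|apply: u2T].
- by move=> k v hk [[c1 c2]]; split; [apply: u1l|apply: u2l].
- by move=> m [/=]; rewrite ev_prod pairMz /= => c1 c2; exists m.
Qed.

Lemma fun_sumE (W : Type) (R : zmodType) (I : Type) (s : seq I) (F : I -> W -> R) p :
  (\sum_(x <- s) F x) p = \sum_(x <- s) F x p.
Proof. by elim/big_rec2: _ => // x a b _ <-. Qed.
Lemma fun_MzE (W : Type) (R : zmodType) (f : W -> R) m p : (f *~ m) p = f p *~ m.
Proof.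
have hn q : (f *+ q) p = f p *+ q by elim: q => [|q IH]; rewrite ?mulr0n // !mulrS -IH.
by case: m => m; [exact: hn|rewrite NegzE !mulrNz; congr (- _); exact: (hn m.+1)].
Qed.

Section CoFun.
Variables (t : nat) (R : zmodType).
(** A vector [v] of a module and an additive map [phi] on it give the function sending [p] to
    [phi (p v)], on which an operator acts by prefixing a letter. [co_wt] imposes what the relations
    force on such functions. *)
Definition co_op (g : gen) (i : nat) (f : word -> R) : word -> R := fun p => f ((i, g) :: p).
Lemma ev_co p f q : ev co_op p f q = f (p ++ q).
Proof. by elim: p f => //= [[i g] p] IH f; rewrite IH. Qed.
Definition co_wt (k : nat) (f : word -> R) : Prop :=
  (forall p, ~~ valid k p -> f p = 0) /\
  (forall p q s r a, zrel t s r -> valid k p -> (a + s <= wend k p)%N ->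
     \sum_(e <- r) f (p ++ shiftw a e.2 ++ q) *~ e.1 = 0).
Definition cofun : nbmod t (word -> R).
Proof.
refine (@NbMod t (word -> R) co_op co_wt _ _ _ _ _ _) => //.
- move=> k; split=> // p q s r a _ _ _.
  by rewrite big1 // => e _; rewrite mul0rz.
- move=> k v w [h1 h2] [h3 h4]; split=> [p hp|p q s r a hr hp ha].
    by rewrite -[LHS]/(v p - w p) h1 ?h3 ?subr0.
  transitivity (\sum_(e <- r) v (p ++ shiftw a e.2 ++ q) *~ e.1
              - \sum_(e <- r) w (p ++ shiftw a e.2 ++ q) *~ e.1).
    by rewrite -sumrB; apply: eq_bigr => e _; rewrite -mulrzBl.
  by rewrite (h2 p q s r a) // (h4 p q s r a) // subr0.
- move=> g i k v [h1 h2] hi; split=> [p hp|p q s r a hr hp ha].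
    by apply: h1; rewrite /= hi.
  by apply: (h2 ((i, g) :: p)) hr _ ha; rewrite /= hi.
- move=> g i k v [h1 h2] hi; apply/funext => p; apply: h1.
  by rewrite /= leqNgt hi.
- move=> s r a k v hr [h1 h2] hk; apply/funext => q; rewrite fun_sumE.
  rewrite -[RHS](h2 [::] q s r a hr isT hk); apply: eq_bigr => e _.
  by rewrite fun_MzE ev_co.
Defined.
End CoFun.

(** * Lagrange interpolation sums *)

Section Lagrange.
Variables (F : fieldType) (N : nat) (al : 'I_N -> F).
Hypothesis alD : forall i j, al i + al j != 0.
Hypothesis alB : forall i j, i != j -> al i - al j != 0.

(** Coefficients of the cap and of the cup of the explicit module on a doubled letter [l].
    [cap_cup_sum] gives the value of the bubble, and [cap_cup_inv] makes the crossing vanish against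
    caps and cups. *)
Definition capw l := \prod_(k | k != l) (al l - al k)^-1.
Definition cupw l := \prod_(k | k != l) (- al l - al k).

Let two0 i : (2%:R : F) * al i != 0.
Proof. by rewrite mulr_natl mulr2n. Qed.
Lemma al_neq0 i : al i != 0.
Proof. by apply: contraNneq (two0 i) => ->; rewrite mulr0. Qed.

Let P := \prod_k ('X + (al k)%:P) - \prod_k ((al k)%:P - 'X).
Let Q := 2%:R *: 'X * \sum_l (capw l * cupw l) *: \prod_(k | k != l) ('X + (al k)%:P).

Let hornP u : P.[u] = \prod_k (u + al k) - \prod_k (al k - u).
Proof.
rewrite /P hornerD hornerN !horner_prod.
by congr (_ - _); apply: eq_bigr => k _; rewrite !hornerE.
Qed.
Let hornQ u : Q.[u] = 2%:R * u * \sum_l capw l * cupw l * \prod_(k | k != l) (u + al k).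
Proof.
rewrite /Q hornerM !hornerE horner_sum; congr (_ * _); apply: eq_bigr => l _.
by rewrite hornerZ horner_prod; congr (_ * _); apply: eq_bigr => k _; rewrite !hornerE.
Qed.

Let monR l : \prod_(k | k != l) ('X + (al k)%:P) \is monic.
Proof. by apply: monic_prod => k _; apply: monicXaddC. Qed.
Let sizeA : size (\prod_k ('X + (al k)%:P)) = N.+1.
Proof.
rewrite (eq_bigr (fun k => 'X - (- al k)%:P)) => [|k _]; last by rewrite polyCN opprK.
by rewrite size_prod_XsubC -[index_enum _]enumT size_enum_ord.
Qed.
Let sizeR l : (size (\prod_(k | k != l) ('X + (al k)%:P))).+1 = N.+1.
Proof.
rewrite -sizeA [in RHS](bigD1 l) //= mulrC size_Mmonic ?monicXaddC ?monic_neq0 //.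
by rewrite size_XaddC addn2.
Qed.
Let sizeB : \prod_k ((al k)%:P - 'X) = (-1) ^+ N *: \prod_k ('X - (al k)%:P).
Proof.
rewrite (eq_bigr (fun k => (-1) *: ('X - (al k)%:P))) => [|k _]; last by rewrite scaleN1r opprB.
by rewrite scaler_prod prodr_const card_ord.
Qed.
Let sizeB' : size (\prod_k ('X - (al k)%:P)) = N.+1.
Proof. by rewrite size_prod_XsubC -[index_enum _]enumT size_enum_ord. Qed.

(** Both polynomials have degree at most [N] and agree at the [N + 1] points [0] and [- al k]. *)
Let P_eq_Q : P = Q.
Proof.
apply/eqP; rewrite -subr_eq0; apply/eqP.
pose rs := 0 :: [seq - al k | k <- enum 'I_N].
apply: (@roots_geq_poly_eq0 _ _ rs).
- apply/allP => x; rewrite inE => /orP[/eqP ->|].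
    rewrite /root hornerD hornerN hornP hornQ mulr0 mul0r subr0 subr_eq0; apply/eqP.
    by apply: eq_bigr => k _; rewrite add0r subr0.
  case/mapP => j _ ->; rewrite /root hornerD hornerN hornP hornQ subr_eq0.
  have -> : \prod_k (- al j + al k) = 0 by rewrite (bigD1 j) //= addNr mul0r.
  have -> : \sum_l capw l * cupw l * \prod_(k | k != l) (- al j + al k) =
            capw j * cupw j * \prod_(k | k != j) (- al j + al k).
    rewrite [LHS](bigD1 j) //= [X in _ + X]big1 ?addr0 // => l jl.
    by rewrite (bigD1 j) 1?eq_sym //= addNr mul0r mulr0.
  rewrite sub0r (bigD1 j) //= opprK /capw /cupw -!big_split /=; apply/eqP.
  rewrite mulrN mulNr; congr (- _); congr (_ * _); first by ring.
  apply: eq_bigr => k kj.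
  have := alB (i := j) (j := k); rewrite eq_sym => /(_ kj) h.
  by field; rewrite h.
- rewrite /= map_inj_uniq ?enum_uniq ?andbT; last first.
    by move=> i j /oppr_inj e; apply/eqP; apply: contraT => /alB; rewrite e subrr eqxx.
  by apply/mapP => -[j _ /eqP]; rewrite eq_sym oppr_eq0 (negPf (al_neq0 j)).
- rewrite /= size_map size_enum_ord.
  have hP : (size (P - Q)%R <= N.+1)%N; last by [].
  rewrite (leq_trans (size_polyD _ _)) // geq_max size_polyN; apply/andP; split.
    rewrite (leq_trans (size_polyD _ _)) // geq_max size_polyN sizeA leqnn /=.
    by rewrite sizeB (leq_trans (size_scale_leq _ _)) // sizeB'.
  case: (posnP N) => [N0|Npos].
    by rewrite /Q big1 ?mulr0 ?size_poly0 // => l _; exfalso; have := ltn_ord l; lia.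
  have hS : (size (\sum_l (capw l * cupw l) *: \prod_(k | k != l) ('X + (al k)%:P))%R <= N)%N.
    apply: (leq_trans (size_sum _ _ _)); apply/bigmax_leqP => l _.
    by rewrite (leq_trans (size_scale_leq _ _)) // -ltnS sizeR.
  rewrite /Q -scalerAl (leq_trans (size_scale_leq _ _)) //.
  by rewrite (leq_trans (size_polyMleq _ _)) // size_polyX add2n /= ltnS.
Qed.

(** The coefficient of [X^N] in [P = Q]: twice the sum is [1 - (-1)^N]. This is where the parity of
    [N] becomes the parameter [t]. *)
Lemma cap_cup_sum : \sum_l capw l * cupw l = (N %% 2)%:R.
Proof.
have two : (2%:R : F) != 0 \/ N = 0.
  case: (posnP N) => [->|Npos]; [by right|left].
  by apply: contraNneq (two0 (Ordinal Npos)) => ->; rewrite mul0r.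
case: two => [two|N0]; last first.
  have -> : (N %% 2 = 0)%N by rewrite N0.
  by rewrite big1 // => l _; exfalso; have := ltn_ord l; lia.
case: (posnP N) => [N0|Npos].
  have -> : (N %% 2 = 0)%N by rewrite N0.
  by rewrite big1 // => l _; exfalso; have := ltn_ord l; lia.
have gen (p : {poly F}) : p \is monic -> size p = N.+1 -> p`_N = 1.
  by rewrite monicE /lead_coef => /eqP + e; rewrite e.
have coA : (\prod_k ('X + (al k)%:P))`_N = 1.
  by apply: gen => //; apply: monic_prod => k _; apply: monicXaddC.
have coB : (\prod_k ('X - (al k)%:P))`_N = 1.
  by apply: gen => //; apply: monic_prod => k _; apply: monicXsubC.
have coR l : (\prod_(k | k != l) ('X + (al k)%:P))`_N.-1 = 1.
  by have /eqP := monR l; rewrite /lead_coef; have /succn_inj -> := sizeR l.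
have := congr1 (fun p : {poly F} => p`_N) P_eq_Q.
rewrite /P /Q sizeB -scalerAl coefB !coefZ coA coB coefXM (gtn_eqF Npos) coef_sum.
under eq_bigr => l _ do rewrite coefZ coR mulr1.
move=> e; apply: (mulfI two); rewrite -e mulr1 -signr_odd modn2.
by case: (odd N); rewrite ?expr1 ?expr0 /=; ring.
Qed.

(** [P = Q] at the point [al i], where the second product in [P] vanishes. *)
Lemma cap_cup_inv i : \sum_l capw l * cupw l / (al i + al l) = (2%:R * al i)^-1.
Proof.
have := congr1 (fun p : {poly F} => p.[al i]) P_eq_Q.
rewrite hornP hornQ [in X in _ - X](bigD1 i) //= subrr mul0r subr0 => e.
have h0 : \prod_k (al i + al k) != 0 by apply/prodf_neq0 => k _; apply: alD.
apply: (mulfI (two0 i)); rewrite mulfV //; apply: (mulIf h0); rewrite mul1r [RHS]e.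
rewrite -!mulrA; congr (_ * _); congr (_ * _); rewrite mulr_suml; apply: eq_bigr => l _.
by rewrite [X in _ * X = _](bigD1 l) //= mulrA divfK // mulrA.
Qed.
End Lagrange.

(** * The module of functions on words *)

Section Blocks.
Variables (F : fieldType) (N : nat) (a : 'I_N -> F).
Hypothesis aD : forall i j, a i + a j != 0.
Hypothesis aB : forall i j, i != j -> a i - a j != 0.

Definition flip (i : 'I_N) (s : 'I_N -> bool) : 'I_N -> bool := fun k => s k (+) (k == i).
Lemma flipC i j s : flip i (flip j s) = flip j (flip i s).
Proof. by apply/funext => k; rewrite /flip addbAC. Qed.
Lemma flipK i s : flip i (flip i s) = s.
Proof. by apply/funext => k; rewrite /flip -addbA addbb addbF. Qed.

Definition alpha (s : 'I_N -> bool) i := if s i then - a i else a i.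
Lemma alpha_flip i s k : alpha (flip i s) k = if k == i then - alpha s k else alpha s k.
Proof.
rewrite /alpha /flip; case: eqP => _; last by rewrite addbF.
by rewrite addbT; case: (s k); rewrite ?opprK.
Qed.
Lemma alpha_flip_eq i s : alpha (flip i s) i = - alpha s i.
Proof. by rewrite alpha_flip eqxx. Qed.
Lemma alpha_flip_neq i s k : k != i -> alpha (flip i s) k = alpha s k.
Proof. by rewrite alpha_flip => /negPf ->. Qed.
Lemma alphaD s i j : alpha s i + alpha s j != 0.
Proof.
rewrite /alpha; case: (eqVneq i j) => [->|ij].
  by case: (s j); rewrite -?opprD ?oppr_eq0.
case: (s i) (s j) => [] []; rewrite ?aD //.
- by rewrite -opprD oppr_eq0.
- by rewrite addrC aB // eq_sym.
- by rewrite aB.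
Qed.
Lemma alphaB s i j : i != j -> alpha s i - alpha s j != 0.
Proof.
move=> ij; rewrite /alpha; case: (s i) (s j) => [] []; rewrite ?opprK ?aB //.
- by rewrite addrC aB // eq_sym.
- by rewrite -opprD oppr_eq0.
Qed.
Lemma alpha2 s i : (2%:R : F) * alpha s i != 0.
Proof. by rewrite mulr_natl mulr2n alphaD. Qed.
Lemma alpha0 s i : alpha s i != 0.
Proof. by apply: contraNneq (alpha2 s i) => ->; rewrite mulr0. Qed.
Lemma two_neq0 (i : 'I_N) : (2%:R : F) != 0.
Proof. by apply: contraNneq (alpha2 (fun _ => false) i) => ->; rewrite mul0r. Qed.

Definition cA s := capw (alpha s).
Definition cU s := cupw (alpha s).

Lemma cAU s i : cA s i * cU (flip i s) i = 1.
Proof.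
rewrite /cA /cU /capw /cupw -big_split big1 //= => k ki.
by rewrite alpha_flip_eq alpha_flip_neq // opprK mulVf // alphaB // eq_sym.
Qed.
Lemma cUA s i : cU s i * cA (flip i s) i = 1.
Proof. by rewrite -{1}[s](flipK i) mulrC cAU. Qed.
Lemma cA_flip s i l : l != i ->
  cA (flip i s) l = cA s l * (alpha s l - alpha s i) / (alpha s l + alpha s i).
Proof.
move=> li; rewrite /cA /capw (bigD1 i) 1?eq_sym //= [in RHS](bigD1 i) 1?eq_sym //=.
rewrite alpha_flip_neq // alpha_flip_eq opprK.
rewrite (eq_bigr (fun k => (alpha s l - alpha s k)^-1)); last first.
  by move=> k /andP[_ ki]; rewrite alpha_flip_neq.
by field; rewrite alphaD alphaB.
Qed.
Lemma cU_flip s i l : l != i ->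
  cU (flip i s) l = cU s l * (alpha s l - alpha s i) / (alpha s l + alpha s i).
Proof.
move=> li; rewrite /cU /cupw (bigD1 i) 1?eq_sym //= [in RHS](bigD1 i) 1?eq_sym //=.
rewrite alpha_flip_neq // alpha_flip_eq opprK.
rewrite (eq_bigr (fun k => (- alpha s l - alpha s k))); last first.
  by move=> k /andP[_ ki]; rewrite alpha_flip_neq.
by field; rewrite alphaD.
Qed.
Lemma cA0 s l : cA s l != 0.
Proof. by apply/prodf_neq0 => k kl; rewrite invr_eq0 alphaB // eq_sym. Qed.

Lemma cU0 s l : cU s l != 0.
Proof. by apply/prodf_neq0 => k kl; rewrite -opprD oppr_eq0 alphaD. Qed.

Lemma sum_cAU s : \sum_l cA s l * cU s l = (N %% 2)%:R.
Proof. by apply: cap_cup_sum => *; rewrite ?alphaD ?alphaB. Qed.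
Lemma sum_cAU_inv s i : \sum_l cA s l * cU s l / (alpha s i + alpha s l) = (2%:R * alpha s i)^-1.
Proof. by apply: cap_cup_inv => *; rewrite ?alphaD ?alphaB. Qed.

(* the crossing on two adjacent letters, read from the state [s] on their left *)
Definition tb s (f : 'I_N -> 'I_N -> F) i j :=
  if i == j then f i i / (2%:R * alpha s i)
       - cU s i * \sum_l cA s l * f l l / (alpha s i + alpha s l)
  else (f i j - f j i) / (alpha s i - alpha s j).
Definition cb s (f : 'I_N -> 'I_N -> F) i j :=
  if i == j then cU s i * \sum_l cA s l * f l l else 0.

Lemma tb_eq s f i : tb s f i i = f i i / (2%:R * alpha s i)
       - cU s i * \sum_l cA s l * f l l / (alpha s i + alpha s l).
Proof. by rewrite /tb eqxx. Qed.
Lemma tb_neq s f i j : i != j -> tb s f i j = (f i j - f j i) / (alpha s i - alpha s j).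
Proof. by rewrite /tb => /negPf ->. Qed.

Lemma tbX1 s f i j : alpha s i * tb s f i j =
  tb s (fun b c => alpha (flip b s) c * f b c) i j + f i j - cb s f i j.
Proof.
case: (eqVneq i j) => [<-|ij].
  rewrite !tb_eq /cb eqxx alpha_flip_eq.
  have -> : \sum_l cA s l * (alpha (flip l s) l * f l l) / (alpha s i + alpha s l) =
     alpha s i * (\sum_l cA s l * f l l / (alpha s i + alpha s l)) - \sum_l cA s l * f l l.
    rewrite mulr_sumr -sumrB; apply: eq_bigr => l _; rewrite alpha_flip_eq.
    by field; rewrite alphaD.
  by field; rewrite alpha0 (two_neq0 i).
have ji : j != i by rewrite eq_sym.
rewrite !tb_neq // /cb (negPf ij) subr0 !alpha_flip_neq //.
by field; rewrite alphaB.
Qed.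
Lemma tbX2 s f i j : alpha (flip i s) j * tb s f i j =
  tb s (fun b c => alpha s b * f b c) i j - f i j + cb s f i j.
Proof.
case: (eqVneq i j) => [<-|ij].
  rewrite !tb_eq /cb eqxx alpha_flip_eq.
  have -> : \sum_l cA s l * (alpha s l * f l l) / (alpha s i + alpha s l) =
     \sum_l cA s l * f l l - alpha s i * (\sum_l cA s l * f l l / (alpha s i + alpha s l)).
    rewrite mulr_sumr -sumrB; apply: eq_bigr => l _.
    by field; rewrite alphaD.
  by field; rewrite alpha0 (two_neq0 i).
have ji : j != i by rewrite eq_sym.
rewrite !tb_neq // /cb (negPf ij) addr0 !alpha_flip_neq //.
by field; rewrite alphaB.
Qed.

Lemma captb s f : \sum_l cA s l * tb s f l l = 0.
Proof.
under eq_bigr => l _ do rewrite tb_eq mulrBr.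
rewrite sumrB.
have -> : \sum_l cA s l * (cU s l * \sum_m cA s m * f m m / (alpha s l + alpha s m)) =
   \sum_m cA s m * f m m * \sum_l cA s l * cU s l / (alpha s m + alpha s l).
  under eq_bigr => l _ do rewrite mulrA mulr_sumr.
  rewrite exchange_big /=; apply: eq_bigr => m _; rewrite mulr_sumr; apply: eq_bigr => l _.
  by rewrite (addrC (alpha s m)); ring.
under [X in _ - X]eq_bigr => m _ do rewrite sum_cAU_inv.
by apply/eqP; rewrite subr_eq0; apply/eqP; apply: eq_bigr => l _; rewrite mulrA.
Qed.
Lemma tbcup s (c : F) i j : tb s (fun b d => if b == d then cU s b * c else 0) i j = 0.
Proof.
case: (eqVneq i j) => [<-|ij]; last first.
  by rewrite tb_neq // (negPf ij) eq_sym (negPf ij) subrr mul0r.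
rewrite tb_eq !eqxx.
have -> : \sum_l cA s l * (if l == l then cU s l * c else 0) / (alpha s i + alpha s l) =
   c * \sum_l cA s l * cU s l / (alpha s i + alpha s l).
  by rewrite mulr_sumr; apply: eq_bigr => l _; rewrite eqxx; ring.
by rewrite sum_cAU_inv; ring.
Qed.

Lemma alpha_inj s s' i j : alpha s i = alpha s' j -> i = j /\ s i = s' j.
Proof.
have h b b' : (if b then - a i else a i) = (if b' then - a j else a j) -> i = j.
  move=> e; apply/eqP; apply: contraT => ij.
  have := aB ij; have := aD i j; case: b b' e => [] [].
  - by move/oppr_inj=> ->; rewrite subrr eqxx.
  - by move=> e; rewrite -[a i]opprK e addNr eqxx.
  - by move=> ->; rewrite addNr eqxx.
  - by move=> ->; rewrite subrr eqxx.
rewrite /alpha => e; have ij := h _ _ e; split=> //; subst j.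
have := aD i i; case: (s i) (s' i) e => [] [] // e.
- by rewrite -{1}e addNr eqxx.
- by rewrite {1}e addNr eqxx.
Qed.

Section Bilin.
Variable s : 'I_N -> bool.
Implicit Types f g : 'I_N -> 'I_N -> F.
Lemma tbB f g : tb s (f - g) = tb s f - tb s g.
Proof.
apply/funext => i; apply/funext => j; rewrite -[RHS]/(tb s f i j - tb s g i j) /tb.
case: eqP => _.
  rewrite -[(f - g) i i]/(f i i - g i i).
  have -> : \sum_l cA s l * (f - g) l l / (alpha s i + alpha s l) =
     \sum_l cA s l * f l l / (alpha s i + alpha s l) -
     \sum_l cA s l * g l l / (alpha s i + alpha s l).
    rewrite -sumrB; apply: eq_bigr => l _; rewrite -[(f - g) l l]/(f l l - g l l); ring.
  by ring.
by rewrite -[(f - g) i j]/(f i j - g i j) -[(f - g) j i]/(f j i - g j i); ring.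
Qed.
HB.instance Definition _ := GRing.isZmodMorphism.Build _ _ (tb s) tbB.
Lemma cbB f g : cb s (f - g) = cb s f - cb s g.
Proof.
apply/funext => i; apply/funext => j; rewrite -[RHS]/(cb s f i j - cb s g i j) /cb.
case: eqP => _; last by rewrite subr0.
rewrite -mulrBr -sumrB; congr (_ * _); apply: eq_bigr => l _.
by rewrite -[(f - g) l l]/(f l l - g l l) mulrBr.
Qed.
HB.instance Definition _ := GRing.isZmodMorphism.Build _ _ (cb s) cbB.
Lemma tbZ (c : F) f i j : tb s (fun b d => c * f b d) i j = c * tb s f i j.
Proof.
rewrite /tb; case: eqP => _; last by ring.
have -> : \sum_l cA s l * (c * f l l) / (alpha s i + alpha s l) =
   c * \sum_l cA s l * f l l / (alpha s i + alpha s l).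
  by rewrite mulr_sumr; apply: eq_bigr => l _; ring.
by ring.
Qed.

Definition x1 f : 'I_N -> 'I_N -> F := fun b c => alpha s b * f b c.
Definition x2 f : 'I_N -> 'I_N -> F := fun b c => alpha (flip b s) c * f b c.
Lemma x1tb f : x1 (tb s f) = tb s (x2 f) + f - cb s f.
Proof. by apply/funext => i; apply/funext => j; apply: tbX1. Qed.
Lemma x2tb f : x2 (tb s f) = tb s (x1 f) - f + cb s f.
Proof. by apply/funext => i; apply/funext => j; apply: tbX2. Qed.
Lemma cbtb f : cb s (tb s f) = 0.
Proof.
by apply/funext => i; apply/funext => j; rewrite /cb captb mulr0 if_same.
Qed.
Lemma tbcb f : tb s (cb s f) = 0.
Proof. by apply/funext => i; apply/funext => j; apply: tbcup. Qed.
(** The correction terms of the two successive dot slides cancel, so the square of the crossing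
    commutes with the dots. *)
Lemma x1tbtb f : x1 (tb s (tb s f)) = tb s (tb s (x1 f)).
Proof.
rewrite x1tb cbtb subr0 x2tb raddfD raddfB /= tbcb addr0.
by rewrite subrK.
Qed.
Lemma x2tbtb f : x2 (tb s (tb s f)) = tb s (tb s (x2 f)).
Proof.
rewrite x2tb cbtb addr0 x1tb raddfB raddfD /= tbcb subr0.
by rewrite addrK.
Qed.

Definition dl m n : 'I_N -> 'I_N -> F := fun b c => ((b == m) && (c == n))%:R.
Lemma x1dl m n : x1 (dl m n) = (fun b c => alpha s m * dl m n b c).
Proof.
apply/funext => b; apply/funext => c; rewrite /x1 /dl.
by case: (eqVneq b m) => [->|] //=; rewrite !mulr0.
Qed.
Lemma x2dl m n : x2 (dl m n) = (fun b c => alpha (flip m s) n * dl m n b c).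
Proof.
apply/funext => b; apply/funext => c; rewrite /x2 /dl.
by case: (eqVneq b m) => [->|] //=; case: (eqVneq c n) => [->|] //=; rewrite !mulr0.
Qed.
(** The square commutes with both dots, whose joint eigenvalues separate the vectors [dl m n]; hence
    it is diagonal. The diagonal entry vanishes because the cap kills crossings if [m = n], and by
    computation otherwise. *)
Lemma tbtb_dl m n i j : tb s (tb s (dl m n)) i j = 0.
Proof.
have off i' j' : (i' != m) || (j' != n) -> tb s (tb s (dl m n)) i' j' = 0.
  move=> h; apply/eqP; apply: contraLR h => h; rewrite negb_or !negbK.
  have e1 := congr1 (fun f => f i' j') (x1tbtb (dl m n)).
  have e2 := congr1 (fun f => f i' j') (x2tbtb (dl m n)).
  move: e1 e2; rewrite x1dl x2dl.
  have -> (c : F) : tb s (fun b d => c * dl m n b d) = (fun b d => c * tb s (dl m n) b d).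
    by apply/funext => b; apply/funext => d; rewrite tbZ.
  have -> (c : F) : tb s (fun b d => c * dl m n b d) = (fun b d => c * tb s (dl m n) b d).
    by apply/funext => b; apply/funext => d; rewrite tbZ.
  rewrite !tbZ /x1 /x2 => /(mulIf h) /alpha_inj[e _] /(mulIf h) /alpha_inj[e' _].
  by rewrite e e' !eqxx.
case: (boolP ((i != m) || (j != n))) => [|h]; first exact: off.
move: h; rewrite negb_or !negbK => /andP[/eqP -> /eqP ->].
case: (eqVneq m n) off => [<-|mn] off.
  have := captb s (tb s (dl m m)); rewrite (bigD1 m) //= big1 ?addr0.
    by move/eqP; rewrite mulf_eq0 (negPf (cA0 _ _)) => /eqP.
  by move=> l lm; rewrite off ?mulr0 ?lm.
have nm : n != m by rewrite eq_sym.
by rewrite tb_neq // !tb_neq //; field; rewrite !alphaB.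
Qed.
Lemma tbtb f : tb s (tb s f) = 0.
Proof.
have -> : f = \sum_(p : 'I_N * 'I_N) (fun b c => f p.1 p.2 * dl p.1 p.2 b c).
  apply/funext => b; apply/funext => c; rewrite !fct_sumE.
  rewrite (bigD1 (b, c)) //= /dl !eqxx mulr1 big1 ?addr0 // => -[m n] /= h.
  by move: h; rewrite xpair_eqE negb_and ![_ == m]eq_sym ![_ == n]eq_sym => /orP[] /negPf ->;
     rewrite ?andbF mulr0.
rewrite !raddf_sum big1 // => p _ /=; apply/funext => i; apply/funext => j.
have -> : tb s (fun b c => f p.1 p.2 * dl p.1 p.2 b c) =
   (fun b d => f p.1 p.2 * tb s (dl p.1 p.2) b d).
  by apply/funext => b; apply/funext => d; rewrite tbZ.
by rewrite tbZ tbtb_dl mulr0.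
Qed.
End Bilin.

Definition cup0 s (z : 'I_N -> F) i j k := if i == j then cU s i * z k else 0.
Definition cup1 s (z : 'I_N -> F) i j k := if j == k then cU (flip i s) j * z i else 0.
Definition cap0 s (y : 'I_N -> 'I_N -> 'I_N -> F) i := \sum_l cA s l * y l l i.
Definition cap1 s (y : 'I_N -> 'I_N -> 'I_N -> F) i := \sum_l cA (flip i s) l * y i l l.
Definition t0 s (y : 'I_N -> 'I_N -> 'I_N -> F) i j k := tb s (fun b c => y b c k) i j.
Definition t1 s (y : 'I_N -> 'I_N -> 'I_N -> F) i := tb (flip i s) (y i).

Lemma cap1t0 s y i : cap1 s (t0 s y) i = cap0 s (t1 s y) i.
Proof.
rewrite /cap1 /cap0 /t0 /t1 (bigD1 i) //= [in RHS](bigD1 i) //= !tb_eq.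
rewrite [X in cU s i * X](bigD1 i) //= [X in cU (flip i s) i * X](bigD1 i) //=.
rewrite alpha_flip_eq.
pose S1 := \sum_(l | l != i) cA s l * y l l i / (alpha s i + alpha s l).
pose S1' := \sum_(l | l != i) cA (flip i s) l * y i l l / (- alpha s i + alpha (flip i s) l).
pose S2 := \sum_(l | l != i) cA (flip i s) l * tb s (fun b c => y b c l) i l.
pose S2' := \sum_(l | l != i) cA s l * tb (flip l s) (y l) l i.
(* The summands with [l != i] match one by one; those with [l = i] are settled afterwards by [cUA]
   and [cAU]. *)
have e : S2 - S1 = S2' - S1'.
  rewrite -!sumrB; apply: eq_bigr => l li; have il : i != l by rewrite eq_sym.
  rewrite !tb_neq // alpha_flip_eq !alpha_flip_neq // cA_flip //.
  field; rewrite alphaD !alphaB //= -?opprD ?oppr_eq0 ?alphaD //.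
  by rewrite (addrC (- _)) alphaB.
rewrite -/S1 -/S1' -/S2 -/S2'.
have -> : S2 = S2' - S1' + S1 by rewrite -e subrK.
have e1 := cUA s i; have e2 := cAU s i.
have -> : cA (flip i s) i = (cU s i)^-1.
  by apply: (mulfI (cU0 s i)); rewrite e1 mulfV // cU0.
have -> : cU (flip i s) i = (cA s i)^-1.
  by apply: (mulfI (cA0 s i)); rewrite e2 mulfV // cA0.
by field; rewrite -opprD !oppr_eq0 alphaD cU0 cA0 alpha0 (two_neq0 i).
Qed.

Lemma t0cup1 s z i j k : t0 s (cup1 s z) i j k = t1 s (cup0 s z) i j k.
Proof.
rewrite /t0 /t1 /cup0 /cup1.
have hS b : \sum_l cA s l * (if l == k then cU (flip l s) l * z l else 0) / (b + alpha s l) = z k / (b + alpha s k).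
  by rewrite (bigD1 k) //= eqxx mulrA cAU mul1r big1 ?addr0 // => l /negPf ->; rewrite mulr0 mul0r.
have hS' b : \sum_l cA (flip i s) l * (if i == l then cU s i * z l else 0) / (b + alpha (flip i s) l) =
   z i / (b + alpha (flip i s) i).
  rewrite (bigD1 i) //= eqxx mulrA (mulrC (cA _ _)) cUA mul1r big1 ?addr0 // => l.
  by rewrite eq_sym => /negPf ->; rewrite mulr0 mul0r.
case: (eqVneq i j) => [<-|ij].
  rewrite tb_eq hS; case: (eqVneq i k) => [<-|ik].
    rewrite tb_eq !eqxx hS' alpha_flip_eq.
    by field; rewrite -opprD !oppr_eq0 (two_neq0 i) alpha0 alphaD.
  have ki : k != i by rewrite eq_sym.
  rewrite tb_neq // eqxx (negPf ik) alpha_flip_eq alpha_flip_neq //.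
  field; rewrite alphaD /= -opprD oppr_eq0 alphaD (two_neq0 i) alpha0 //.
have ji : j != i by rewrite eq_sym.
rewrite tb_neq //; case: (eqVneq j k) => [<-|jk].
  rewrite tb_eq hS' (negPf ij) alpha_flip_eq alpha_flip_neq //.
  by field; rewrite !alphaB // two_neq0 // alpha0.
rewrite tb_neq // (negPf ij); case: (eqVneq i k) => [<-|ik].
  rewrite cU_flip // alpha_flip_eq alpha_flip_neq //.
  by field; rewrite alphaB // opprK !alphaD.
by rewrite !subrr !mul0r.
Qed.

Section Tri.
Variable s : 'I_N -> bool.
Local Notation Y := ('I_N -> 'I_N -> 'I_N -> F).
Implicit Types y : Y.
Let ext3 (y y' : Y) : (forall i j k, y i j k = y' i j k) -> y = y'.
Proof. by move=> h; apply/funext => i; apply/funext => j; apply/funext => k. Qed.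

Definition w1 y : Y := fun i j k => alpha s i * y i j k.
Definition w2 y : Y := fun i j k => alpha (flip i s) j * y i j k.
Definition w3 y : Y := fun i j k => alpha (flip j (flip i s)) k * y i j k.
Definition c0 y : Y := fun i j k => cb s (fun b c => y b c k) i j.
Definition c1 y : Y := fun i => cb (flip i s) (y i).
Local Notation t0 := (t0 s).
Local Notation t1 := (t1 s).

Lemma t0B y z : t0 (y - z) = t0 y - t0 z.
Proof. by apply: ext3 => i j k; rewrite -[LHS]/(tb s ((fun b c => y b c k) - (fun b c => z b c k)) i j) tbB. Qed.
Lemma t1B y z : t1 (y - z) = t1 y - t1 z.
Proof. by apply: ext3 => i j k; rewrite -[LHS]/(tb (flip i s) (y i - z i) j k) tbB. Qed.
HB.instance Definition _ := GRing.isZmodMorphism.Build Y Y t0 t0B.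
HB.instance Definition _ := GRing.isZmodMorphism.Build Y Y t1 t1B.

Lemma w1t0 y : w1 (t0 y) = t0 (w2 y) + y - c0 y.
Proof. by apply: ext3 => i j k; apply: (congr1 (fun f => f i j) (x1tb s (fun b c => y b c k))). Qed.
Lemma w2t0 y : w2 (t0 y) = t0 (w1 y) - y + c0 y.
Proof. by apply: ext3 => i j k; apply: (congr1 (fun f => f i j) (x2tb s (fun b c => y b c k))). Qed.
Lemma w2t1 y : w2 (t1 y) = t1 (w3 y) + y - c1 y.
Proof. by apply: ext3 => i j k; apply: (congr1 (fun f => f j k) (x1tb (flip i s) (y i))). Qed.
Lemma w3t1 y : w3 (t1 y) = t1 (w2 y) - y + c1 y.
Proof. by apply: ext3 => i j k; apply: (congr1 (fun f => f j k) (x2tb (flip i s) (y i))). Qed.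
Lemma w1t1 y : w1 (t1 y) = t1 (w1 y).
Proof. by apply: ext3 => i j k; rewrite /t1 /w1 tbZ. Qed.
Lemma w3t0 y : w3 (t0 y) = t0 (w3 y).
Proof.
apply: ext3 => i j k; rewrite /t0 /w3 /tb; case: eqP => [<-|_].
  rewrite flipK; have -> : \sum_l cA s l * (alpha (flip l (flip l s)) k * y l l k) / (alpha s i + alpha s l) =
    alpha s k * \sum_l cA s l * y l l k / (alpha s i + alpha s l).
    by rewrite mulr_sumr; apply: eq_bigr => l _; rewrite flipK; ring.
  by ring.
by rewrite (flipC i j); ring.
Qed.
Lemma t00 y : t0 (t0 y) = 0.
Proof. by apply: ext3 => i j k; apply: (congr1 (fun f => f i j) (tbtb s (fun b c => y b c k))). Qed.
Lemma t11 y : t1 (t1 y) = 0.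
Proof. by apply: ext3 => i j k; apply: (congr1 (fun f => f j k) (tbtb (flip i s) (y i))). Qed.
Lemma c0cc y : c0 y = cup0 s (cap0 s y). Proof. by []. Qed.
Lemma c1cc y : c1 y = cup1 s (cap1 s y). Proof. by []. Qed.
Lemma t0_cup1 z : t0 (cup1 s z) = t1 (cup0 s z).
Proof. by apply: ext3 => i j k; apply: t0cup1. Qed.
Lemma cap1_t0 y : cap1 s (t0 y) = cap0 s (t1 y).
Proof. by apply/funext => i; apply: cap1t0. Qed.
Lemma cup00 : cup0 s 0 = 0.
Proof. by apply: ext3 => i j k; rewrite /cup0; case: eqP => // _; rewrite mulr0. Qed.
Lemma cup10 : cup1 s 0 = 0.
Proof. by apply: ext3 => i j k; rewrite /cup1; case: eqP => // _; rewrite mulr0. Qed.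
Lemma cap00 : cap0 s 0 = 0.
Proof. by apply/funext => i; rewrite /cap0 big1 // => l _; rewrite mulr0. Qed.
Lemma cap10 : cap1 s 0 = 0.
Proof. by apply/funext => i; rewrite /cap1 big1 // => l _; rewrite mulr0. Qed.
Lemma c0t1t0 y : c0 (t1 (t0 y)) = 0.
Proof. by rewrite c0cc -cap1_t0 t00 cap10 cup00. Qed.
Lemma c1t0t1 y : c1 (t0 (t1 y)) = 0.
Proof. by rewrite c1cc cap1_t0 t11 cap00 cup10. Qed.
Lemma t1t0c1 y : t1 (t0 (c1 y)) = 0.
Proof. by rewrite c1cc t0_cup1 t11. Qed.
Lemma t0t1c0 y : t0 (t1 (c0 y)) = 0.
Proof. by rewrite c0cc -t0_cup1 t00. Qed.
Lemma t0c1t0 y : t0 (c1 (t0 y)) = t1 (c0 (t1 y)).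
Proof. by rewrite c1cc t0_cup1 cap1_t0. Qed.
Lemma c0t0 y : c0 (t0 y) = 0.
Proof. by apply: ext3 => i j k; apply: (congr1 (fun f => f i j) (cbtb s (fun b c => y b c k))). Qed.
Lemma c1t1 y : c1 (t1 y) = 0.
Proof. by apply: ext3 => i j k; apply: (congr1 (fun f => f j k) (cbtb (flip i s) (y i))). Qed.

(** The defect of the braid relation, shown to vanish through its behaviour under the three dots. *)
Definition bz y : Y := t0 (t1 (t0 y)) - t1 (t0 (t1 y)).
Lemma w1B y z : w1 (y - z) = w1 y - w1 z.
Proof. by apply: ext3 => i j k; rewrite -[RHS]/(w1 y i j k - w1 z i j k) /w1 -mulrBr. Qed.
Lemma w2B y z : w2 (y - z) = w2 y - w2 z.
Proof. by apply: ext3 => i j k; rewrite -[RHS]/(w2 y i j k - w2 z i j k) /w2 -mulrBr. Qed.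
Lemma w3B y z : w3 (y - z) = w3 y - w3 z.
Proof. by apply: ext3 => i j k; rewrite -[RHS]/(w3 y i j k - w3 z i j k) /w3 -mulrBr. Qed.
Lemma t0D y z : t0 (y + z) = t0 y + t0 z. Proof. exact: raddfD. Qed.
Lemma t1D y z : t1 (y + z) = t1 y + t1 z. Proof. exact: raddfD. Qed.

Lemma w1bz y : w1 (bz y) = bz (w3 y).
Proof.
rewrite /bz w1B w1t0 c0t1t0 w2t1 w3t0 w1t1 w1t0 w2t1.
rewrite !(t0B, t1B, t0D, t1D) !(t00, t11, c1t1, t1t0c1) t0c1t0 !(subr0, addr0).
have gen (a' b c d : Y) : a' - c + b - (d + b - c) = a' - d.
  apply: ext3 => i j k; rewrite -[RHS]/(a' i j k - d i j k).
  rewrite -[LHS]/(a' i j k - c i j k + b i j k - (d i j k + b i j k - c i j k)); ring.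
exact: gen.
Qed.
Lemma w2bz y : w2 (bz y) = bz (w2 y).
Proof.
rewrite /bz w2B w2t0 c0t1t0 w1t1 w1t0 w2t1 w3t0 c1t0t1 w3t1.
rewrite !(t0B, t1B, t0D, t1D) !(t00, t11, c1t1, t0t1c0, t1t0c1, raddf0) !(subr0, addr0).
have gen (a' b c d : Y) : a' + b - c - (d - c + b) = a' - d.
  apply: ext3 => i j k; rewrite -[RHS]/(a' i j k - d i j k).
  rewrite -[LHS]/(a' i j k + b i j k - c i j k - (d i j k - c i j k + b i j k)); ring.
exact: gen.
Qed.
Lemma w3bz y : w3 (bz y) = bz (w1 y).
Proof.
rewrite /bz w3B w3t0 w3t1 w2t0 w3t1 w2t0.
rewrite !(t0B, t1B, t0D, t1D) !(t00, t11, c1t0t1, t0t1c0, c0t0, t0c1t0) !(subr0, addr0).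
rewrite w1t1; have gen (a' b c d : Y) : a' - b + c - (d + c - b) = a' - d.
  apply: ext3 => i j k; rewrite -[RHS]/(a' i j k - d i j k).
  rewrite -[LHS]/(a' i j k - b i j k + c i j k - (d i j k + c i j k - b i j k)); ring.
exact: gen.
Qed.

Lemma t0Z (c : F) y : t0 (fun b d e => c * y b d e) = (fun b d e => c * t0 y b d e).
Proof. by apply: ext3 => i j k; rewrite /t0 tbZ. Qed.
Lemma t1Z (c : F) y : t1 (fun b d e => c * y b d e) = (fun b d e => c * t1 y b d e).
Proof. by apply: ext3 => i j k; rewrite /t1 tbZ. Qed.
Lemma bzZ (c : F) y : bz (fun b d e => c * y b d e) = (fun b d e => c * bz y b d e).
Proof.
rewrite /bz !(t0Z, t1Z); apply: ext3 => i j k.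
by rewrite -[LHS]/(c * t0 (t1 (t0 y)) i j k - c * t1 (t0 (t1 y)) i j k) -mulrBr.
Qed.
Lemma bzB y z : bz (y - z) = bz y - bz z.
Proof.
rewrite /bz !(t0B, t1B).
have gen (a' b c d : Y) : a' - b - (c - d) = a' - c - (b - d).
  apply: ext3 => i j k; rewrite -[RHS]/(a' i j k - c i j k - (b i j k - d i j k)).
  rewrite -[LHS]/(a' i j k - b i j k - (c i j k - d i j k)); ring.
exact: gen.
Qed.
HB.instance Definition _ := GRing.isZmodMorphism.Build Y Y bz bzB.
Lemma cap0bz y : cap0 s (bz y) = 0.
Proof.
apply/funext => i; rewrite /cap0.
transitivity (cap0 s (t0 (t1 (t0 y))) i - cap0 s (t1 (t0 (t1 y))) i).
  by rewrite /cap0 -sumrB; apply: eq_bigr => l _; rewrite -mulrBr.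
rewrite -cap1_t0 t00 cap10 subr0 /cap0.
exact: captb.
Qed.
Definition d3 m n p : Y := fun b c d => ((b == m) && (c == n) && (d == p))%:R.
Lemma d3E m n p b c d (h : 'I_N -> 'I_N -> 'I_N -> F) :
  h b c d * d3 m n p b c d = h m n p * d3 m n p b c d.
Proof.
rewrite /d3; case: (eqVneq b m) => [->|_] /=; last by rewrite !mulr0.
case: (eqVneq c n) => [->|_] /=; last by rewrite !mulr0.
by case: (eqVneq d p) => [->|_] /=; last by rewrite !mulr0.
Qed.
(* [bz] intertwines the dots [w1], [w2], [w3] with [w3], [w2], [w1], whose eigenvalues
   separate most pairs of basis vectors. *)
Lemma bz_d3_off m n p i j k : bz (d3 m n p) i j k != 0 ->
  [/\ i = p, j = n & k = m] /\ (uniq [:: i; j; k] \/ i = j /\ j = k).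
Proof.
move=> h.
have e1 := congr1 (fun f => f i j k) (w1bz (d3 m n p)).
have e2 := congr1 (fun f => f i j k) (w2bz (d3 m n p)).
have e3 := congr1 (fun f => f i j k) (w3bz (d3 m n p)).
have f1 : w1 (d3 m n p) = (fun b c d => alpha s m * d3 m n p b c d).
  by apply: ext3 => b c d; apply: (d3E _ _ _ _ _ _ (fun b c d => alpha s b)).
have f2 : w2 (d3 m n p) = (fun b c d => alpha (flip m s) n * d3 m n p b c d).
  by apply: ext3 => b c d; apply: (d3E _ _ _ _ _ _ (fun b c d => alpha (flip b s) c)).
have f3 : w3 (d3 m n p) = (fun b c d => alpha (flip n (flip m s)) p * d3 m n p b c d).
  by apply: ext3 => b c d; apply: (d3E _ _ _ _ _ _ (fun b c d => alpha (flip c (flip b s)) d)).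
move: e1 e2 e3; rewrite f1 f2 f3 !bzZ /w1 /w2 /w3 => /(mulIf h)/alpha_inj[ip s1].
move=> /(mulIf h)/alpha_inj[jn s2] /(mulIf h)/alpha_inj[km s3].
split=> //; subst p n m; move: s1 s2 s3; rewrite /flip /= !inE.
case: (s i) (s j) (s k) => [] [] []; rewrite ?(eq_sym j i) ?(eq_sym k i) ?(eq_sym k j);
 case: (eqVneq i j) => ij; case: (eqVneq i k) => ik; case: (eqVneq j k) => jk //=; by auto.
Qed.
(** [bz_d3_off] leaves three equal letters, excluded because the cap kills the defect, and three
    distinct letters, where the crossings are plain divided differences. *)
Lemma bz_d3 m n p i j k : bz (d3 m n p) i j k = 0.
Proof.
apply/eqP; apply: contraT => h; have [[ip jn km] hh] := bz_d3_off h; subst p n m.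
case: hh => [|[ij jk]]; last first.
  subst j k; have := congr1 (fun f => f i) (cap0bz (d3 i i i)); rewrite /cap0 (bigD1 i) //= big1.
    by move/eqP; rewrite addr0 mulf_eq0 (negPf (cA0 _ _)) (negPf h).
  move=> l li; case: (eqVneq (bz (d3 i i i) l l i) 0) => [->|/bz_d3_off[[e _ _] _]]; first by rewrite mulr0.
  by rewrite e eqxx in li.
rewrite /= !inE negb_or andbT => /andP[/andP[ij ik] jk].
have ji : j != i by rewrite eq_sym. have ki : k != i by rewrite eq_sym. have kj : k != j by rewrite eq_sym.
case/negP: h; apply/eqP; rewrite -[LHS]/(t0 (t1 (t0 (d3 k j i))) i j k - t1 (t0 (t1 (d3 k j i))) i j k).
rewrite /t0 /t1.
rewrite !(tb_neq, alpha_flip_neq) //.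
by field; rewrite !alphaB.
Qed.
Lemma tri_braid y : t0 (t1 (t0 y)) = t1 (t0 (t1 y)).
Proof.
apply/eqP; rewrite -subr_eq0 -/(bz y); apply/eqP.
have -> : y = \sum_(q : 'I_N * 'I_N * 'I_N)
    (fun b c d => y q.1.1 q.1.2 q.2 * d3 q.1.1 q.1.2 q.2 b c d).
  apply: ext3 => b c d; rewrite !fct_sumE.
  rewrite (bigD1 (b, c, d)) //= /d3 !eqxx mulr1 big1 ?addr0 // => -[[m n] p] /= h.
  rewrite (eq_sym b) (eq_sym c) (eq_sym d).
  by move: h; rewrite !xpair_eqE => /negPf ->; rewrite mulr0.
rewrite raddf_sum big1 // => q _ /=; rewrite bzZ; apply: ext3 => i j k.
by rewrite bz_d3 mulr0.
Qed.
End Tri.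
End Blocks.

Section WordModule.
Variables (F : fieldType) (N : nat) (a : 'I_N -> F).
Hypothesis aD : forall i j, a i + a j != 0.
Hypothesis aB : forall i j, i != j -> a i - a j != 0.
Local Notation state := ('I_N -> bool).
Local Notation letters := (seq 'I_N).
Local Notation alpha := (alpha a).
Local Notation cA := (cA a).
Local Notation cU := (cU a).
Local Notation tb := (tb a).
Implicit Types (s : state) (psi : letters -> F) (w v : letters).

(* [s] records the parity of each letter among those on the left; a dot on the letter [i]
   acts by [alpha s i = +- a i]. *)
Definition loc (g : gen) s psi w : F :=
  match g with
  | GX => if w is i :: _ then alpha s i * psi w else 0
  | GT => if w is i :: j :: v then tb s (fun b c => psi [:: b, c & v]) i j else 0
  | GCap => \sum_l cA s l * psi [:: l, l & w]
  | GCup => if w is i :: j :: v then if i == j then cU s i * psi v else 0 else 0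
  end.

(** An operator on an inner strand reaches its place by reading the letters on its left, which
    update the state that determines its signs. *)
Fixpoint rop (g : gen) s (k : nat) psi w : F :=
  match k, w with
  | 0, _ => loc g s psi w
  | k'.+1, i :: w' => rop g (flip i s) k' (fun v => psi (i :: v)) w'
  | _.+1, [::] => 0
  end.

Lemma tb_lin s (I : finType) (c : I -> F) (f : I -> 'I_N -> 'I_N -> F) i j :
  tb s (fun b d => \sum_x c x * f x b d) i j = \sum_x c x * tb s (f x) i j.
Proof.
rewrite /tb; case: eqP => _.
  under [in RHS]eq_bigr => x _ do rewrite mulrBr.
  rewrite [RHS]sumrB; congr (_ - _).
    by rewrite mulr_suml; apply: eq_bigr => x _; rewrite mulrA.
  have -> : \sum_l cA s l * (\sum_x c x * f x l l) / (alpha s i + alpha s l) =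
     \sum_x c x * \sum_l cA s l * f x l l / (alpha s i + alpha s l).
    under eq_bigr => l _ do rewrite mulr_sumr mulr_suml.
    rewrite exchange_big /=; apply: eq_bigr => x _; rewrite mulr_sumr.
    by apply: eq_bigr => l _; ring.
  by rewrite mulr_sumr; apply: eq_bigr => x _; ring.
by rewrite -sumrB mulr_suml; apply: eq_bigr => x _; ring.
Qed.
Lemma loc_lin g s (I : finType) (c : I -> F) (p : I -> letters -> F) w :
  loc g s (fun v => \sum_x c x * p x v) w = \sum_x c x * loc g s (p x) w.
Proof.
case: g => /=.
- case: w => [|i w]; first by rewrite big1 // => x _; rewrite mulr0.
  by rewrite mulr_sumr; apply: eq_bigr => x _; rewrite mulrCA.
- case: w => [|i [|j w]]; [by rewrite big1 // => x _; rewrite mulr0..|exact: tb_lin].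
- under eq_bigr => l _ do rewrite mulr_sumr.
  rewrite exchange_big /=; apply: eq_bigr => x _; rewrite mulr_sumr.
  by apply: eq_bigr => l _; rewrite mulrCA.
- case: w => [|i [|j w]]; [by rewrite big1 // => x _; rewrite mulr0..|].
  case: eqP => _; last by rewrite big1 // => x _; rewrite mulr0.
  by rewrite mulr_sumr; apply: eq_bigr => x _; rewrite mulrCA.
Qed.
Lemma rop_lin g s k (I : finType) (c : I -> F) (p : I -> letters -> F) w :
  rop g s k (fun v => \sum_x c x * p x v) w = \sum_x c x * rop g s k (p x) w.
Proof.
elim: k s p w => [|k IH] s p [|i w] /=; try exact: loc_lin; last exact: IH.
by rewrite big1 // => x _; rewrite mulr0.
Qed.
Lemma ropZ g s k (c : F) psi w : rop g s k (fun v => c * psi v) w = c * rop g s k psi w.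
Proof.
have := rop_lin g s k (fun _ : 'I_1 => c) (fun _ => psi) w.
have -> : (fun v => \sum_(x < 1) c * psi v) = (fun v => c * psi v).
  by apply/funext => v; rewrite big_ord1.
by rewrite big_ord1.
Qed.
Lemma rop_tb g s s' k (p : 'I_N -> 'I_N -> letters -> F) i j w :
  rop g s k (fun v => tb s' (fun b c => p b c v) i j) w =
  tb s' (fun b c => rop g s k (p b c) w) i j.
Proof.
pose coef (q : 'I_N * 'I_N) := tb s' (dl F q.1 q.2) i j.
have h (f : 'I_N -> 'I_N -> F) : tb s' f i j = \sum_q coef q * f q.1 q.2.
  rewrite {1}(_ : f = fun b c => \sum_q f q.1 q.2 * dl F q.1 q.2 b c).
    by rewrite tb_lin; apply: eq_bigr => q _; rewrite mulrC.
  apply/funext => b; apply/funext => c; rewrite (bigD1 (b, c)) //= /dl !eqxx mulr1 big1 ?addr0 //.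
  move=> -[m n] /= hq; rewrite (eq_sym b) (eq_sym c).
  by move: hq; rewrite xpair_eqE => /negPf ->; rewrite mulr0.
rewrite h -rop_lin; congr (rop g s k _ w).
by apply/funext => v; rewrite h.
Qed.
Lemma rop_sub g s k psi phi : rop g s k (psi - phi) = rop g s k psi - rop g s k phi.
Proof.
apply/funext => w; pose c (b : bool) : F := if b then 1 else -1.
have := rop_lin g s k c (fun b => if b then psi else phi) w.
rewrite big_bool /c /= mul1r mulN1r => h.
transitivity (rop g s k psi w - rop g s k phi w); last by [].
rewrite -h; congr (rop g s k _ w); apply/funext => v.
by rewrite big_bool /= mul1r mulN1r.
Qed.
Lemma rop0 g s k : rop g s k (fun _ => 0) = fun _ => 0.
Proof.
apply/funext => w; rewrite -[RHS](mul0r (rop g s k (fun _ => 0) w)) -ropZ.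
by congr (rop g s k _ w); apply/funext => v; rewrite mul0r.
Qed.

(** The interchange law: a local operator exchanges only subwords with the same effect on the state,
    so the operator further right sees the same signs on both sides. *)
Lemma loc_rop g h s c psi w :
  rop h s (gtgt g + c) (loc g s psi) w = loc g s (rop h s (gsrc g + c) psi) w.
Proof.
case: g => /=.
- by case: w => [|i w] //=; rewrite ropZ.
- case: w => [|i [|j w]] //=.
  rewrite (rop_tb _ _ _ _ (fun b c v => psi [:: b, c & v])).
  rewrite /tb; case: eqP => [->|_]; last by rewrite (flipC i j).
  congr (_ / _ - _ * _); rewrite ?flipK //.
  by apply: eq_bigr => l _; rewrite !flipK.
- rewrite rop_lin; apply: eq_bigr => l _ /=; by rewrite flipK.
- case: w => [|i [|j w]] //=; case: eqP => [<-|_]; last by rewrite rop0.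
  by rewrite ropZ flipK.
Qed.

Variable S : state.
Definition endst s w : state := foldl (fun s i => flip i s) s w.
(** Words are walks on the cube of states, each letter flipping one coordinate; [wtS] keeps the
    functions supported on walks from [s] to the fixed end [S]. *)
Definition good k s w := size w = k /\ endst s w = S.
Definition wtS s k psi := forall w, ~ good k s w -> psi w = 0.

Lemma good_cons k s i w : good k.+1 s (i :: w) <-> good k (flip i s) w.
Proof. by split=> -[h1 h2]; split=> //; [case: h1|rewrite /= h1]. Qed.
Lemma good_swap k s i j w : good k s [:: i, j & w] <-> good k s [:: j, i & w].
Proof. by rewrite /good /= flipC. Qed.
Lemma good_pair k s l m w : good k s [:: l, l & w] <-> good k s [:: m, m & w].
Proof. by rewrite /good /= !flipK. Qed.
Lemma good_pair2 k s l w : good k.+2 s [:: l, l & w] <-> good k s w.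
Proof. by rewrite /good /= !flipK; split=> -[h1 h2]; split=> //; [case: h1|rewrite h1]. Qed.

Lemma tb_ext0 s f i j : f i j = 0 -> f j i = 0 -> (i = j -> forall l, f l l = 0) -> tb s f i j = 0.
Proof.
rewrite /tb => h1 h2; case: eqP => [e h|_ _]; last by rewrite h1 h2 subrr mul0r.
by rewrite h // mul0r big1 ?mulr0 ?subrr // => l _; rewrite h // mulr0 mul0r.
Qed.

Lemma wtS_loc g s k psi : wtS s (gsrc g + k) psi -> wtS s (gtgt g + k) (loc g s psi).
Proof.
case: g => /= h w hw /=.
- by case: w hw => //= i w hw; rewrite h ?mulr0.
- case: w hw => [|i [|j w]] //= hw; apply: tb_ext0; first exact: h.
    by apply: h => /good_swap.
  by move=> e l; subst j; apply: h => /good_pair /hw.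
- by rewrite big1 // => l _; rewrite (h [:: l, l & w]) ?mulr0 // => /good_pair2.
- case: w hw => [|i [|j w]] //= hw; case: eqP => // e; subst j.
  by rewrite h ?mulr0 // => /good_pair2.
Qed.
Lemma wtS_cons s k psi i : wtS s k.+1 psi -> wtS (flip i s) k (fun v => psi (i :: v)).
Proof. by move=> h w hw; apply: h => /good_cons. Qed.
Lemma wtS_rop g s k i psi : wtS s k psi -> (i + gsrc g <= k)%N ->
  wtS s (k - gsrc g + gtgt g) (rop g s i psi).
Proof.
elim: i s k psi => [|i IH] s k psi h hi.
  have -> : (k - gsrc g + gtgt g = gtgt g + (k - gsrc g))%N by lia.
  by apply: wtS_loc; rewrite subnKC.
case: k h hi => [|k] h hi; first by lia.
have -> : (k.+1 - gsrc g + gtgt g = (k - gsrc g + gtgt g).+1)%N by lia.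
case=> [|j w] hw //=; apply: (IH (flip j s) k) => //; first exact: wtS_cons.
by move=> hg; apply: hw; apply/good_cons.
Qed.
Lemma loc_out g s k psi : wtS s k psi -> (k < gsrc g)%N -> loc g s psi = fun _ => 0.
Proof.
move=> h hk; apply/funext => w; case: g hk => //= hk.
- by case: w => //= i w; rewrite h ?mulr0 // => -[/=]; lia.
- by case: w => [|i [|j w]] //; apply: tb_ext0 => [||_ l]; apply: h => -[/=]; lia.
- by rewrite big1 // => l _; rewrite h ?mulr0 // => -[/=]; lia.
Qed.
Lemma rop_out g s k i psi : wtS s k psi -> (k < i + gsrc g)%N -> rop g s i psi = fun _ => 0.
Proof.
elim: i s k psi => [|i IH] s k psi h hk; first exact: loc_out h hk.
apply/funext => -[|j w] //=; case: k h hk => [|k] h hk; last first.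
  by rewrite (IH _ k) //; apply: wtS_cons.
have -> : (fun v => psi (j :: v)) = fun _ => 0 by apply/funext => v; apply: h => -[].
by rewrite rop0.
Qed.

Definition evr s (p : word) psi := ev (fun g i => rop g s i) p psi.
Lemma evr_cons s p b psi i w :
  evr s (shiftw b.+1 p) psi (i :: w) = evr (flip i s) (shiftw b p) (fun v => psi (i :: v)) w.
Proof. by elim: p psi => //= e p IH psi; rewrite IH. Qed.
Lemma evr_nil s p b psi : p != [::] -> evr s (shiftw b.+1 p) psi [::] = 0.
Proof.
by case/lastP: p => // p e _; rewrite /shiftw map_rcons /evr -cats1 ev_cat /=.
Qed.

Lemma wtS_size s k psi w : wtS s k psi -> size w != k -> psi w = 0.
Proof. by move=> h hw; apply: h => -[hs]; rewrite hs eqxx in hw. Qed.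

Lemma rel_base s m r k psi w : zrel (N %% 2) m r -> wtS s k psi -> (m <= k)%N ->
  \sum_(e <- r) evr s e.2 psi w *~ e.1 = 0.
Proof.
move=> hr hpsi hk; have sz v : (size v < k)%N -> psi v = 0.
  by move=> hv; apply: wtS_size hpsi _; rewrite neq_ltn hv.
have cupl (f : 'I_N -> F) i : \sum_l (if l == i then f l else 0) = f i.
  by rewrite -big_mkcond big_pred1_eq.
case: hr hk => /=; rewrite ?unlock /= ?mulr1z ?mulrN1z ?addr0 /evr /=.
- move=> _; case: w => [|i [|j w]] //.
  exact: (congr1 (fun f => f i j) (tbtb aD aB s (fun b c => psi [:: b, c & w]))).
- move=> _; case: w => [|i [|j [|l w]]] /=; rewrite ?subrr //.
    by rewrite tb_ext0 ?subrr.
  apply/eqP; rewrite subr_eq0; apply/eqP.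
  exact: (congr1 (fun f => f i j l) (tri_braid aD aB s (fun b c d => psi [:: b, c, d & w]))).
- move=> _; under eq_bigr => l _ do rewrite eqxx mulrA.
  by rewrite -mulr_suml sum_cAU // mulrNz mulr_natl -pmulrn subrr.
- move=> hk; case: w => [|i w].
    by rewrite sz // big1 ?subrr // => l _; rewrite mulr0.
  under eq_bigr => l _ do rewrite (fun_if (fun z => cA s l * z)) mulr0.
  by rewrite cupl mulrA cAU // mul1r subrr.
- move=> hk; case: w => [|i w]; first by rewrite sz // subrr.
  under eq_bigr => l _ do rewrite eq_sym (fun_if (fun z => cA (flip i s) l * z)) mulr0.
  by rewrite cupl mulrA mulrC [cA _ _ * _]mulrC cUA // mulr1 subrr.
- by move=> _; apply: captb.
- move=> _; case: w => [|i w] /=.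
    by rewrite big1 ?subrr // => l _; rewrite mulr0.
  by apply/eqP; rewrite subr_eq0; apply/eqP; apply: (cap1t0 aD aB s (fun b c d => psi [:: b, c, d & w])).
- move=> hk; case: w => [|i [|j w]] /=.
  + by rewrite (sz [::] (ltnW hk)) oppr0 !addr0.
  + by rewrite (sz [:: i] hk) mulr0 oppr0 !addr0.
  + rewrite (tbX1 aD aB s (fun b c => psi [:: b, c & w])) /cb.
    by case: eqP => _; ring.
- move=> _; rewrite -big_split big1 //= => l _.
  by rewrite alpha_flip_eq; ring.
- move=> g h c hk /=; rewrite mulr1z mulrN1z addr0.
  by have /= -> := loc_rop g h s c psi w; rewrite subrr.
Qed.

Lemma rel_shift s m r b k psi w : zrel (N %% 2) m r -> wtS s k psi -> (b + m <= k)%N ->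
  \sum_(e <- r) evr s (shiftw b e.2) psi w *~ e.1 = 0.
Proof.
move=> hr; elim: b s k psi w => [|b IH] s k psi w hpsi hk.
  rewrite -[RHS](rel_base w hr hpsi hk); apply: eq_bigr => e _; congr (evr _ _ _ _ *~ _).
  by rewrite /shiftw -[RHS]map_id; apply: eq_map => -[].
case: w => [|i w].
  rewrite big1 // => e _; case: (eqVneq e.2 [::]) => [->|h]; last by rewrite evr_nil ?mul0rz.
  by rewrite /evr /= (wtS_size hpsi) ?mul0rz //=; lia.
case: k hk hpsi => // k hk hpsi.
rewrite -[RHS](IH (flip i s) k (fun v => psi (i :: v)) w); last by lia.
  by apply: eq_bigr => e _; rewrite evr_cons.
exact: wtS_cons.
Qed.

Let s0 : state := fun _ => false.
Lemma repM_rel m r b k psi : zrel (N %% 2) m r -> wtS s0 k psi -> (b + m <= k)%N ->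
  \sum_(e <- r) ev (fun g i => rop g s0 i) (shiftw b e.2) psi *~ e.1 = 0.
Proof.
move=> hr hpsi hk; apply/funext => w; rewrite fun_sumE.
rewrite -[RHS](rel_shift w hr hpsi hk); apply: eq_bigr => e _; exact: fun_MzE.
Qed.
Lemma wtS_0 k : wtS s0 k 0. Proof. by []. Qed.
Lemma wtS_B k psi phi : wtS s0 k psi -> wtS s0 k phi -> wtS s0 k (psi - phi).
Proof.
move=> h h' w hw; transitivity (psi w - phi w); first by [].
by rewrite h // h' // subrr.
Qed.
Definition repM : nbmod (N %% 2) (letters -> F) :=
  NbMod (fun g i psi phi => rop_sub g s0 i psi phi) wtS_0 wtS_B
    (fun g i k psi => @wtS_rop g s0 k i psi) (fun g i k psi => @rop_out g s0 k i psi) repM_rel.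

Definition gap s := #|[pred i | s i != S i]|.
Lemma gap_flip i s : (gap s <= (gap (flip i s)).+1)%N.
Proof.
rewrite /gap (cardD1 i) [in X in (_ <= X)%N](cardD1 i) !inE.
have -> : #|[predD1 [pred i | s i != S i] & i]| = #|[predD1 [pred j | flip i s j != S j] & i]|.
  by apply: eq_card => j; rewrite !inE /flip; case: eqP; rewrite ?addbF.
by set n1 := #|_|; case: (s i != S i); case: (flip i s i != S i); lia.
Qed.
Lemma good_gap k s w : good k s w -> (gap s <= k)%N.
Proof.
elim: w k s => [|i w IH] [|k] s [] //=.
  by move=> _ ->; rewrite /gap eq_card0 // => j; rewrite !inE eqxx.
move=> [<-] h; apply: leq_trans (gap_flip i s) _; rewrite ltnS; apply: IH; split=> //.
Qed.
Definition lowv k s : letters -> F := fun w => (asbool (good k s w))%:R.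
(** At [k = gap s] the support consists of shortest walks: they repeat no letter and remain shortest
    when two letters are swapped, so the divided difference of their indicator function is 0. *)
Lemma lowv_T k s i : (k <= gap s)%N -> rop GT s i (lowv k s) = fun _ => 0.
Proof.
elim: i k s => [|i IH] k s hk; apply/funext => -[|j w] //=.
  case: w => // l w; rewrite /tb /lowv.
  have -> : asbool (good k s [:: l, j & w]) = asbool (good k s [:: j, l & w]).
    by apply: asbool_equiv_eq; apply: good_swap.
  rewrite subrr mul0r; case: eqP => // e; subst l.
  have hz m : (asbool (good k s [:: m, m & w])) = false.
    apply: asboolF => hg; case: (hg) => /= hs _; move: hg; rewrite -hs => /good_pair2 /good_gap.
    by move: hs hk => /= <-; lia.
  by rewrite hz mul0r big1 ?mulr0 ?subrr // => m _; rewrite hz mulr0 mul0r.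
have hj : (fun v => lowv k s (j :: v)) = if k is k'.+1 then lowv k' (flip j s) else fun _ => 0.
  apply/funext => v; case: k {hk} => [|k]; rewrite /lowv.
    by rewrite asboolF // => -[].
  by congr (_%:R); congr nat_of_bool; apply: asbool_equiv_eq; apply: good_cons.
rewrite hj; case: k hk {hj} => [|k] hk; first by rewrite rop0.
by rewrite IH //; have := gap_flip j s; lia.
Qed.
Lemma lowv_wt k : wtS s0 k (lowv k s0).
Proof. by move=> w hw; rewrite /lowv asboolF. Qed.
Lemma wt_low k psi : (k < gap s0)%N -> wtS s0 k psi -> psi = fun _ => 0.
Proof. by move=> hk h; apply/funext => w; apply: h => /good_gap; lia. Qed.
End WordModule.

(** * The functional lambda and the upper bound *)

Definition indep (K : fieldType) (W : Type) r (v : 'I_r -> W -> K) :=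
  forall c : 'I_r -> K, (forall w, \sum_i c i * v i w = 0) -> forall i, c i = 0.

(** All that is used of the explicit module. Its field may be larger than [K], and [md_ext] carries
    independence over to it; evaluation at [md_w] reads off multiples of the lowest vector
    [md_u]. *)
Record model (K : fieldType) (t n : nat) (G : nat -> nat) := Model {
  md_F : fieldType;
  md_W : Type;
  md_M : nbmod t (md_W -> md_F);
  md_u : md_W -> md_F;
  md_w : md_W;
  md_iota : {rmorphism K -> md_F};
  md_low : lowest md_M n md_u (fun _ v => v = 0);
  md_one : md_u md_w = 1;
  md_lin : forall g i c v, op md_M g i (fun w => c * v w) = (fun w => c * op md_M g i v w);
  md_wtZ : forall k c v, inw md_M k v -> inw md_M k (fun w => c * v w);
  md_dim : forall k r (v : 'I_r -> md_W -> md_F), (forall i, inw md_M k (v i)) ->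
    indep v -> (r <= G k)%N;
  md_ext : forall r (W : Type) (v : 'I_r -> W -> K), indep v -> indep (fun i w => md_iota (v i w))
}.

Arguments md_u {K t n G} m _.
Arguments md_w {K t n G} m.
Arguments md_M {K t n G} m.

Lemma valid_widen b k p : valid k p -> valid (k + b) p /\ wend (k + b) p = (wend k p + b)%N.
Proof.
elim: p k => [|[i g] p IH] k //= /andP[h1 h2]; have [h3 h4] := IH _ h2.
have e : (k + b - gsrc g + gtgt g = k - gsrc g + gtgt g + b)%N by lia.
by rewrite e h3 h4 andbT; split=> //; lia.
Qed.

Lemma zrel_homog t s r : zrel t s r -> exists k d,
  all (fun e => [&& valid s e.2, wend s e.2 == k & wdeg e.2 == d]) r.
Proof.
case=> [||||||||| g h c].
- by exists 2, (-4); rewrite /wdeg unlock.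
- by exists 3, (-6); rewrite /wdeg unlock.
- by exists 0, 0; rewrite /wdeg unlock.
- by exists 1, 0; rewrite /wdeg unlock.
- by exists 1, 0; rewrite /wdeg unlock.
- by exists 0, (-2); rewrite /wdeg unlock.
- by exists 1, (-2); rewrite /wdeg unlock.
- by exists 2, 0; rewrite /wdeg unlock.
- by exists 0, 2; rewrite /wdeg unlock.
- exists (gtgt g + c + gtgt h)%N, (gdeg g + gdeg h) => /=.
  rewrite andbT !wdeg_cons wdeg_nil /= !addr0 !andbT (addrC (gdeg h)) !eqxx !andbT.
  apply/andP; split; first by apply/andP; split; [apply/andP; split; lia|apply/eqP; lia].
  by apply/andP; split; [apply/andP; split; lia|apply/eqP; lia].
Qed.

Section Lambda.
Variables (K : fieldType) (t n : nat) (G : nat -> nat) (m : model K t n G).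
Local Notation F := (md_F m).
Local Notation M := (md_M m).
Local Notation u := (md_u m).
Local Notation iota := (md_iota m).
Local Notation evM := (ev (op M)).

Definition closed0 (h : word) := [&& valid n h, wend n h == n & wdeg h == 0].
Definition lamz (h : word) : int :=
  if pselect (exists z : int, evM h u = u *~ z) is left e then projT1 (cid e) else 0.
(** The coefficient of the lowest vector in [h u]: for reasons of weight and degree only closed
    words of degree 0 contribute, and all others get the value 0. *)
Definition lam (h : word) : K := if closed0 h then (lamz h)%:~R else 0.

Lemma lamzP h : closed0 h -> evM h u = u *~ lamz h.
Proof.
case/and3P=> _ /eqP h2 /eqP h3; rewrite /lamz; case: pselect => [e|[]]; first exact: projT2 (cid e).
have [sub inu uT low] := md_low m.
by have [z hz] := @ev_zero _ _ M n u _ sub inu uT low h h2 h3; exists z; apply/subr0_eq.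
Qed.
Lemma iota_lam h : closed0 h -> iota (lam h) = evM h u (md_w m).
Proof.
move=> hh; rewrite (lamzP hh) fun_MzE /lam hh (md_one m).
by rewrite rmorph_int.
Qed.
Lemma lam_neg h : wend n h = n -> wdeg h < 0 -> evM h u = 0.
Proof.
have [sub inu uT low] := md_low m.
exact: (@ev_neg _ _ M n u _ sub inu uT low h).
Qed.

Lemma lam0 h : ~~ closed0 h -> lam h = 0.
Proof. by rewrite /lam => /negPf ->. Qed.

(** Relations are homogeneous, so either all words of the relation in this context are closed of
    degree 0 or none is; in the first case the identity holds in the explicit module, and [iota] is
    injective. *)
Lemma lam_rel p q s r a : zrel t s r -> (a + s <= wend n p)%N ->
  \sum_(e <- r) lam (p ++ shiftw a e.2 ++ q) *~ e.1 = 0.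
Proof.
move=> hr ha; have [k [d /allP hrd]] := zrel_homog hr.
pose b := (wend n p - (a + s))%N.
have hc e : e \in r -> closed0 (p ++ shiftw a e.2 ++ q) =
    [&& valid n p, valid (a + k + b) q, wend (a + k + b) q == n & wdeg p + (d + wdeg q) == 0].
  move=> he; have /and3P[h1 /eqP h2 /eqP h3] := hrd e he.
  rewrite /closed0 !valid_cat !wend_cat !wdeg_cat wdeg_shift h3.
  have -> : wend n p = (a + s + b)%N by rewrite subnKC.
  have [-> ->] : valid (a + s + b) (shiftw a e.2) /\ wend (a + s + b) (shiftw a e.2) = (a + k + b)%N.
    have [v1 v2] := valid_widen b h1; rewrite -!addnA; split; first exact: valid_shift.
    by rewrite wend_shift // v2 h2.
  by rewrite /= !andbA.
case hcl: [&& valid n p, valid (a + k + b) q, wend (a + k + b) q == n & wdeg p + (d + wdeg q) == 0]; last first.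
  by rewrite big_seq big1 // => e he; rewrite lam0 ?mul0rz // hc // hcl.
apply: (fmorph_inj iota); rewrite rmorph0 rmorph_sum /=.
have inu : inw M n u by case: (md_low m).
have [hw] : inw M (wend n p) (evM p u) by apply: inw_ev.
have := op_rel hr hw ha.
move/(congr1 (ev (op M) q)); rewrite ev_sum ev0 => /(congr1 (fun f => f (md_w m))).
rewrite fun_sumE => h; rewrite -[RHS]h.
rewrite big_seq [RHS]big_seq; apply: eq_bigr => e he.
by rewrite rmorphMz iota_lam ?hc // evMz fun_MzE !ev_cat.
Qed.

Lemma lam_wt : wt (cofun t K) n lam.
Proof.
split=> [p hp|p q s r a hr _]; last exact: lam_rel.
by rewrite lam0 // /closed0 (negPf hp).
Qed.

Definition Lvec (s : seq (K * word)) : word -> K := fun q => \sum_(x <- s) x.1 * lam (x.2 ++ q).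
(** The degree [d] part of [1_k L(n)], in the grading where [lam] has degree 0, that is, before the
    shift by [n(n-1)/2]. *)
Definition inL k d (f : word -> K) := exists2 s : seq (K * word),
  all (fun x => [&& valid n x.2, wend n x.2 == k & wdeg x.2 == d]) s & f = Lvec s.

Lemma inL_supp k d f q : inL k d f -> f q != 0 -> [/\ valid k q, wend k q = n & wdeg q = - d].
Proof.
case=> s /allP hs -> hq.
have [x hx] : exists2 x, x \in s & lam (x.2 ++ q) != 0.
  apply/hasP; apply: contraNT hq => /hasPn h; rewrite /Lvec big_seq big1 // => x hx.
  by move: (h x hx); rewrite negbK => /eqP ->; rewrite mulr0.
move=> h; have : closed0 (x.2 ++ q) by apply: contraNT h => /lam0 ->.
have /and3P[h1 /eqP h2 /eqP h3] := hs x hx.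
rewrite /closed0 valid_cat wend_cat wdeg_cat h1 h2 h3 => /and3P[h4 /eqP h5 /eqP h6].
by split=> //; lia.
Qed.

Definition liftv s : md_W m -> F := fun w => \sum_(x <- s) iota x.1 * evM x.2 u w.
Lemma ev_lin p c v : evM p (fun w => c * v w) = (fun w => c * evM p v w).
Proof. by elim: p v => //= e p IH v; rewrite md_lin IH. Qed.
Lemma ev_sumlin p (I : Type) (s : seq I) (c : I -> F) (v : I -> md_W m -> F) w :
  evM p (fun w => \sum_(x <- s) c x * v x w) w = \sum_(x <- s) c x * evM p (v x) w.
Proof.
have -> : (fun w => \sum_(x <- s) c x * v x w) = \sum_(x <- s) (fun w => c x * v x w).
  by apply/funext => z; rewrite fun_sumE.
rewrite ev_sum fun_sumE; apply: eq_bigr => x _; by rewrite ev_lin.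
Qed.
Lemma liftv_inw k d s : all (fun x => [&& valid n x.2, wend n x.2 == k & wdeg x.2 == d]) s ->
  inw M k (liftv s).
Proof.
move=> /allP hs; have -> : liftv s = \sum_(x <- s) (fun w => iota x.1 * evM x.2 u w).
  by apply/funext => z; rewrite fun_sumE.
rewrite big_seq; elim/big_rec: _ => [|x v hx hv]; first exact: inw0.
apply: inwD => //; apply: md_wtZ; have /and3P[h1 /eqP <- _] := hs x hx.
by have [_ inu _ _] := md_low m; apply: inw_ev.
Qed.
Lemma liftv_ev k d s q :
  all (fun x => [&& valid n x.2, wend n x.2 == k & wdeg x.2 == d]) s ->
  valid k q -> wend k q = n -> wdeg q <= - d ->
  evM q (liftv s) (md_w m) = if wdeg q == - d then iota (Lvec s q) else 0.
Proof.
move=> /allP hs h1 h2 h3; rewrite ev_sumlin /Lvec; case: eqP => hq.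
  rewrite rmorph_sum /= big_seq [RHS]big_seq; apply: eq_bigr => x hx.
  have /and3P[h4 /eqP h5 /eqP h6] := hs x hx.
  rewrite rmorphM iota_lam ?ev_cat //.
  by rewrite /closed0 valid_cat wend_cat wdeg_cat h4 h5 h6 h1 h2 hq subrr !eqxx.
rewrite big_seq big1 // => x hx; have /and3P[h4 /eqP h5 /eqP h6] := hs x hx.
rewrite -ev_cat lam_neg ?mulr0 // ?wend_cat ?h5 // wdeg_cat h6; lia.
Qed.

(* In the highest degree occurring in a linear relation between the lifted vectors, the words
   of opposite degree evaluate it through [lambda]; those of lower degree vanish. *)
Lemma upper_bound k r (v : 'I_r -> word -> K) (d : 'I_r -> int) :
  (forall i, inL k (d i) (v i)) -> indep v -> (r <= G k)%N.
Proof.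
move=> hv hi.
have hex i : exists s, all (fun x => [&& valid n x.2, wend n x.2 == k & wdeg x.2 == d i]) s
     /\ v i = Lvec s by case: (hv i) => s hs1 hs2; exists s.
have [s hs] := boolp.choice hex.
have hs1 i := (hs i).1; have hs2 i := (hs i).2.
apply: (md_dim (v := fun i => liftv (s i))) => [i|c hc]; first exact: liftv_inw (hs1 i).
move=> i0; apply/eqP; apply: contraT => hi0.
case: (@Order.TotalTheory.arg_maxP _ _ _ i0 (fun i => c i != 0) d hi0) => i1 hi1 hmax.
pose c' i := if d i == d i1 then c i else 0.
have hc' : forall i, c' i = 0.
  apply: (md_ext hi) => q.
  case hq: [&& valid k q, wend k q == n & wdeg q == - d i1]; last first.
    rewrite big1 // => i _; rewrite /c'; case: eqP => hd; last by rewrite mul0r.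
    have [->|/(inL_supp (hv i))[h1 h2 h3]] := eqVneq (v i q) 0; first by rewrite rmorph0 mulr0.
    by move: hq; rewrite h1 h2 h3 hd !eqxx.
  have /and3P[h1 /eqP h2 /eqP h3] := hq.
  have hz : (fun w => \sum_i c i * liftv (s i) w) = 0 by apply/funext => w; apply: hc.
  move/(congr1 (fun f => evM q f (md_w m))): hz; rewrite ev0 ev_sumlin => hz.
  rewrite -[RHS]hz; apply: eq_bigr => i _; rewrite /c'.
  case: (eqVneq (c i) 0) => [->|hci]; first by rewrite if_same !mul0r.
  have : d i <= d i1 by exact: hmax.
  rewrite le_eqVlt => /orP[/eqP hd|hd].
    by rewrite (liftv_ev (hs1 i)) // ?h3 hd ?eqxx -?hs2.
  rewrite (liftv_ev (hs1 i)) // ?h3 ?lerN2 ?ltW // lt_eqF // eqr_opp (gt_eqF hd).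
  by rewrite mul0r mulr0.
by move: hi1; have := hc' i1; rewrite /c' eqxx => ->; rewrite eqxx.
Qed.
End Lambda.

(** * Denominators, walks on the cube and construction of the model *)

Local Open Scope quotient_scope.
Lemma fraction_clear (R : idomainType) r (c : 'I_r -> {fraction R}) :
  exists b (p : 'I_r -> R), b != 0 /\ forall i, FracField.tofrac b * c i = FracField.tofrac (p i).
Proof.
have one (x : {fraction R}) : exists y : R * R, y.2 != 0 /\ FracField.tofrac y.2 * x = FracField.tofrac y.1.
  elim/quotW: x => y; exists (\n_y, \d_y); split; first exact: denom_ratioP.
  rewrite /= -[LHS]/(FracField.mul _ _) !piE.
  apply/eqmodP => /=; rewrite FracField.equivfE /FracField.mulf !numden_Ratio ?(oner_eq0, mulf_neq0, denom_ratioP) //.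
  by rewrite !mulr1 mul1r.
have [y hy] := boolp.choice (fun i => one (c i)).
exists (\prod_i (y i).2), (fun i => (\prod_(j | j != i) (y j).2) * (y i).1); split.
  by apply/prodf_neq0 => i _; case: (hy i).
by move=> i; rewrite (bigD1 i) //= !rmorphM /= -(proj2 (hy i)); ring.
Qed.

Local Close Scope quotient_scope.

(** Counts by the first step: at distance [m] from the end, [m] directions lead closer and [N - m]
    lead away. *)
Fixpoint walks (N k m : nat) : nat :=
  if k is k'.+1 then (m * walks N k' m.-1 + (N - m) * walks N k' m.+1)%N else (m == 0%N).

Section Words.
Variables (N : nat) (S : 'I_N -> bool).
Local Notation gap := (gap S).
Local Notation good := (good S).
Fixpoint gwords k s : seq (seq 'I_N) :=
  if k is k'.+1 then flatten [seq [seq i :: w | w <- gwords k' (flip i s)] | i <- enum 'I_N]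
  else if gap s == 0%N then [:: [::]] else [::].
Lemma gwordsP k s w : good k s w -> w \in gwords k s.
Proof.
elim: w k s => [|i w IH] [|k] s [] //= .
  by move=> _ h; have := @good_gap _ S 0 s [::] (conj erefl h); rewrite leqn0 => ->; rewrite inE.
move=> [h1] h2; apply/flattenP; exists [seq i :: w | w <- gwords k (flip i s)].
  by apply/mapP; exists i; rewrite ?mem_enum.
by apply/mapP; exists w => //; apply: IH.
Qed.
Lemma gap_flipE i s : gap (flip i s) = if s i != S i then (gap s).-1 else (gap s).+1.
Proof.
rewrite /gap (cardD1 i) [in RHS](cardD1 i) !inE.
have -> : #|[predD1 [pred i | s i != S i] & i]| = #|[predD1 [pred j | flip i s j != S j] & i]|.
  by apply: eq_card => j; rewrite !inE /flip; case: eqP; rewrite ?addbF.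
by rewrite /flip eqxx addbT; case: (s i) (S i) => [] [].
Qed.
Lemma size_gwords k s : size (gwords k s) = walks N k (gap s).
Proof.
elim: k s => [|k IH] s /=; first by case: eqP.
rewrite size_flatten /shape -map_comp sumnE big_map big_enum /=.
under eq_bigr => i _ do rewrite size_map IH gap_flipE.
rewrite (bigID (fun i => s i != S i)) /=; congr (_ + _)%N.
  rewrite (eq_bigr (fun => walks N k (gap s).-1)) => [|i ->] //.
  by rewrite sum_nat_const; congr (_ * _)%N; apply: eq_card.
rewrite (eq_bigr (fun => walks N k (gap s).+1)) => [|i /negPf ->] //.
rewrite sum_nat_const; congr (_ * _)%N.
have := cardC [pred i | s i != S i]; rewrite card_ord /gap => e.
by apply/esym/eqP; rewrite -(eqn_add2l (gap s)) /gap subnKC ?e // -[X in (_ <= X)%N]e leq_addr.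
Qed.
Lemma good_ex s : exists w, good (gap s) s w.
Proof.
move e: (gap s) => k; elim: k s e => [|k IH] s e.
  exists [::]; split=> //=; apply/funext => i; apply/eqP; apply: contraT => h.
  by move: e; rewrite /gap (cardD1 i) inE h.
have /card_gt0P[i] : (0 < gap s)%N by rewrite e.
rewrite inE => hi; have hg : gap (flip i s) = k by rewrite gap_flipE hi e.
by have [w [h1 h2]] := IH _ hg; exists (i :: w); split=> //=; rewrite h1.
Qed.
End Words.

Section ModelEx.
Variables (K : fieldType) (n N : nat).
Hypothesis two : (2%:R : K) != 0.
Hypothesis nN : (n <= N)%N.
Local Notation F := {fraction {poly K}}.
(** Distinct powers of the variable separate the letters; [2 X^(i+1) != 0] is where the
    characteristic enters. *)
Definition modela (i : 'I_N) : F := FracField.tofrac 'X^(i.+1).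
Lemma modelaD i j : modela i + modela j != 0.
Proof.
rewrite -rmorphD tofrac_eq0; apply: contraTneq isT => /(congr1 (fun p : {poly K} => p`_i.+1)).
rewrite coefD !coefXn eqxx coef0; case: (_ == _) => /eqP; first by rewrite (negPf two).
by rewrite addr0 oner_eq0.
Qed.
Lemma modelaB i j : i != j -> modela i - modela j != 0.
Proof.
move=> ij; rewrite -rmorphB tofrac_eq0; apply: contraTneq isT => /(congr1 (fun p : {poly K} => p`_i.+1)).
rewrite coefB !coefXn eqxx coef0 eqSS val_eqE (negPf ij) subr0 => /eqP.
by rewrite oner_eq0.
Qed.
Definition modelS (i : 'I_N) : bool := (i < n)%N.
Definition modelM := repM modelaD modelaB modelS.
Definition modelI : {rmorphism K -> F} := (@FracField.tofrac _ \o polyC).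

Lemma gap_modelS : gap modelS (fun _ => false) = n.
Proof.
rewrite /gap -sum1_card (eq_bigl (fun i : 'I_N => (i < n)%N)); last by move=> i; rewrite inE /modelS; case: (i < n)%N.
by rewrite (big_ord_narrow nN) sum1_card card_ord.
Qed.
Lemma model_lin g s k c v : rop modela g s k (fun w => c * v w) = (fun w => c * rop modela g s k v w).
Proof. by apply/funext => w; apply: ropZ. Qed.

Lemma model_dim k r (v : 'I_r -> seq 'I_N -> F) : (forall i, inw modelM k (v i)) ->
    indep v -> (r <= walks N k n)%N.
Proof.
move=> hv hi; rewrite -gap_modelS -size_gwords; set ws := gwords _ _ _.
pose A := \matrix_(i < r, j < size ws) v i (nth [::] ws j).
suff /eqP <- : row_free A by apply: rank_leq_col.
apply: inj_row_free => c hc; apply/rowP => i; rewrite mxE; move: i.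
apply: (hi (fun i => c 0 i)) => w.
have [hw|hw] := pselect (good modelS k (fun _ => false) w); last first.
  by rewrite big1 // => i _; case: (hv i) => /(_ w hw) ->; rewrite mulr0.
have hj := gwordsP hw; rewrite -index_mem in hj.
move/rowP/(_ (Ordinal hj)): hc; rewrite !mxE => hc; rewrite -[RHS]hc.
by apply: eq_bigr => i _; rewrite mxE /= nth_index // gwordsP.
Qed.
(** Clear denominators in a relation over [K(X)], then compare the coefficients of each power of
    [X]. *)
Lemma model_ext r (W : Type) (v : 'I_r -> W -> K) : indep v -> indep (fun i w => modelI (v i w)).
Proof.
move=> hi c hc i; have [b [p [hb hp]]] := fraction_clear c.
suff h : p i = 0.
  move/eqP: (hp i); rewrite h rmorph0 mulf_eq0 tofrac_eq0 (negPf hb) /=.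
  by move/eqP.
apply/polyP => j; rewrite coef0; apply: (hi (fun i => (p i)`_j)) => w.
have : FracField.tofrac (\sum_i p i * (v i w)%:P) = 0.
  rewrite rmorph_sum -[RHS](mulr0 (FracField.tofrac b)) -[in RHS](hc w) mulr_sumr.
  by apply: eq_bigr => l _; rewrite mulrA hp /= -rmorphM.
move/eqP; rewrite tofrac_eq0 => /eqP /(congr1 (fun q : {poly K} => q`_j)).
by rewrite coef0 coef_sum => h; rewrite -[RHS]h; apply: eq_bigr => l _; rewrite coefMC.
Qed.
End ModelEx.

Lemma model_ex (K : fieldType) (t n N : nat) : (2%:R : K) != 0 -> (n <= N)%N -> (N %% 2 = t)%N ->
  exists m : model K t n (fun k => walks N k n), True.
Proof.
move=> two nN et; subst t.
have [w0 hw0] := good_ex (@modelS n N) (fun _ => false).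
have hg := gap_modelS nN.
suff m : model K (N %% 2) n (fun k => walks N k n) by exists m.
unshelve refine (@Model K _ n _ {fraction {poly K}} _ (@modelM K n N two) (lowv _ (@modelS n N) n (fun _ => false)) w0 (modelI K) _ _ _ _ _ _) => //.
- split.
  + split=> // [k v ->|k v w -> ->|g i k v ->]; [exact: wt_0|by rewrite subrr|exact: op0].
  + by constructor; apply: lowv_wt.
  + by move=> i; apply: lowv_T; rewrite hg.
  + by move=> k v hk [/wt_low]; apply; rewrite hg.
- by rewrite /lowv asboolT //; move: hw0; rewrite hg.
- by move=> g i c v; apply: model_lin.
- by move=> k c v [h]; constructor => /= w hw; rewrite (h w hw) mulr0.
- by move=> k r v; apply: model_dim.
- by move=> r W v; apply: model_ext.
Qed.

(** * Independent families and lowest weight vectors *)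

Section Families.
Variables (K : fieldType) (W : Type).
Implicit Types (P Z Q : (W -> K) -> Prop) (v : W -> K).
Definition sc (c : K) v : W -> K := fun w => c * v w.
Lemma scN1 v : sc (-1) v = - v. Proof. by apply/funext => w; rewrite /sc mulN1r. Qed.
Lemma sc1 v : sc 1 v = v. Proof. by apply/funext => w; rewrite /sc mul1r. Qed.
Lemma sc0 v : sc 0 v = 0. Proof. by apply/funext => w; rewrite /sc mul0r. Qed.
Lemma scv0 c : sc c 0 = 0. Proof. by apply/funext => w; rewrite /sc [X in _ * X]/(0 : K) mulr0. Qed.
Lemma scM c d v : sc c (sc d v) = sc (c * d) v. Proof. by apply/funext => w; rewrite /sc mulrA. Qed.
Lemma scD c v v' : sc c (v + v') = sc c v + sc c v'.
Proof. by apply/funext => w; rewrite -[RHS]/(c * v w + c * v' w) -mulrDr. Qed.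
Lemma scB c v v' : sc c (v - v') = sc c v - sc c v'.
Proof. by apply/funext => w; rewrite -[RHS]/(c * v w - c * v' w) -mulrBr. Qed.
Lemma scz (z : int) v : v *~ z = sc z%:~R v.
Proof. by apply/funext => w; rewrite fun_MzE /sc mulrzl. Qed.
Lemma sc_sum c (I : Type) (s : seq I) (F : I -> W -> K) : sc c (\sum_(i <- s) F i) = \sum_(i <- s) sc c (F i).
Proof. by apply/funext => w; rewrite /sc !fun_sumE mulr_sumr; apply: eq_bigr. Qed.
Lemma sc_suml v (I : Type) (s : seq I) (c : I -> K) : sc (\sum_(i <- s) c i) v = \sum_(i <- s) sc (c i) v.
Proof. by apply/funext => w; rewrite /sc !fun_sumE mulr_suml. Qed.

Record subsp Z : Prop := Subsp {
  ss_0 : Z 0; ss_B : forall v v', Z v -> Z v' -> Z (v - v'); ss_sc : forall c v, Z v -> Z (sc c v) }.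
Lemma ss_N Z v : subsp Z -> Z v -> Z (- v).
Proof. by move=> hZ; rewrite -scN1; apply: ss_sc. Qed.
Lemma ss_D Z v v' : subsp Z -> Z v -> Z v' -> Z (v + v').
Proof. by move=> hZ h h'; rewrite -[v']opprK; apply: ss_B => //; apply: ss_N. Qed.
Lemma ss_sum Z (I : eqType) (s : seq I) (F : I -> W -> K) : subsp Z ->
  (forall i, i \in s -> Z (F i)) -> Z (\sum_(i <- s) F i).
Proof.
by move=> hZ h; rewrite big_seq; elim/big_rec: _ => [|i v hi hv]; [apply: ss_0|apply: ss_D; auto].
Qed.
Lemma subsp0 : subsp (fun v => v = 0).
Proof. by split=> // [v v' -> ->|c v ->]; rewrite ?subrr ?scv0. Qed.

(** Lower bounds are expressed by explicit families, independent modulo [Z], so that subquotients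
    can be treated inside one ambient space of functions. *)
Definition indfam P Z r := exists v : 'I_r -> W -> K, (forall i, P (v i)) /\
  forall c : 'I_r -> K, Z (\sum_i sc (c i) (v i)) -> forall i, c i = 0.

Lemma indfam_indep P r : indfam P (fun v => v = 0) r <->
  exists2 v : 'I_r -> W -> K, (forall i, P (v i)) & indep v.
Proof.
split=> [[v [h1 h2]]|[v h1 h2]]; exists v => //.
  move=> c hc; apply: h2; apply/funext => w; rewrite fun_sumE -[RHS](hc w).
  by apply: eq_bigr.
split=> // c hc; apply: h2 => w; move/(congr1 (fun f => f w)): hc; rewrite fun_sumE => hc.
by rewrite -[RHS]hc; apply: eq_bigr.
Qed.
Lemma indfam0 P Z : indfam P Z 0.
Proof. by exists (fun _ => 0); split=> [[]|c _ []]. Qed.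
Lemma indfamW P P' Z Z' r : (forall v, P v -> P' v) -> (forall v, Z' v -> Z v) -> indfam P Z r -> indfam P' Z' r.
Proof. by move=> h h' [v [h1 h2]]; exists v; split=> [i|c /h' /h2]; auto. Qed.
(** One step of a filtration: vectors independent modulo the larger space [Q], together with vectors
    of [Q] independent modulo [Z]. *)
Lemma indfamD P Q Z r s : subsp Q -> (forall v, Z v -> Q v) ->
  indfam P Q r -> indfam (fun v => P v /\ Q v) Z s -> indfam P Z (r + s).
Proof.
move=> hQ ZQ [v [v1 v2]] [w [w1 w2]].
exists (fun i => match fintype.split i with inl j => v j | inr j => w j end); split.
  by move=> i; case: (fintype.split i) => j; [|case: (w1 j)].
move=> c hc.
have e : \sum_i sc (c i) (match fintype.split i with inl j => v j | inr j => w j end) =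
  \sum_j sc (c (lshift s j)) (v j) + \sum_j sc (c (rshift r j)) (w j).
  rewrite big_split_ord; congr (_ + _); apply: eq_bigr => j _.
    by rewrite (unsplitK (inl j)).
  by rewrite (unsplitK (inr j)).
rewrite e in hc.
have hw : Q (\sum_j sc (c (rshift r j)) (w j)).
  by apply: ss_sum => // j _; apply: ss_sc => //; case: (w1 j).
have c1 j : c (lshift s j) = 0.
  apply: (v2 (fun j => c (lshift s j))); have := ss_B hQ (ZQ _ hc) hw.
  by rewrite addrK.
have c2 j : c (rshift r j) = 0.
  apply: (w2 (fun j => c (rshift r j))); move: hc; rewrite big1 ?add0r // => i _.
  by rewrite c1 sc0.
by move=> i; rewrite -(splitK i); case: (fintype.split i) => j /=; rewrite ?c1 ?c2.
Qed.
Lemma indfam1 P Z v : subsp Z -> P v -> ~ Z v -> indfam P Z 1.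
Proof.
move=> hZ hP hv; exists (fun _ => v); split=> // c; rewrite big_ord1 => hc i.
rewrite ord1; apply/eqP; apply: contra_notT hv => h0.
by rewrite -[v]sc1 -(mulVf h0) -scM; apply: ss_sc.
Qed.
End Families.

Section Linear.
Variables (K : fieldType) (W : Type) (t : nat) (M : nbmod t (W -> K)).
Definition klin := forall g i c v, op M g i (sc c v) = sc c (op M g i v).
Hypothesis Mlin : klin.
Lemma ev_sc p c v : ev (op M) p (sc c v) = sc c (ev (op M) p v).
Proof. by elim: p v => //= e p IH v; rewrite Mlin IH. Qed.
Definition evs (s : seq (K * word)) v := \sum_(x <- s) sc x.1 (ev (op M) x.2 v).
Lemma ev_evs q s v : ev (op M) q (evs s v) = \sum_(x <- s) sc x.1 (ev (op M) (x.2 ++ q) v).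
Proof. by rewrite /evs ev_sum; apply: eq_bigr => x _; rewrite ev_sc ev_cat. Qed.
Lemma evs_cat s s' v : evs (s ++ s') v = evs s v + evs s' v.
Proof. exact: big_cat. Qed.
Definition scs (c : K) (s : seq (K * word)) := [seq (c * x.1, x.2) | x <- s].
Lemma evs_scs c s v : evs (scs c s) v = sc c (evs s v).
Proof. by rewrite /evs big_map sc_sum; apply: eq_bigr => x _; rewrite scM. Qed.
Definition rws (s : seq (K * word)) q := [seq (x.1, x.2 ++ q) | x <- s].
Lemma evs_rws s q v : evs (rws s q) v = ev (op M) q (evs s v).
Proof. by rewrite ev_evs /evs big_map. Qed.
End Linear.

(** * Comparison of L(m) with an arbitrary lowest vector of weight m *)

Section LemmaX.
Variables (K : fieldType) (t m : nat) (G : nat -> nat) (mo : model K t m G).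
Variables (W : Type) (M : nbmod t (W -> K)) (Mlin : klin M).
Variables (u : W -> K) (D : nat -> (W -> K) -> Prop).
Hypotheses (low : lowest M m u D) (Dsc : forall k, subsp (D k)) (hu : ~ D m u).

(** [joint_ev_zero], applied to [u] and to the lowest vector of the explicit module, identifies the
    integer with [lam]. *)
Lemma lam_lowest q : closed0 m q -> D m (ev (op M) q u - sc (lam mo q) u).
Proof.
move=> hq; have /and3P[_ /eqP h2 /eqP h3] := hq.
have [z [h4 h5]] := joint_ev_zero low (md_low mo) h2 h3.
suff -> : lam mo q = z%:~R by rewrite -scz.
apply: (fmorph_inj (md_iota mo)); rewrite iota_lam // rmorph_int.
move/subr0_eq: h5 => ->; by rewrite fun_MzE md_one.
Qed.
Definition pres k (d : int) (s : seq (K * word)) :=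
  all (fun x => [&& valid m x.2, wend m x.2 == k & wdeg x.2 == d]) s.
(** [L(m)] is a quotient of the module generated by [u] modulo [D]: if a combination sends [u] into
    [D], so does its continuation by any closing word, whose action on [u] is the value of [lam]. *)
Lemma lowest_Lvec k d s : pres k d s -> D k (evs M s u) -> Lvec mo s = 0.
Proof.
move=> /allP hs hD; apply/funext => q; rewrite -[RHS]/(0 : K) /Lvec.
have hc x : x \in s -> closed0 m (x.2 ++ q) = [&& valid k q, wend k q == m & d + wdeg q == 0].
  move=> /hs /and3P[h1 /eqP h2 /eqP h3].
  by rewrite /closed0 valid_cat wend_cat wdeg_cat h1 h2 h3.
case hq: [&& valid k q, wend k q == m & d + wdeg q == 0]; last first.
  by rewrite big_seq big1 // => x hx; rewrite lam0 ?mulr0 // hc // hq.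
have /and3P[_ /eqP hk _] := hq.
have hsub := lw_sub low.
have := sub_ev q hsub hD; rewrite hk ev_evs // => hD'.
have hD2 : D m (\sum_(x <- s) sc x.1 (ev (op M) (x.2 ++ q) u - sc (lam mo (x.2 ++ q)) u)).
  apply: ss_sum => // x hx; apply: ss_sc => //; apply: lam_lowest; by rewrite hc.
have := sub_B hsub hD' hD2; rewrite -sumrB.
have -> : \sum_(x <- s) (sc x.1 (ev (op M) (x.2 ++ q) u) -
    sc x.1 (ev (op M) (x.2 ++ q) u - sc (lam mo (x.2 ++ q)) u)) =
    sc (\sum_(x <- s) x.1 * lam mo (x.2 ++ q)) u.
  by rewrite sc_suml; apply: eq_bigr => x _; rewrite scB opprB addrC subrK scM.
move=> h; apply/eqP; apply: contra_notT hu => h0.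
by rewrite -[u]sc1 -(mulVf h0) -scM; apply: ss_sc.
Qed.

Lemma Lvec_cat s s' : Lvec mo (s ++ s') = Lvec mo s + Lvec mo s'.
Proof. by apply/funext => q; rewrite /Lvec big_cat. Qed.
Lemma Lvec_scs c s : Lvec mo (scs c s) = sc c (Lvec mo s).
Proof.
by apply/funext => q; rewrite /Lvec /sc big_map mulr_sumr; apply: eq_bigr => x _; rewrite mulrA.
Qed.
Lemma pres_scs k d c s : pres k d s -> pres k d (scs c s).
Proof. by move=> h; rewrite /pres all_map. Qed.
Lemma evs_indfam (P Z : (W -> K) -> Prop) k d r : indfam (inL mo k d) (fun v => v = 0) r ->
  (forall s, pres k d s -> Z (evs M s u) -> Lvec mo s = 0) ->
  (forall s, pres k d s -> P (evs M s u)) -> indfam P Z r.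
Proof.
move=> [v [h1 h2]] hZ hP.
have hex i : exists s, pres k d s /\ v i = Lvec mo s by case: (h1 i) => s; exists s.
have [s hs] := boolp.choice hex.
exists (fun i => evs M (s i) u); split=> [i|c hc]; first by apply: hP; case: (hs i).
apply: h2.
pose s' := flatten [seq scs (c i) (s i) | i <- enum 'I_r].
have e1 : evs M s' u = \sum_i sc (c i) (evs M (s i) u).
  by rewrite /evs big_flatten /= big_map big_enum; apply: eq_bigr => i _; apply: evs_scs.
have e2 : Lvec mo s' = \sum_i sc (c i) (v i).
  apply/funext => q; rewrite /Lvec big_flatten /= big_map big_enum fun_sumE; apply: eq_bigr => i _.
  by rewrite (hs i).2 -Lvec_scs.
rewrite -e2; apply: hZ; last by rewrite e1.
apply/allP => x /flattenP[y /mapP[i _ ->] hx].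
by have /allP/(_ x hx) := pres_scs (c i) (hs i).1.
Qed.
(** Consequently the dimensions of [L(m)] are lower bounds for any subquotient that contains a
    lowest vector of weight [m]. *)
Lemma lowest_indfam (P : (W -> K) -> Prop) k d r : indfam (inL mo k d) (fun v => v = 0) r ->
  (forall s, pres k d s -> P (evs M s u)) -> indfam P (D k) r.
Proof. by move=> h hP; apply: evs_indfam h _ hP => s; apply: lowest_Lvec. Qed.
End LemmaX.

(** * The irreducible module *)

Section LModule.
Variables (K : fieldType) (t n : nat) (G : nat -> nat) (mo : model K t n G).
Local Notation C := (cofun t K).
Local Notation l := (lam mo).
Local Notation M := (md_M mo).
Local Notation u := (md_u mo).

Lemma evs_lam s : evs C s l = Lvec mo s.
Proof. by apply/funext => q; rewrite /evs fun_sumE /Lvec; apply: eq_bigr => x _; rewrite /sc ev_co. Qed.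

Lemma lam_nil : l [::] = 1.
Proof.
apply: (fmorph_inj (md_iota mo)); rewrite rmorph1 iota_lam; first exact: md_one.
by rewrite /closed0 wdeg_nil /= !eqxx.
Qed.
Lemma lam_neq0 : l <> 0.
Proof. by move/(congr1 (fun f => f [::])); rewrite lam_nil => /eqP; rewrite oner_eq0. Qed.
Lemma lam_ev0 p : ev (op M) p u = 0 -> ev (op C) p l = 0.
Proof.
move=> h; apply/funext => q; rewrite ev_co -[RHS]/(0 : K).
case hq: (closed0 n (p ++ q)); last by rewrite lam0 // hq.
by apply: (fmorph_inj (md_iota mo)); rewrite iota_lam // ev_cat h ev0 rmorph0.
Qed.
Lemma lam_closed h : closed0 n h -> ev (op C) h l = sc (l h) l.
Proof.
move=> hh; have /and3P[h1 /eqP h2 /eqP h3] := hh; apply/funext => q; rewrite ev_co /sc.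
have e : closed0 n (h ++ q) = closed0 n q.
  by rewrite /closed0 valid_cat wend_cat wdeg_cat h1 h2 h3 add0r.
case hq: (closed0 n q); last by rewrite (@lam0 _ _ _ _ _ (h ++ q)) ?e ?hq // (@lam0 _ _ _ _ _ q) ?hq // mulr0.
apply: (fmorph_inj (md_iota mo)); rewrite rmorphM !iota_lam // ?e //.
by rewrite ev_cat (lamzP mo hh) evMz !fun_MzE md_one mulrzl.
Qed.
Lemma lamT i : op C GT i l = 0.
Proof. by apply: (@lam_ev0 [:: (i, GT)]); have [_ _ h _] := md_low mo; apply: h. Qed.
Lemma lam_out p k : valid n p -> wend n p = k -> (k < n)%N -> ev (op C) p l = 0.
Proof.
move=> _ h1 h2; apply: lam_ev0; have [_ h3 _ h4] := md_low mo.
by apply: (h4 k) => //; rewrite -h1; apply: inw_ev.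
Qed.
Lemma lam_negC p : wend n p = n -> wdeg p < 0 -> ev (op C) p l = 0.
Proof. by move=> h1 h2; apply: lam_ev0; apply: lam_neg. Qed.

Definition spanL k v := exists2 s : seq (K * word),
  all (fun x => valid n x.2 && (wend n x.2 == k)) s & v = Lvec mo s.
Lemma inL_span k d v : inL mo k d v -> spanL k v.
Proof. by case=> s /allP h ->; exists s => //; apply/allP => x /h /and3P[-> ->]. Qed.
Lemma spanL_ss k : subsp (spanL k).
Proof.
split=> [|v v' [s hs ->] [s' hs' ->]|c v [s hs ->]].
- by exists [::] => //; apply/funext => q; rewrite /Lvec big_nil.
- exists (s ++ scs (-1) s'); first by rewrite all_cat hs all_map.
  by rewrite Lvec_cat Lvec_scs scN1.
- by exists (scs c s); [rewrite all_map|rewrite Lvec_scs].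
Qed.
Lemma inL_ss k d : subsp (inL mo k d).
Proof.
split=> [|v v' [s hs ->] [s' hs' ->]|c v [s hs ->]].
- by exists [::] => //; apply/funext => q; rewrite /Lvec big_nil.
- exists (s ++ scs (-1) s'); first by rewrite all_cat hs all_map.
  by rewrite Lvec_cat Lvec_scs scN1.
- by exists (scs c s); [rewrite all_map|rewrite Lvec_scs].
Qed.
Lemma Lvec_wt k s : all (fun x => valid n x.2 && (wend n x.2 == k)) s -> wt C k (Lvec mo s).
Proof.
move=> /allP hs; suff [h] : inw C k (Lvec mo s) by [].
rewrite -evs_lam /evs big_seq; elim/big_rec: _ => [|x v /hs /andP[_ /eqP <-] hv]; first exact: inw0.
apply: inwD => //; rewrite -ev_sc //; apply: inw_ev; constructor.
have [h1 h2] := lam_wt mo; split=> [p hp|p q m r a hr hp ha].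
  by rewrite /sc h1 ?mulr0.
rewrite -[RHS](mulr0 x.1) -[in RHS](h2 p q m r a hr hp ha) mulr_sumr.
by apply: eq_bigr => e _; rewrite /sc mulrzAr.
Qed.
Lemma spanL_evC q k v : spanL k v -> spanL (wend k q) (ev (op C) q v).
Proof.
move=> [s hs ->]; case hq: (valid k q); last first.
  have hw : inw C k (Lvec mo s) by constructor; apply: Lvec_wt.
  by rewrite (ev_invalid hw) ?hq //; apply: (ss_0 (spanL_ss _)).
exists (rws s q); last by rewrite -!evs_lam evs_rws.
apply/allP => _ /mapP[x /(allP hs) /andP[h1 /eqP h2] ->] /=.
by rewrite valid_cat wend_cat h1 h2 hq eqxx.
Qed.
Lemma inL_ev q k d v : inL mo k d v -> inL mo (wend k q) (d + wdeg q) (ev (op C) q v).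
Proof.
move=> [s hs ->]; case hq: (valid k q); last first.
  have hw : inw C k (Lvec mo s).
    by constructor; apply: Lvec_wt; apply/allP => x /(allP hs) /and3P[-> ->].
  by rewrite (ev_invalid hw) ?hq //; apply: (ss_0 (inL_ss _ _)).
exists (rws s q); last by rewrite -!evs_lam evs_rws.
apply/allP => _ /mapP[x /(allP hs) /and3P[h1 /eqP h2 /eqP h3] ->] /=.
by rewrite valid_cat wend_cat wdeg_cat h1 h2 h3 hq !eqxx.
Qed.
Lemma spanL_sub : submodule C spanL.
Proof.
split=> [k v [s hs ->]|k|k v w|g i k v h]; first exact: Lvec_wt.
- exact: (ss_0 (spanL_ss _)).
- exact: (ss_B (spanL_ss _)).
- exact: (@spanL_evC [:: (i, g)]).
Qed.
Definition LV := restrict spanL_sub.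
Lemma inw_LV k v : inw LV k v <-> spanL k v.
Proof. by split=> [[h]|h]; [|constructor]. Qed.
Lemma spanL_lam : spanL n l.
Proof. by exists [:: (1, [::])]; rewrite /= ?eqxx // -evs_lam /evs big_seq1 sc1. Qed.
Lemma inL_lam : inL mo n 0 l.
Proof.
exists [:: (1, [::])]; rewrite /= ?wdeg_nil ?eqxx // -evs_lam /evs big_seq1 sc1 //.
Qed.
Lemma spanL_low k v : spanL k v -> (k < n)%N -> v = 0.
Proof.
move=> [s /allP hs ->] hk; rewrite -evs_lam /evs big_seq big1 // => x /hs /andP[h1 /eqP h2].
by rewrite (lam_out h1 h2) // scv0.
Qed.
Lemma wend_parity k p : valid k p -> wend k p = k %[mod 2].
Proof.
by elim: p k => //= [[i g] p] IH k /andP[h1 h2]; rewrite IH //; case: g h1 h2 => /= h1 h2; lia.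
Qed.
Lemma spanL_parity k v : spanL k v -> k != n %[mod 2] -> v = 0.
Proof.
move=> [s /allP hs ->] hk; rewrite /Lvec; apply/funext => q; rewrite big_seq big1 // => x /hs /andP[h1 /eqP h2].
by move: hk; rewrite -h2 wend_parity // eqxx.
Qed.
Lemma inL_neg d v : inL mo n d v -> d < 0 -> v = 0.
Proof.
move=> [s /allP hs ->] hd; rewrite -evs_lam /evs big_seq big1 // => x /hs /and3P[h1 /eqP h2 /eqP h3].
by rewrite lam_negC ?scv0 // h3.
Qed.
Lemma inL_eval k v q : valid k q -> wend k q = n ->
  inL mo k (- wdeg q) v -> ev (op C) q v = sc (v q) l.
Proof.
move=> h1 h2 [s /allP hs ->]; rewrite -evs_lam ev_evs // evs_lam /Lvec sc_suml big_seq [RHS]big_seq.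
apply: eq_bigr => x /hs /and3P[h3 /eqP h4 /eqP h5]; rewrite lam_closed ?scM //.
by rewrite /closed0 valid_cat wend_cat wdeg_cat h3 h4 h5 h1 h2 addNr !eqxx.
Qed.
(** Irreducibility of [L(n)]: a nonzero function is nonzero at some word, and that word carries it
    to a nonzero multiple of [lam]. *)
Lemma inL_hit k d v : inL mo k d v -> v <> 0 ->
  exists q, [/\ valid k q, wend k q = n, wdeg q = - d & exists2 c, c != 0 & ev (op C) q v = sc c l].
Proof.
move=> h hv; have [q hq] : exists q, v q != 0.
  by apply: contrapT => hn; apply: hv; apply/funext => q; apply/eqP; apply: contraT => h0; case: hn; exists q.
have [h1 h2 h3] := inL_supp h hq; exists q; split=> //; exists (v q) => //.
by apply: (@inL_eval k) => //; rewrite h3 opprK.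
Qed.

Lemma bub_ev E (M' : nbmod t E) p r k v : inw M' k v ->
  ev (op M') p (bub M' 0 r v) = bub M' 0 r (ev (op M') p v).
Proof. by elim: p k v => //= e p IH k v h; rewrite (bub_op _ _ _ (k := k)) (IH _ _ (inw_op _ _ h)). Qed.
Lemma wdeg_X r i : wdeg (nseq r (i, GX)) = 2 * r%:Z.
Proof. by elim: r => [|r IH]; [rewrite wdeg_nil|rewrite [nseq _ _]/= wdeg_cons IH /=; lia]. Qed.
Lemma bub_ev_word E (M' : nbmod t E) r v :
  bub M' 0 r v = ev (op M') ((0, GCup) :: nseq r (0, GX) ++ [:: (0, GCap)])%N v.
Proof. by rewrite /= ev_cat -Xp_is_ev. Qed.
(** Leftmost bubbles commute with every word. In a closed word of degree 0 containing one, the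
    remaining letters have negative degree and may act first, which kills the lowest vector. *)
Lemma bub_lam r : bub C 0 r.+1 l = 0.
Proof.
apply/funext => q; rewrite bub_ev_word ev_co -[RHS]/(0 : K); set b := _ :: _.
case hq: (closed0 n (b ++ q)); last by rewrite lam0 // hq.
apply: (fmorph_inj (md_iota mo)); rewrite iota_lam // ev_cat -bub_ev_word rmorph0.
have [_ inu _ _] := md_low mo; rewrite (bub_ev _ _ inu).
have hb : wdeg b = 2 * r.+1%:Z.
  by rewrite /b wdeg_cons wdeg_cat wdeg_X [wdeg [:: _]]wdeg_cons wdeg_nil /= !addr0 add0r.
move: hq => /and3P[]; rewrite valid_cat wend_cat wdeg_cat hb => /andP[_ h1] /eqP h2 /eqP h3.
have hw : wend n b = n.
  have h : wend n.+2 (nseq r.+1 (0%N, GX)) = n.+2.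
    by elim: r.+1 => //= r' IH; rewrite subn1 addn1 /= IH.
  rewrite -[b]/([:: (0%N, GCup)] ++ (nseq r.+1 (0%N, GX) ++ [:: (0%N, GCap)])) !wend_cat.
  have -> : wend n [:: (0%N, GCup)] = n.+2 by rewrite /= subn0 addn2.
  by rewrite h /= subn2 addn0.
rewrite hw in h2; rewrite lam_neg //; last by lia.
by rewrite [bub _ _ _ _]raddf0.
Qed.
End LModule.

(** * Totals of graded dimensions over all degrees *)

Definition totge (f : int -> nat) (w : nat) := exists2 ds : seq int, uniq ds & (w <= \sum_(d <- ds) f d)%N.
Lemma totge_shift f e w : totge f w -> totge (fun d => f (d - e)) w.
Proof.
case=> ds h1 h2; exists [seq d + e | d <- ds]; first by rewrite map_inj_uniq //; apply: addIr.
by rewrite big_map; under eq_bigr => d _ do rewrite addrK.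
Qed.
Lemma sum_sub (ds ds' : seq int) (f : int -> nat) : uniq ds -> {subset ds <= ds'} ->
  (\sum_(d <- ds) f d <= \sum_(d <- ds') f d)%N.
Proof.
elim: ds ds' => [|d ds IH] ds' /=; first by rewrite big_nil.
move=> /andP[h1 h2] hs; have hd : d \in ds' by apply: hs; rewrite mem_head.
rewrite big_cons (big_rem d hd) /= leq_add2l; apply: IH => // e he.
have hne : e != d by apply: contraNneq h1 => <-.
have := hs e; rewrite inE he orbT => /(_ isT).
by rewrite (perm_mem (perm_to_rem hd)) inE (negPf hne).
Qed.
Lemma totgeD f g w w' : totge f w -> totge g w' -> totge (fun d => f d + g d)%N (w + w').
Proof.
case=> ds h1 h2 [ds' h3 h4]; exists (undup (ds ++ ds')); first exact: undup_uniq.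
rewrite big_split; apply: leq_add.
  by apply: leq_trans h2 (sum_sub _ h1 _) => d hd; rewrite mem_undup mem_cat hd.
by apply: leq_trans h4 (sum_sub _ h3 _) => d hd; rewrite mem_undup mem_cat hd orbT.
Qed.
Lemma totge0 f : totge f 0. Proof. by exists [::]. Qed.
Lemma totge_sum f w J (e : nat -> int) : totge f w ->
  totge (fun d => (\sum_(j < J) f (d - e j)%R)%N) (J * w).
Proof.
move=> h; elim: J => [|J IH]; first exact: totge0.
have [ds h1 h2] := totgeD IH (totge_shift (e J) h); exists ds => //.
by rewrite mulSn addnC; under eq_bigr => d _ do rewrite big_ord_recr.
Qed.
Lemma totge1 (d0 : int) : totge (fun d => (d == d0) : nat) 1.
Proof. by exists [:: d0] => //; rewrite big_seq1 eqxx. Qed.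
Lemma totgeW f g w : (forall d, (f d <= g d)%N) -> totge f w -> totge g w.
Proof. by move=> h [ds h1 h2]; exists ds => //; apply: leq_trans h2 _; apply: leq_sum. Qed.

Section Total.
Variables (K : fieldType) (t n : nat) (G : nat -> nat) (mo : model K t n G).
Definition offdeg (d : int) (v : word -> K) := forall q, wdeg q = - d -> v q = 0.
Lemma offdeg_ss d : subsp (offdeg d).
Proof.
split=> [q //|v v' h h' q hq|c v h q hq]; last by rewrite /sc h ?mulr0.
by rewrite -[LHS]/(v q - v' q) h ?h' ?subrr.
Qed.
Lemma inL_off k d e v : inL mo k e v -> d != e -> offdeg d v.
Proof.
move=> h hde q hq; apply/eqP; apply: contraT => /(inL_supp h)[_ _]; rewrite hq => /eqP.
by rewrite eqr_opp (negPf hde).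
Qed.
(** Vectors of different degrees are supported on words of different degrees, so the families found
    degree by degree are jointly independent and [upper_bound] applies to their union. *)
Lemma indfam_total k (f : int -> nat) w : (forall d, indfam (inL mo k d) (fun v => v = 0) (f d)) ->
  totge f w -> (w <= G k)%N.
Proof.
move=> hf [ds hu hw]; apply: leq_trans hw _.
pose P ds v := exists2 d, d \in (ds : seq int) & inL mo k d v.
have h : indfam (P ds) (fun v => v = 0) (\sum_(d <- ds) f d)%N.
  elim: ds hu => [|d ds IH] /= hu; first by rewrite big_nil; apply: indfam0.
  have /andP[h1 h2] := hu; rewrite big_cons; apply: (@indfamD _ _ _ (offdeg d)).
  - exact: offdeg_ss.
  - by move=> v -> .
  - have [v [v1 v2]] := hf d; exists v; split=> [i|c hc]; first by exists d; rewrite ?mem_head.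
    apply: v2; apply/funext => q; case: (eqVneq (wdeg q) (- d)) => [/hc //|hq].
    have hin : inL mo k d (\sum_i sc (c i) (v i)).
      by apply: ss_sum => [|i _]; [exact: inL_ss|apply: ss_sc => //; exact: inL_ss].
    by apply/eqP; apply: contraT => /(inL_supp hin)[_ _ /eqP]; rewrite (negPf hq).
  - apply: indfamW (IH h2) => // v [e he hv]; split; first by exists e; rewrite // inE he orbT.
    by apply: inL_off hv _; apply: contraNneq h1 => ->.
have [v h1 h2] := (indfam_indep _ _).1 h.
have hex i : exists d, inL mo k d (v i) by case: (h1 i) => d _; exists d.
by have [d hd] := boolp.choice hex; apply: upper_bound hd h2.
Qed.
End Total.

(** * Submodules generated by one vector *)

Section Gen.
Variables (K : fieldType) (t : nat) (W : Type) (M : nbmod t (W -> K)) (Mlin : klin M).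
Hypothesis Msc : forall k c v, inw M k v -> inw M k (sc c v).
Variables (a : nat) (w : W -> K).
Definition cyc k v := exists2 s : seq (K * word),
  all (fun x => valid a x.2 && (wend a x.2 == k)) s & v = evs M s w.
Lemma cyc_ss k : subsp (cyc k).
Proof.
split=> [|v v' [s hs ->] [s' hs' ->]|c v [s hs ->]].
- by exists [::] => //; rewrite /evs big_nil.
- exists (s ++ scs (-1) s'); first by rewrite all_cat hs all_map.
  by rewrite evs_cat evs_scs scN1.
- by exists (scs c s); [rewrite all_map|rewrite evs_scs].
Qed.
Hypothesis hw : inw M a w.
Lemma cyc_inw k v : cyc k v -> inw M k v.
Proof.
move=> [s /allP hs ->]; rewrite /evs big_seq.
elim/big_rec: _ => [|x v' /hs /andP[_ /eqP <-] hv]; first exact: inw0.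
by apply: inwD => //; apply: Msc; apply: inw_ev.
Qed.
Lemma cyc_ev q k v : cyc k v -> cyc (wend k q) (ev (op M) q v).
Proof.
move=> h; have hv := cyc_inw h; case: h => s hs e; case hq: (valid k q); last first.
  by rewrite (ev_invalid hv) ?hq //; apply: (ss_0 (cyc_ss _)).
exists (rws s q); last by rewrite evs_rws // e.
apply/allP => _ /mapP[x /(allP hs) /andP[h1 /eqP h2] ->] /=.
by rewrite valid_cat wend_cat h1 h2 hq eqxx.
Qed.
Lemma cyc_sub : submodule M cyc.
Proof.
split=> [k v /cyc_inw[] //|k|k v v'|g i k v h].
- exact: (ss_0 (cyc_ss _)).
- exact: (ss_B (cyc_ss _)).
- exact: (@cyc_ev [:: (i, g)]).
Qed.
Lemma cyc_self : cyc a w.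
Proof. by exists [:: (1, [::])]; rewrite /= ?eqxx // /evs big_seq1 sc1. Qed.
End Gen.

(** * The filtration by the leftmost dot *)

Section ShiftedL.
Variables (K : fieldType) (t n : nat) (G : nat -> nat) (mo : model K t n G).
Local Notation C := (cofun t K).
Local Notation l := (lam mo).
Local Notation spanL := (spanL mo).
Local Notation inL := (inL mo).
(** The restriction of [L(n)] along the addition of a strand on the left. The dot on the forgotten
    strand commutes with this action, which is what makes its powers filter [R]. *)
Definition R := shiftmod (LV mo).
Lemma inw_R k v : inw R k v <-> spanL k.+1 v.
Proof. by split=> [/inw_shiftmod/inw_LV|h] //; apply/inw_shiftmod/inw_LV. Qed.
Lemma R_lin : klin R. Proof. by []. Qed.
Lemma R_sc k c v : inw R k v -> inw R k (sc c v).
Proof. by move/inw_R => h; apply/inw_R; apply: ss_sc => //; apply: spanL_ss. Qed.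
Lemma spanL_inw k v : spanL k v -> inw C k v.
Proof. by move/(sub_wt (spanL_sub mo)). Qed.
Lemma evRE p v : ev (op R) p v = ev (op C) (shiftw 1 p) v.
Proof. exact: (ev_shift (LV mo)). Qed.

Lemma op_Xp0 g i j k v : inw C k v -> op C g i.+1 (Xp C 0 j v) = Xp C 0 j (op C g i.+1 v).
Proof.
move=> h; elim: j => // j IH; rewrite !XpE -IH.
have hh : inw C k (Xp C 0 j v) by apply: inwXp.
by rewrite (@far _ _ C GX g 0 i.+1 i.+1 k _ hh) //= addn1.
Qed.
Lemma evR_Xp0 p j k v : inw C k.+1 v -> (forall q, inw C (wend k q).+1 (ev (op R) q v)) ->
  ev (op R) p (Xp C 0 j v) = Xp C 0 j (ev (op R) p v).
Proof.
move=> _ hq; elim/last_ind: p => // p e IH.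
by rewrite -cats1 !ev_cat IH; exact: (op_Xp0 e.2 e.1 j (hq p)).
Qed.
Lemma spanL_evR k v q : spanL k.+1 v -> spanL (wend k q).+1 (ev (op R) q v).
Proof. by move/inw_R => h; apply/inw_R; apply: inw_ev. Qed.
Lemma evR_Xp p j k v : spanL k.+1 v -> ev (op R) p (Xp C 0 j v) = Xp C 0 j (ev (op R) p v).
Proof.
move=> h; apply: (@evR_Xp0 _ _ k); first exact: spanL_inw.
by move=> q; apply: spanL_inw; apply: spanL_evR.
Qed.
Lemma Xp_sc i j c v : Xp C i j (sc c v) = sc c (Xp C i j v).
Proof. by rewrite !Xp_is_ev ev_sc. Qed.
Lemma evsR_Xp s j k v : spanL k.+1 v -> evs R s (Xp C 0 j v) = Xp C 0 j (evs R s v).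
Proof.
move=> h; rewrite /evs Xp_sum; apply: eq_bigr => x _.
by rewrite (evR_Xp _ _ h) Xp_sc.
Qed.
Lemma wend_X k i j : (i < k)%N -> wend k (nseq j (i, GX)) = k.
Proof. by move=> h; elim: j => //= j IH; rewrite subn1 addn1 prednK ?IH //; lia. Qed.
Lemma spanL_Xp k j v : spanL k.+1 v -> spanL k.+1 (Xp C 0 j v).
Proof. by move=> h; have := spanL_evC (nseq j (0%N, GX)) h; rewrite wend_X // -Xp_is_ev. Qed.
Lemma inL_Xp k j d v : inL k.+1 d v -> inL k.+1 (d + 2 * j%:Z) (Xp C 0 j v).
Proof. by move=> h; have := inL_ev (nseq j (0%N, GX)) h; rewrite wend_X // -Xp_is_ev wdeg_X. Qed.

Lemma inL_evR k d v q : inL k.+1 d v -> inL (wend k q).+1 (d + wdeg q) (ev (op R) q v).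
Proof.
move=> h; case hq: (valid k q).
  have := inL_ev (shiftw 1 q) h; rewrite -evRE wdeg_shift -add1n.
  by rewrite wend_shift // add1n.
have hw : inw R k v by apply/inw_R; apply: inL_span h.
by rewrite (ev_invalid hw) ?hq //; apply: (ss_0 (inL_ss _ _ _)).
Qed.
Lemma pres_R m k e d v s : inL m.+1 d v -> pres m k e s -> inL k.+1 (d + e) (evs R s v).
Proof.
move=> h /allP hs; apply: ss_sum => [|x /hs /and3P[_ /eqP <- /eqP <-]]; first exact: inL_ss.
by apply: ss_sc; [exact: inL_ss|exact: inL_evR].
Qed.
Lemma pres_cyc m k e v s : pres m k e s -> cyc R m v k (evs R s v).
Proof. by move=> /allP hs; exists s => //; apply/allP => x /hs /and3P[-> ->]. Qed.

(* [u_j = X_0^j lambda], [C_j = X_0^j V + S] *)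
Section Cj.
Variables (S : nat -> (word -> K) -> Prop).
Hypothesis (SR : submodule R S) (Ssc : forall k, subsp (S k)).
Definition Cj j k v := exists v0 s, [/\ spanL k.+1 v0, S k s & v = Xp C 0 j v0 + s].
Lemma Cj_ss j k : subsp (Cj j k).
Proof.
split=> [|v v' [v0 [s [h1 h2 ->]]] [v0' [s' [h1' h2' ->]]]|c v [v0 [s [h1 h2 ->]]]].
- exists 0, 0; split; rewrite ?raddf0 ?addr0 //; [exact: (ss_0 (spanL_ss _ _))|exact: (ss_0 (Ssc _))].
- exists (v0 - v0'), (s - s'); split; [exact: (ss_B (spanL_ss _ _))|exact: (ss_B (Ssc _))|].
  by rewrite XpB opprD addrACA.
- exists (sc c v0), (sc c s); split; [exact: (ss_sc (spanL_ss _ _))|exact: (ss_sc (Ssc _))|].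
  by rewrite scD Xp_sc.
Qed.
Lemma Cj_sub j : submodule R (Cj j).
Proof.
split=> [k v [v0 [s [h1 h2 ->]]]|k|k v v'|g i k v [v0 [s [h1 h2 ->]]]].
- apply: inwP; apply: inwD; last exact: (sub_inw SR h2).
  by apply/inw_R; apply: spanL_Xp.
- exact: (ss_0 (Cj_ss _ _)).
- exact: (ss_B (Cj_ss _ _)).
- exists (op R g i v0), (op R g i s); split; last first.
    by rewrite opD; congr (_ + _); exact: (@evR_Xp [:: (i, g)] j k _ h1).
    exact: (sub_op SR).
  exact: (@spanL_evR k v0 [:: (i, g)] h1).
Qed.
Lemma Cj_S j k v : S k v -> Cj j k v.
Proof.
move=> h; exists 0, v; split=> //; first exact: (ss_0 (spanL_ss _ _)).
by rewrite raddf0 add0r.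
Qed.
Lemma Cj_dec j k v : Cj j.+1 k v -> Cj j k v.
Proof.
move=> [v0 [s [h1 h2 ->]]]; exists (op C GX 0 v0), s; split=> //; last by rewrite -XpS.
by have := spanL_Xp 1 h1.
Qed.
End Cj.
End ShiftedL.

Section Chain.
Variables (K : fieldType) (t m : nat) (G G' : nat -> nat) (mo : model K t m.+1 G) (mo' : model K t m G').
Local Notation C := (cofun t K).
Local Notation l := (lam mo).
Local Notation spanL := (spanL mo).
Local Notation inL' := (inL mo').
Local Notation inL := (inL mo).
Local Notation R := (R mo).
Definition uj j := Xp C 0 j l.
Lemma uj_in j : inL m.+1 (2 * j%:Z) (uj j).
Proof. by have := inL_Xp j (inL_lam mo); rewrite add0r. Qed.
Lemma uj_inw j : inw R m (uj j).
Proof. by apply/inw_R; apply: inL_span (uj_in j). Qed.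
(** By degree only the component of [v] of degree [-2] could contribute, and [L(m + 1)] has no
    negative degrees in weight [m + 1]. *)
Lemma uj_notin j v : uj j <> 0 -> spanL m.+1 v -> uj j <> Xp C 0 j.+1 v.
Proof.
move=> h0 [s /allP hs ->] e; apply: h0; apply/funext => q; rewrite -[RHS]/(0 : K).
apply/eqP; apply: contraT => hq; have [_ _ hd] := inL_supp (uj_in j) hq.
move: hq; rewrite e Xp_is_ev ev_co /Lvec big_seq big1 ?eqxx // => x /hs /andP[h1 /eqP h2].
case hc: (closed0 m.+1 (x.2 ++ nseq j.+1 (0%N, GX) ++ q)); last by rewrite lam0 ?mulr0 // hc.
have hx : wdeg x.2 < 0.
  by move: hc => /and3P[_ _]; rewrite !wdeg_cat wdeg_X hd => /eqP; lia.
by have /(congr1 (fun f => f (nseq j.+1 (0%N, GX) ++ q))) := lam_negC mo h2 hx; rewrite ev_co => ->; rewrite [X in _ * X]/(0:K) mulr0.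
Qed.
Variables (S : nat -> (word -> K) -> Prop).
Hypothesis (SR : submodule R S) (Ssc : forall k, subsp (S k)) (S0 : forall v, S m v -> v = 0).
Lemma uj_low j : lowest R m (uj j) (Cj mo S j.+1).
Proof.
split=> [||i|k v hk /inw_R h]; first exact: Cj_sub.
- exact: uj_inw.
- have -> : op R GT i (uj j) = Xp C 0 j (op C GT i.+1 l).
    exact: (@evR_Xp _ _ _ _ mo [:: (i, GT)] j m _ (spanL_lam mo)).
  by rewrite lamT raddf0; apply: ss_0; apply: Cj_ss.
- by rewrite (spanL_low h) //; apply: ss_0; apply: Cj_ss.
Qed.
Lemma uj_Cj j : uj j <> 0 -> ~ Cj mo S j.+1 m (uj j).
Proof.
move=> h0 [v0 [s [h1 /S0 -> ]]]; rewrite addr0; exact: uj_notin.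
Qed.
(** The vector [uj j] is lowest of weight [m] and degree [2j] in [C_j] modulo [C_{j+1}]. Membership
    in the submodule that it generates is kept for [extra_in_ker]. *)
Lemma chain_step j k d r : uj j <> 0 -> indfam (inL'  k (d - 2 * j%:Z)) (fun v => v = 0) r ->
  indfam (fun v => [/\ inL k.+1 d v, Cj mo S j k v & cyc R m (uj j) k v]) (Cj mo S j.+1 k) r.
Proof.
move=> h0 hb; apply: (lowest_indfam _ (uj_low j) _ (uj_Cj h0) hb) => //; first by move=> k'; apply: Cj_ss.
move=> s hs; split; last exact: pres_cyc hs.
  by have := pres_R (uj_in j) hs; rewrite addrC subrK.
exists (evs R s l), 0; split; last by rewrite addr0 (evsR_Xp _ _ (spanL_lam mo)).
  by apply: inL_span; apply: pres_R (inL_lam mo) hs.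
exact: (ss_0 (Ssc _)).
Qed.
Lemma chain J k d (r : nat -> nat) : (forall j, (j < J)%N -> uj j <> 0) ->
  (forall j, (j < J)%N -> indfam (inL'  k (d - 2 * j%:Z)) (fun v => v = 0) (r j)) ->
  indfam (fun v => inL k.+1 d v /\ exists j, cyc R m (uj j) k v) (Cj mo S J k) (\sum_(j < J) r j).
Proof.
elim: J => [|J IH] h0 hb; first by rewrite big_ord0; apply: indfam0.
rewrite big_ord_recr /=; apply: (@indfamD _ _ _ (Cj mo S J k)).
- exact: Cj_ss.
- by move=> v; apply: Cj_dec.
- by apply: IH => j hj; [apply: h0|apply: hb]; lia.
- apply: indfamW (chain_step (h0 J (ltnSn J)) (hb J (ltnSn J))) => // v [h1 h2 h3].
  by split=> //; split=> //; exists J.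
Qed.
End Chain.

Definition Tword i r : word := [seq (a, GT) | a <- iota i r].

Lemma Tword_rcons i r : Tword i r.+1 = Tword i r ++ [:: ((i + r)%N, GT)].
Proof. by rewrite /Tword -[r.+1]addn1 iotaD map_cat. Qed.

(** * Lowest vectors obtained by a full row of crossings *)

Section Head.
Variables (t : nat) (E : zmodType) (M : nbmod t E) (D : nat -> E -> Prop) (k : nat) (y : E).
Hypotheses (DM : submodule M D) (hy : inw M k y).
Hypotheses (hT : forall i, D k (op M GT i.+1 y)) (hX : D k (op M GX 0 y)).
Hypothesis low : forall v, inw M (k - 2) v -> D (k - 2) v.
Local Notation z j := (ev (op M) (Tword 0 j) y).
Lemma zS j : z j.+1 = op M GT j (z j).
Proof. by rewrite Tword_rcons ev_cat. Qed.
Lemma zw j : inw M k (z j).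
Proof. by elim: j => [|j IH] //; rewrite zS; apply: inwT. Qed.
Existing Instance hy.
Existing Instance zw.
Lemma zT_hi i j : (j < i)%N -> D k (op M GT i (z j)).
Proof.
elim: j => [|j IH] hi; first by case: i hi.
rewrite zS -TT_far; last by lia.
by apply: (sub_T DM); apply: IH; lia.
Qed.
Lemma zT i j : i != j -> D k (op M GT i (z j)).
Proof.
elim: j i => [|j IH] i hi; first by apply: zT_hi; lia.
have [h|[h|h]] : (j.+1 < i \/ i = j \/ i < j)%N by lia.
- exact: zT_hi.
- by rewrite zS h TT0; apply: (sub_0 DM).
- have [h1|h1] : (i.+1 = j \/ i.+1 < j)%N by lia.
    rewrite -h1 2!zS braid; apply: (sub_T DM); apply: (sub_T DM); apply: zT_hi; lia.
  rewrite zS TT_far; last by lia.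
  by apply: (sub_T DM); apply: IH; lia.
Qed.
Lemma low_UA' i v : inw M k v -> D k (op M GCup i (op M GCap i v)).
Proof.
move=> hv; case: (leqP (i + 2) k) => hi; last first.
  by rewrite (op_out (g := GCap) hi) op0; apply: (sub_0 DM).
have := sub_U DM i (low (inwA i hv)); by have -> : ((k - 2).+2 = k)%N by lia.
Qed.
Lemma zX j : (j.+1 < k)%N -> D k (op M GX j.+1 (z j.+1) + z j).
Proof.
elim: j => [|j IH] hj; rewrite zS XTs // addrAC subrK; apply: (sub_D DM); try exact: low_UA'.
  exact: (sub_T DM).
rewrite -[op M GX j.+1 _](addrK (z j)) opB; apply: (sub_B DM); last by apply: zT_hi.
by apply: (sub_T DM); apply: IH; lia.
Qed.
(** Dots undo the crossings: modulo [D], the dot on strand [j + 1] sends [z (j + 1)] to [- z j]. *)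
Lemma head_notin r : (r < k)%N -> D k (z r) -> D k y.
Proof.
elim: r => [|r IH] hr // h; apply: IH; first by lia.
have := sub_B DM (zX hr) (sub_X DM r.+1 h); by rewrite addrC addKr.
Qed.
(** [zT] excepts only the crossing at [r], and with [k = r + 1] strands that crossing is out of
    range; so [z r] is killed by all crossings modulo [D]. *)
Lemma head_T r i : k = r.+1 -> D k (op M GT i (z r)).
Proof.
move=> hk; case: (eqVneq i r) => [->|]; last exact: zT.
by rewrite (op_out (g := GT) (k := k)); [exact: (sub_0 DM)|rewrite /=; lia].
Qed.
End Head.

(** * Powers of the leftmost dot on lambda *)

Section UpperNil.
Variables (K : fieldType) (t m : nat) (G G' : nat -> nat) (mo : model K t m.+1 G) (mo' : model K t m G').
Local Notation C := (cofun t K).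
Local Notation l := (lam mo).
Local Notation spanL := (spanL mo).
Local Notation inL' := (inL mo').
Local Notation inL := (inL mo).
Local Notation R := (R mo).
Local Notation uj := (uj mo).

Lemma Tword_Xp i r b k v : inw C k v ->
  ev (op C) (Tword i.+1 r) (Xp C i b v) = Xp C i b (ev (op C) (Tword i.+1 r) v).
Proof.
move=> h; elim: r => // r IH; rewrite Tword_rcons !ev_cat IH.
have hk : inw C (wend k (Tword i.+1 r)) (ev (op C) (Tword i.+1 r) v) by apply: inw_ev.
by apply: esym; apply: (@XpT_far _ _ C i (i.+1 + r) b _ _ hk); lia.
Qed.
Lemma wend_Tword k i r : (i + r < k)%N -> wend k (Tword i r) = k.
Proof.
elim: r => // r IH h; rewrite Tword_rcons wend_cat IH /=; lia.
Qed.
Lemma wdeg_Tword i r : wdeg (Tword i r) = - (2 * r%:Z).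
Proof.
elim: r => [|r IH]; first by rewrite wdeg_nil.
by rewrite Tword_rcons wdeg_cat IH wdeg_cons wdeg_nil /=; lia.
Qed.
Lemma l_inw : inw C m.+1 l. Proof. by apply: spanL_inw; exact: spanL_lam. Qed.
Existing Instance l_inw.
Lemma UA_lam i j k b v : spanL m.+1 v -> Xp C i b (op C GCup j (op C GCap k v)) = 0.
Proof.
move=> h; have h2 := spanL_evC [:: (k, GCap)] h.
have -> : op C GCap k v = 0 by apply: (spanL_low h2); rewrite /=; lia.
by rewrite op0 raddf0.
Qed.
(** Each crossing acts as a divided difference. Only the term that puts all remaining dots on the
    next strand survives: the others contain a word of negative degree on [lam], or pass through a
    weight below [n]. *)
Lemma Tword_lam i r : (i + r < m.+1)%N -> ev (op C) (Tword i r) (Xp C i r l) = l.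
Proof.
elim: r i => // r IH i h; rewrite -[Tword i r.+1]/((i, GT) :: Tword i.+1 r) -[LHS]/(ev (op C) (Tword i.+1 r) (op C GT i (Xp C i r.+1 l))).
rewrite TXp; last by lia.
rewrite lamT raddf0 add0r ev_sum big_ord_recl /= big1 ?addr0.
  rewrite subn1 /= Xp0 UA_lam ?subr0; last exact: spanL_lam.
  by apply: IH; lia.
move=> b _; rewrite UA_lam; last first.
  by have := spanL_evC (nseq (bump 0 b) (i, GX)) (spanL_lam mo); rewrite wend_X -?Xp_is_ev //; lia.
rewrite subr0 XpXp Tword_Xp (_ : ev _ _ _ = 0) ?raddf0 //.
rewrite Xp_is_ev -ev_cat lam_negC //.
  by rewrite wend_cat wend_X ?wend_Tword //; lia.
by rewrite wdeg_cat wdeg_X wdeg_Tword /bump /=; have := ltn_ord b; lia.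
Qed.
Lemma uj_neq0 j : (j <= m)%N -> uj j <> 0.
Proof.
move=> hj h; have := @Tword_lam 0 m (leqnn _).
rewrite -[Xp C 0 m l](_ : Xp C 0 (m - j) (uj j) = _); last by rewrite /uj XpD subnK.
by rewrite h raddf0 ev0 => /esym; apply: lam_neq0.
Qed.

Variable f : int -> nat.
Hypothesis hf : forall d, indfam (inL' m d) (fun v => v = 0) (f d).
Hypothesis hft : totge f m`!.
Hypothesis hG : (G m.+1 <= (m.+1)`!)%N.
(** Otherwise the restriction would contain [m + 2] copies of [L(m)], each of total dimension at
    least [m!] in weight [m], exceeding [(m+1)!]. *)
Lemma Xn_lam : uj m.+1 = 0.
Proof.
apply: contrapT => h.
have hJ j : (j < m.+2)%N -> uj j <> 0.
  by rewrite ltnS leq_eqVlt => /orP[/eqP ->|/uj_neq0].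
have hb d : indfam (inL m.+1 d) (fun v => v = 0) (\sum_(j < m.+2) f (d - 2 * j%:Z)%R)%N.
  have := @chain _ _ _ _ _ mo mo' (fun _ v => v = 0) (zero_submod _) (fun _ => subsp0 _ _) (fun v => id) m.+2 m d (fun j => f (d - 2 * j%:Z)) hJ (fun j _ => hf _).
  apply: indfamW => [v []//|v ->]; apply: ss_0; apply: Cj_ss; exact: (fun _ => subsp0 _ _).
have := indfam_total hb (totge_sum m.+2 (fun j => 2 * j%:Z) hft).
rewrite leqNgt => /negP; apply; apply: leq_ltn_trans hG _.
by rewrite factS ltn_mul2r fact_gt0 ltnSn.
Qed.
End UpperNil.

(** * Homogeneous components *)

Section Proj.
Variables (K : fieldType) (t n : nat) (G : nat -> nat) (mo : model K t n G).
Local Notation C := (cofun t K).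
Local Notation l := (lam mo).
Definition proj (d : int) (v : word -> K) : word -> K := fun q => if wdeg q == - d then v q else 0.
Lemma projD d v v' : proj d (v + v') = proj d v + proj d v'.
Proof.
apply/funext => q; rewrite -[RHS]/(proj d v q + proj d v' q) /proj.
by case: eqP => // _; rewrite addr0.
Qed.
Lemma proj0 d : proj d 0 = 0.
Proof. by apply/funext => q; rewrite /proj if_same. Qed.
Lemma proj_sc d c v : proj d (sc c v) = sc c (proj d v).
Proof. by apply/funext => q; rewrite /proj /sc; case: eqP; rewrite ?mulr0. Qed.
Lemma proj_ev d p v : proj d (ev (op C) p v) = ev (op C) p (proj (d - wdeg p) v).
Proof.
apply/funext => q; rewrite /proj !ev_co wdeg_cat; congr (if _ then _ else _).
by apply/eqP/eqP; lia.
Qed.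
Lemma proj_inL k d e v : inL mo k d v -> proj e v = if e == d then v else 0.
Proof.
move=> h; apply/funext => q; rewrite /proj; case: (eqVneq e d) => [->|hed]; case: eqP => hq //.
  by apply/esym/eqP; apply: contraT => /(inL_supp h)[_ _].
rewrite -[RHS]/(0 : K); apply/eqP; apply: contraT => /(inL_supp h)[_ _]; rewrite hq => /eqP.
by rewrite eqr_opp (negPf hed).
Qed.
Lemma Lvec_filter d s : all (fun x => valid n x.2) s ->
  proj d (Lvec mo s) = Lvec mo [seq x <- s | wdeg x.2 == d].
Proof.
move=> /allP hs; apply/funext => q; rewrite /proj /Lvec big_filter.
case: eqP => hq.
  rewrite [LHS](bigID (fun x => wdeg x.2 == d)) /= [X in _ + X]big1 ?addr0 // => x hx.
  rewrite lam0 ?mulr0 //; apply: contraNN hx => /and3P[_ _]; rewrite wdeg_cat hq => /eqP h.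
  by apply/eqP; lia.
rewrite big1 // => x /eqP hx; rewrite lam0 ?mulr0 //; apply/negP => /and3P[_ _].
by rewrite wdeg_cat hx => /eqP h; apply: hq; lia.
Qed.
Lemma pres_filter k d (s : seq (K * word)) : all (fun x => valid n x.2 && (wend n x.2 == k)) s ->
  pres n k d [seq x <- s | wdeg x.2 == d].
Proof.
move=> /allP hs; apply/allP => x; rewrite mem_filter => /andP[h1 /hs /andP[h2 h3]].
by rewrite h1 h2 h3.
Qed.
Lemma proj_spanL k d v : spanL mo k v -> inL mo k d (proj d v).
Proof.
move=> [s hs ->]; rewrite Lvec_filter; last by apply/allP => x /(allP hs) /andP[].
by exists [seq x <- s | wdeg x.2 == d] => //; apply: pres_filter.
Qed.
Lemma proj_neq0 v : v <> 0 -> exists d, proj d v <> 0.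
Proof.
move=> h; apply: contrapT => hn; apply: h; apply/funext => q; apply: contrapT => hq.
apply: hn; exists (- wdeg q) => /(congr1 (fun f => f q)); rewrite /proj opprK eqxx.
exact: hq.
Qed.
Lemma bub_spanL r k v : spanL mo k v -> bub C 0 r.+1 v = 0.
Proof.
move=> [s /allP hs ->]; rewrite -evs_lam bub_ev_word ev_evs // big_seq big1 // => x hx.
have hl : inw C n l by apply: spanL_inw; apply: spanL_lam.
by rewrite ev_cat -bub_ev_word -(bub_ev _ _ hl) bub_lam ev0 scv0.
Qed.
Lemma lam_lowest0 : lowest (LV mo) n l (fun _ v => v = 0).
Proof.
split=> [||i|k v hk /inw_LV h].
- exact: zero_submod.
- by apply/inw_LV; apply: spanL_lam.
- exact: lamT.
- exact: (spanL_low h).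
Qed.
End Proj.

Section WeightN.
Variables (K : fieldType) (t m : nat) (G : nat -> nat) (mo : model K t m.+1 G).
Local Notation C := (cofun t K).
Local Notation l := (lam mo).
Local Notation R := (R mo).
Definition splitn v := exists r v2, [/\ cyc R m l m r, spanL mo m.+1 v2 & v = r + op C GX 0 v2].
Lemma l_inwR : inw R m l. Proof. by apply/inw_R; exact: spanL_lam. Qed.
Lemma cycR_sub : submodule R (cyc R m l).
Proof. by apply: cyc_sub => //; [exact: R_sc|exact: l_inwR]. Qed.
Lemma cycR_spanL k r : cyc R m l k r -> spanL mo k.+1 r.
Proof. by move=> h; apply/inw_R; apply: (sub_inw cycR_sub h). Qed.
Lemma splitn_ss : subsp splitn.
Proof.
split=> [|v v' [r [w [h1 h2 ->]]] [r' [w' [h1' h2' ->]]]|c v [r [w [h1 h2 ->]]]].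
- exists 0, 0; split; [exact: (ss_0 (cyc_ss _ _ _ _))|exact: (ss_0 (spanL_ss _ _))|by rewrite op0 addr0].
- exists (r - r'), (w - w'); split; [exact: (ss_B (cyc_ss _ _ _ _))|exact: (ss_B (spanL_ss _ _))|].
  by rewrite opB opprD addrACA.
- exists (sc c r), (sc c w); split; [exact: (ss_sc (cyc_ss _ _ _ _))|exact: (ss_sc (spanL_ss _ _))|].
  by rewrite scD.
Qed.
(** Straightening expresses a vector of this weight by dots and bubbles on [lam]. Bubbles vanish on
    [L(n)], dots off the leftmost strand preserve the submodule generated by [lam], and the leftmost
    dot gives the second term. *)
Lemma spanL_split v : spanL mo m.+1 v -> splitn v.
Proof.
move=> [s /allP hs ->]; rewrite -evs_lam; apply: ss_sum => [|x hx]; first exact: splitn_ss.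
apply: ss_sc; first exact: splitn_ss.
have /andP[_ /eqP h1] := hs x hx.
have [sub inu uT low] := lam_lowest0 mo.
have := @polys_ev _ _ (LV mo) m.+1 l _ sub inu uT low x.2 h1.
elim=> {x hx h1 s hs v}.
- exists l, 0; split; [|exact: (ss_0 (spanL_ss _ _))|by rewrite op0 addr0].
  exact: cyc_self.
- by move=> d v ->; apply: ss_0; apply: splitn_ss.
- by move=> d v w _ h _ h'; apply: (ss_B splitn_ss).
- move=> d [|i] v hv [r [w [h1 h2 e]]].
    exists 0, v; split; [exact: (ss_0 (cyc_ss _ _ _ _))| |by rewrite add0r].
    by rewrite e; apply: (ss_D (spanL_ss _ _)); [exact: cycR_spanL|apply: (spanL_Xp 1)].
  exists (op C GX i.+1 r), (op C GX i.+1 w); split.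
  + exact: (sub_X cycR_sub i h1).
  + by have /inw_R := inwX i (proj2 (inw_R mo m w) h2).
  + rewrite e -[LHS]/(op C GX i.+1 (r + op C GX 0 w)) opD; congr (_ + _).
    have hw : inw C m.+1 w by apply: spanL_inw h2.
    by rewrite XX.
- move=> d r v hv h; rewrite (_ : bub _ _ _ _ = 0); first by apply: ss_0; apply: splitn_ss.
  apply: (@bub_spanL _ _ _ _ mo r m.+1); case: h => r' [w [h1 h2 ->]].
  by apply: (ss_D (spanL_ss _ _)); [exact: cycR_spanL|apply: (spanL_Xp 1)].
Qed.
End WeightN.

(** * Consequences of a saturated upper bound *)

Section Extra.
Variables (K : fieldType) (t m : nat) (G G' : nat -> nat) (mo : model K t m.+1 G) (mo1 : model K t m G').
Local Notation inL1 := (inL mo1).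
Local Notation inL := (inL mo).
Local Notation R := (R mo).
Variables (k : nat) (f : int -> nat) (w : nat).
Hypothesis hf : forall d, indfam (inL1 k d) (fun v => v = 0) (f d).
Hypothesis hft : totge f w.
Hypothesis hG : (G k.+1 <= m.+1 * w)%N.

(** The [m + 1] copies of [L(m)] already reach the upper bound in total, so no degree has room for
    one more dimension. *)
Lemma no_extra d0 : ~ (forall d, indfam (inL k.+1 d) (fun v => v = 0)
  ((\sum_(j < m.+1) f (d - 2 * j%:Z)%R) + (d == d0))%N).
Proof.
move=> hb; have := indfam_total hb (totgeD (totge_sum m.+1 (fun j => 2 * j%:Z) hft) (totge1 d0)).
by rewrite addn1 ltnNge hG.
Qed.
Lemma chain_f S (SR : submodule R S) (Ssc : forall k, subsp (S k)) (S0 : forall v, S m v -> v = 0) d :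
  indfam (fun v => inL k.+1 d v /\ exists j, cyc R m (uj mo j) k v) (S k)
     (\sum_(j < m.+1) f (d - 2 * j%:Z)%R)%N.
Proof.
have h0 j : (j < m.+1)%N -> uj mo j <> 0 by rewrite ltnS => hj; apply: uj_neq0.
have hb := @chain _ _ _ _ _ mo mo1 S SR Ssc S0 m.+1 k d (fun j => f (d - 2 * j%:Z)) h0 (fun j _ => hf _).
by apply: indfamW hb => // v; apply: Cj_S.
Qed.
(** Since [S] vanishes in weight [m], the copies of [L(m)] remain independent modulo [S]; a nonzero
    vector of [S] would come in addition to them. *)
Lemma extra_in_sub S (SR : submodule R S) (Ssc : forall k, subsp (S k)) (S0 : forall v, S m v -> v = 0) d0 v :
  inL k.+1 d0 v -> S k v -> v = 0.
Proof.
move=> hv hS; apply: contrapT => h; apply: (@no_extra d0) => d.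
case: eqP => [->|_]; last first.
  by rewrite addn0; apply: indfamW (chain_f (zero_submod _) (fun _ => subsp0 _ _) (fun v => id) d) => // x [].
apply: (@indfamD _ _ _ (S k)) => //; first by move=> x ->; apply: ss_0.
- by apply: indfamW (chain_f SR Ssc S0 d0) => // x [].
- by apply: (indfam1 (subsp0 _ _) _ h); split.
Qed.
(** The vectors representing the copies all lie in [Z], so a vector outside [Z] would come in
    addition to them. *)
Lemma extra_in_ker Z (hZ : subsp Z) (hc : forall j v, cyc R m (uj mo j) k v -> Z v) d0 v :
  inL k.+1 d0 v -> Z v.
Proof.
move=> hv; apply: contrapT => h; apply: (@no_extra d0) => d.
have hb := chain_f (zero_submod _) (fun _ => subsp0 _ _) (fun v => id) d.
case: eqP => [e|_]; last by rewrite addn0; apply: indfamW hb => // x [].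
rewrite addnC; apply: (@indfamD _ _ _ Z) => //; first by move=> x ->; apply: ss_0.
- by rewrite e; apply: (indfam1 hZ hv h).
- by apply: indfamW hb => // x [h1 [j h2]]; split=> //; apply: hc h2.
Qed.
End Extra.

Section Socle.
Variables (K : fieldType) (t m : nat) (G G' : nat -> nat) (mo : model K t m.+1 G) (mo1 : model K t m G').
Local Notation C := (cofun t K).
Local Notation l := (lam mo).
Local Notation inL1 := (inL mo1).
Local Notation inL := (inL mo).
Local Notation R := (R mo).
Local Notation uj := (uj mo).
(* relations of [L(m)] applied to the lowest restricted copy [X_0^m lambda] *)
Definition soc k v := exists s : seq (K * word),
  [/\ all (fun x => valid m x.2 && (wend m x.2 == k)) s, Lvec mo1 s = 0 & v = evs R s (uj m)].
Lemma soc_ss k : subsp (soc k).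
Proof.
split=> [|v v' [s [h1 h2 ->]] [s' [h1' h2' ->]]|c v [s [h1 h2 ->]]].
- by exists [::]; split=> //; [apply/funext => q; rewrite /Lvec big_nil|rewrite /evs big_nil].
- exists (s ++ scs (-1) s'); split; first by rewrite all_cat h1 all_map.
    by rewrite Lvec_cat Lvec_scs h2 h2' scv0 addr0.
  by rewrite evs_cat evs_scs scN1.
- by exists (scs c s); split; [rewrite all_map|rewrite Lvec_scs h2 scv0|rewrite evs_scs].
Qed.
Lemma soc_cyc k v : soc k v -> cyc R m (uj m) k v.
Proof. by case=> s [h1 _ ->]; exists s. Qed.
Lemma soc_sub : submodule R soc.
Proof.
have hu := uj_inw mo m.
have csub := cyc_sub (R_lin mo) (@R_sc _ _ _ _ mo) hu.
split=> [k v /soc_cyc h|k|k v v'|g i k v h].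
- exact: (sub_wt csub h).
- exact: (ss_0 (soc_ss _)).
- exact: (ss_B (soc_ss _)).
- have hv := sub_inw csub (soc_cyc h); case: (leqP (i + gsrc g) k) => hi; last first.
    by rewrite (op_out hi); apply: (ss_0 (soc_ss _)).
  case: h => s [h1 h2 e]; exists (rws s [:: (i, g)]); split.
  + apply/allP => _ /mapP[x /(allP h1) /andP[h3 /eqP h4] ->] /=.
    by rewrite valid_cat wend_cat h3 h4 /= hi eqxx.
  + by rewrite -evs_lam evs_rws // evs_lam h2 ev0.
  + by rewrite evs_rws // -e.
Qed.
Lemma soc_spanL k v : soc k v -> spanL mo k.+1 v.
Proof. by move/(sub_inw soc_sub)/inw_R. Qed.
Lemma soc_proj k d v : soc k v -> soc k (proj d v) /\ exists s, [/\ pres m k (d - 2 * m%:Z) s,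
   Lvec mo1 s = 0 & proj d v = evs R s (uj m)].
Proof.
move=> [s [h1 h2 ->]].
pose s' := [seq x <- s | wdeg x.2 == d - 2 * m%:Z].
have e1 : pres m k (d - 2 * m%:Z) s' by apply: pres_filter.
have e2 : Lvec mo1 s' = 0.
  rewrite -Lvec_filter ?h2 ?proj0 //; by apply/allP => x /(allP h1) /andP[].
have e3 : proj d (evs R s (uj m)) = evs R s' (uj m).
  rewrite /evs /s' big_filter [RHS]big_mkcond /=.
  elim: s {h1 h2 s' e1 e2} => [|x s IH]; first by rewrite !big_nil proj0.
  rewrite !big_cons projD IH; congr (_ + _); rewrite proj_sc (evRE mo) proj_ev wdeg_shift (proj_inL _ (uj_in mo m)).
  case: eqP => [e|ne]; case: eqP => // e'; try lia.
  by rewrite ev0 scv0.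
split; last by exists s'.
by rewrite e3; exists s'; split=> //; apply/allP => x /(allP e1) /and3P[-> ->].
Qed.
Lemma soc_hom k v : soc k v -> v <> 0 -> exists d s, [/\ pres m k (d - 2 * m%:Z) s, Lvec mo1 s = 0,
   evs R s (uj m) <> 0, inL k.+1 d (evs R s (uj m)) & soc k (evs R s (uj m))].
Proof.
move=> h /proj_neq0[d hd]; have [h1 [s [h2 h3 h4]]] := soc_proj d h.
exists d, s; rewrite -h4; split=> //; apply: proj_spanL; exact: soc_spanL h.
Qed.

Variable f : int -> nat.
Hypothesis hf : forall d, indfam (inL1 m d) (fun v => v = 0) (f d).
Hypothesis hft : totge f m`!.
Hypothesis hG : (G m.+1 <= (m.+1)`!)%N.
(** A nonzero [v] would make the last copy, generated by [X_0^m lam], larger than [L(m)] in weight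
    [m]; with the [m] other copies the total exceeds [(m+1)!]. *)
Lemma soc_m v : soc m v -> v = 0.
Proof.
move=> h; apply: contrapT => /(soc_hom h)[d0 [s [hs s0 hv hin _]]].
apply: (@no_extra _ _ _ _ mo m f m`! hft _ d0); first by rewrite -factS.
move=> d.
have zs := @zero_submod _ _ R; have zz := (fun k : nat => subsp0 K word); have zi := (fun v (h : v = 0 :> (word -> K)) => h).
have u0 j : (j < m)%N -> uj j <> 0 by move=> hj; apply: uj_neq0; lia.
case: eqP => [->|_]; last first.
  have := chain_f (f := f) hf zs zz zi d; rewrite addn0.
  by apply: indfamW => // x [].
rewrite big_ord_recr /= -addnA.
apply: (@indfamD _ _ _ (Cj mo (fun _ v => v = 0) m m)).
- exact: Cj_ss.
- by move=> x ->; apply: ss_0; apply: Cj_ss.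
- have hb := @chain _ _ _ _ _ mo mo1 _ zs zz zi m m d0 (fun j => f (d0 - 2 * j%:Z)) u0 (fun j _ => hf _).
  by apply: indfamW hb => // x [].
(* The line of the extra vector. Modulo this line the last copy still contains all of [L(m)],
   because the vector comes from a relation of [L(m)]. *)
pose L x := exists c, x = sc c (evs R s (uj m)).
have LC x : L x -> Cj mo (fun _ v => v = 0) m m x.
  move=> [c ->]; exists (sc c (evs R s l)), 0; rewrite addr0 Xp_sc (evsR_Xp _ _ (spanL_lam mo)); split=> //.
  apply: ss_sc; first exact: spanL_ss.
  by apply: inL_span; apply: pres_R (inL_lam mo) hs.
have Lss : subsp L.
  split=> [|x y [c ->] [c' ->]|c x [c' ->]]; first by exists 0; rewrite sc0.
    by exists (c - c'); apply/funext => q; rewrite /sc mulrBl.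
  by exists (c * c'); rewrite scM.
apply: (@indfamD _ _ _ L) => //.
- by move=> x ->; apply: ss_0.
- have hlow := uj_low zs zz m.
  apply: (evs_indfam (k := m) (d := d0 - 2 * m%:Z) (u := uj m) (M := R) (hf _)).
    move=> s' hs' [c hc].
    have : Lvec mo1 (s' ++ scs (- c) s) = 0.
      have huj : uj m <> 0 by apply: uj_neq0.
      have hD k' : subsp (Cj mo (fun _ v => v = 0) m.+1 k') by apply: Cj_ss.
      apply: (@lowest_Lvec _ _ _ _ mo1 _ R (R_lin mo) (uj m) _ hlow hD (uj_Cj zi huj) m (d0 - 2 * m%:Z)).
        by rewrite /pres all_cat; apply/andP; split; [exact: hs'|exact: pres_scs hs].
      have -> : evs R (s' ++ scs (- c) s) (uj m) = 0.
        rewrite evs_cat evs_scs hc; apply/funext => q; rewrite -[LHS]/(c * _ + - c * _) mulNr subrr //.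
      by apply: ss_0; apply: Cj_ss.
    by rewrite Lvec_cat Lvec_scs s0 scv0 addr0.
  move=> s' hs'; split; first by have := pres_R (uj_in mo m) hs'; rewrite addrC subrK.
  exists (evs R s' l), 0; rewrite addr0 (evsR_Xp _ _ (spanL_lam mo)); split=> //.
  by apply: inL_span; apply: pres_R (inL_lam mo) hs'.
- apply: (indfam1 (subsp0 _ _) _ hv).
  have hL : L (evs R s (uj m)) by exists 1; rewrite sc1.
  by split=> //; split=> //; apply: LC.
Qed.
End Socle.

(** * The copies of L(n + 1) *)

Lemma valid_Tword k i r : (i + r < k)%N -> valid k (Tword i r).
Proof.
elim: r => // r IH h; rewrite Tword_rcons valid_cat IH ?wend_Tword /= ?andbT; lia.
Qed.

Section ShiftTwo.
Variables (K : fieldType) (t : nat).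
Local Notation C := (cofun t K).
Lemma A_shift2 q k v : inw C k.+2 v ->
  op C GCap 0 (ev (op C) (shiftw 2 q) v) = ev (op C) q (op C GCap 0 v).
Proof.
elim: q k v => // [[i g] q] IH k v h.
rewrite -[ev _ (shiftw 2 _) v]/(ev (op C) (shiftw 2 q) (op C g i.+2 v)) -[RHS]/(ev (op C) q (op C g i (op C GCap 0 v))).
case: (leqP (i + gsrc g) k) => hi; last first.
  rewrite (op_out (k := k.+2) (g := g)); last by lia.
  have hA := inwA 0 h; rewrite (op_out (k := k.+2 - 2) (g := g)); last by lia.
  by rewrite !ev0 op0.
have hw : inw C (k - gsrc g + gtgt g).+2 (op C g i.+2 v).
  by have := inw_op g i.+2 h; have -> : (k.+2 - gsrc g + gtgt g = (k - gsrc g + gtgt g).+2)%N by lia.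
rewrite (IH _ _ hw); congr (ev _ _ _).
by apply: esym; apply: (@far _ _ C GCap g 0 i.+2 i k.+2 v h); rewrite /=; lia.
Qed.
Lemma U_shift2 q k v : inw C k v ->
  ev (op C) (shiftw 2 q) (op C GCup 0 v) = op C GCup 0 (ev (op C) q v).
Proof.
elim: q k v => // [[i g] q] IH k v h.
rewrite -[LHS]/(ev (op C) (shiftw 2 q) (op C g i.+2 (op C GCup 0 v))).
rewrite (@far _ _ C GCup g 0 i i.+2 k v h) /=; [|lia..].
by rewrite (IH _ _ (inw_op g i h)).
Qed.

End ShiftTwo.

Section Off.
Variables (K : fieldType) (t m : nat) (G G1 : nat -> nat) (mo : model K t m.+1 G) (mo1 : model K t m G1).
Local Notation C := (cofun t K).
Local Notation l := (lam mo).
Local Notation inL1 := (inL mo1).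
Local Notation spanL1 := (spanL mo1).
Local Notation R1 := (R mo1).
Local Notation spanL := (spanL mo).
Local Notation inL := (inL mo).
Local Notation R := (R mo).
Local Notation uj := (uj mo).
Local Notation soc := (soc mo mo1).
Variable f : int -> nat.
Hypothesis hf : forall d, indfam (inL1 m d) (fun v => v = 0) (f d).
Hypothesis hft : totge f m`!.
Hypothesis hG : (G m.+1 <= (m.+1)`!)%N.
(** Saturation of [L(m)] in weight [m + 2], in its two forms: nothing there belongs to a submodule
    starting too high, and everything there is generated from lower weights. [mods_extra_sub] and
    [mods_extra_ker] establish them for [m] congruent to [t]. *)
Hypothesis Hsub : forall S, submodule R1 S -> (forall k, subsp (S k)) ->
  (forall k v, (k <= m)%N -> S k v -> v = 0) -> forall d v, inL1 m.+2 d v -> S m.+1 v -> v = 0.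
Hypothesis Hker : forall Z, subsp Z ->
  (forall k u v, (k < m)%N -> spanL1 k.+1 u -> cyc R1 k u m.+1 v -> Z v) ->
  forall d v, inL1 m.+2 d v -> Z v.

Lemma evR_shift p v : ev (op R) (shiftw 1 p) v = ev (op C) (shiftw 2 p) v.
Proof. by rewrite (evRE mo) shiftwD. Qed.

(* Otherwise [g lambda_{n-1} |-> A_0 g X_0^{n-1} lambda_n] is well defined, and [L(n - 1)]
   has more vectors of weight [n + 1] than the upper bound allows. *)
Lemma soc_nonzero : exists k v, soc k v /\ v <> 0.
Proof.
apply: contrapT => hn.
have S0 k v : soc k v -> v = 0 by move=> h; apply: contrapT => h0; apply: hn; exists k, v.
pose Z v := exists s : seq (K * word), [/\ all (fun x => valid m x.2 && (wend m x.2 == m.+2)) s,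
   v = Lvec mo1 s & op C GCap 0 (evs R s (uj m)) = 0].
have hZ : subsp Z.
  split=> [|v v' [s [h1 -> h3]] [s' [h1' -> h3']]|c v [s [h1 -> h3]]].
  - exists [::]; split=> //; first by apply/funext => q; rewrite /Lvec big_nil.
    by rewrite /evs big_nil op0.
  - exists (s ++ scs (-1) s'); split; first by rewrite all_cat h1 all_map.
      by rewrite Lvec_cat Lvec_scs scN1.
    by rewrite evs_cat evs_scs scN1 opB h3 h3' subrr.
  - exists (scs c s); split; [by rewrite all_map|by rewrite Lvec_scs|].
    by rewrite evs_scs -[LHS]/(sc c (op C GCap 0 (evs R s (uj m)))) h3 scv0.
(* Here the cap [A 0] commutes with the word, which acts from strand 2 on, and lands in a weight
   below [m + 1], where [L(m + 1)] is 0. *)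
have hc k u v : (k < m)%N -> spanL1 k.+1 u -> cyc R1 k u m.+1 v -> Z v.
  move=> hk [su hsu ->] [s /allP hs ->]; apply: ss_sum => // x hx; apply: ss_sc => //.
  have /andP[hx1 /eqP hx2] := hs x hx.
  exists (rws su (shiftw 1 x.2)); split.
  - apply/allP => _ /mapP[y /(allP hsu) /andP[h1 /eqP h2] ->] /=.
    have v1 := valid_shift 1 hx1; have w1 := wend_shift 1 hx1; rewrite !add1n in v1 w1.
    by rewrite valid_cat wend_cat h1 h2 v1 w1 hx2 !eqxx.
  - by rewrite -!evs_lam evs_rws // (evRE mo1).
  - rewrite evs_rws // evR_shift.
    have hX : spanL k.+2 (evs R su (uj m)).
      apply/inw_R; have hu := uj_inw mo m.
      by apply: (cyc_inw (@R_sc _ _ _ _ mo) hu); exists su.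
    rewrite (A_shift2 _ (spanL_inw hX)).
    have hA := spanL_evC [:: (0%N, GCap)] hX.
    have -> : op C GCap 0 (evs R su (uj m)) = 0 by apply: (spanL_low hA); rewrite /=; lia.
    by rewrite ev0.
(* Chosen so that [A 0] straightens its cup and leaves the crossings on [X_0^m lam], which by
   [Tword_lam] give [lam], a nonzero vector. *)
pose p : word := (0%N, GCup) :: shiftw 1 (Tword 0 m).
have hs : pres m m.+2 (- (2 * m%:Z)) [:: (1 : K, p)].
  have hv : valid m.+1 (Tword 0 m) by apply: valid_Tword.
  have v1 := valid_shift 1 hv; have w1 := wend_shift 1 hv; rewrite !add1n wend_Tword // in v1 w1.
  by rewrite /pres /= subn0 addn2 v1 wdeg_cons wdeg_shift wdeg_Tword /= add0r w1 !eqxx.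
have hz : inL1 m.+2 (- (2 * m%:Z)) (Lvec mo1 [:: (1, p)]) by exists [:: (1, p)].
have [s [h1 h2 h3]] := Hker hZ hc hz.
have h4 : evs R (s ++ scs (-1) [:: (1, p)]) (uj m) = 0.
  apply: (S0 m.+2); exists (s ++ scs (-1) [:: (1, p)]); split=> //.
    rewrite all_cat h1; apply/allP => x hx.
    by have /allP/(_ x hx)/and3P[-> ->] := pres_scs (-1) hs.
  by rewrite Lvec_cat Lvec_scs -h2 scN1 subrr.
have h5 : op C GCap 0 (ev (op R) p (uj m)) = l.
  have hu : inw C m.+1 (uj m) by apply/spanL_inw/inL_span/uj_in.
  have hU : inw C m.+3 (op C GCup 1 (uj m)) by apply: inwU.
  rewrite -[ev (op R) p _]/(ev (op R) (shiftw 1 (Tword 0 m)) (op C GCup 1 (uj m))) evR_shift (A_shift2 _ hU).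
  by rewrite zzl //; apply: Tword_lam.
apply: (lam_neq0 (mo := mo)); rewrite -h5.
move: h4; rewrite evs_cat evs_scs scN1 => /subr0_eq h4.
by move: h3; rewrite h4 /evs big_seq1 sc1.
Qed.

(** Makes words on the forgotten strand accessible inside the restriction: once the cap [A 0]
    straightens the cup, [hitword q] becomes [q] acting on all strands. *)
Definition hitword (q : word) : word := (0%N, GCup) :: shiftw 1 q.
Lemma hitwordP k d s q : soc k s -> inL k.+1 d s -> valid k.+1 q -> wend k.+1 q = m.+1 ->
  let v := ev (op R) (hitword q) s in
  [/\ wend k (hitword q) = m.+2, soc m.+2 v, inL m.+3 (d + wdeg q) v & op C GCap 0 v = ev (op C) q s].
Proof.
move=> hs hd h1 h2 v.
have hw : wend k (hitword q) = m.+2.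
  by have := wend_shift 1 h1; rewrite !add1n h2 /= subn0 addn2.
have hdeg : wdeg (hitword q) = wdeg q by rewrite wdeg_cons wdeg_shift add0r.
split=> //.
- by have := sub_ev (hitword q) (soc_sub mo mo1) hs; rewrite hw.
- by have := inL_evR (hitword q) hd; rewrite hw hdeg.
- have hi : inw C k.+1 s by apply/spanL_inw/(inL_span hd).
  have hU : inw C k.+3 (op C GCup 1 s) by apply: inwU.
  rewrite /v -[ev (op R) _ s]/(ev (op R) (shiftw 1 q) (op C GCup 1 s)) evR_shift (A_shift2 _ hU).
  by rewrite zzl.
Qed.
Lemma soc_lower k v : (k < m.+2)%N -> soc k v -> v = 0.
Proof.
move=> hk h; have hs := soc_spanL h.
have [h1|[h1|h1]] : (k < m \/ k = m \/ k = m.+1)%N by lia.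
- by apply: (spanL_low hs).
- by subst k; apply: (soc_m hf hft hG h).
- by subst k; apply: (spanL_parity hs); lia.
Qed.
Lemma X0_soc k v : soc k v -> op C GX 0 v = 0.
Proof.
move=> [s [hs _ ->]]; have hX := Xn_lam mo hf hft hG.
have h := evsR_Xp s m.+1 (spanL_lam mo); rewrite [Xp _ _ _ _]hX in h.
have h2 := evsR_Xp s m (spanL_lam mo).
rewrite -[uj m]/(Xp C 0 m l) h2 -XpE -h.
by rewrite /evs big1 // => x _; rewrite ev0 scv0.
Qed.
(* By straightening, a word [m.+2 -> m.+2] of positive degree sends [s] into the kernel of the
   leftmost cap. *)
Lemma soc_descent d s : soc m.+2 s -> inL m.+3 d s -> d < 0 -> (forall i, op R GT i s = 0) -> s = 0.
Proof.
move=> hs hd d0 hT; apply: contrapT => h0.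
have [q [h1 h2 h3 [c hc h4]]] := inL_hit hd h0.
have [h5 h6 h7 h8] := hitwordP hs hd h1 h2.
have hlow : lowest (restrict (soc_sub mo mo1)) m.+2 s (fun _ v => v = 0).
  split=> [||i|k v hk [h]]; [|by constructor|exact: hT|exact: soc_lower h].
  exact: zero_submod.
have [l1 l2 l3 l4] := hlow.
have SsC x : soc m.+2 x -> inw C m.+3 x by move=> h; apply: spanL_inw (soc_spanL h).
have SsB r x : soc m.+2 x -> bub C 0 r.+1 x = 0 by move=> h; apply: bub_spanL (soc_spanL h).
have SsZ : soc m.+2 0 /\ op C GCap 0 0 = 0.
  by split; [exact: (ss_0 (soc_ss mo mo1 _))|exact: op0].
have hA : forall e v, polys (restrict (soc_sub mo mo1)) m.+2 s (fun _ v => v = 0) e v ->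
   soc m.+2 v /\ op C GCap 0 v = 0.
  move=> e v; elim=> {e v}.
  - split=> //; apply: (inL_neg (mo := mo) (d := d)) => //.
    by have := inL_ev [:: (0%N, GCap)] hd; rewrite wdeg_cons wdeg_nil /= !addr0 subn2 addn0.
  - by move=> e v ->.
  - by move=> e v w _ [a1 a2] _ [b1 b2]; split; [exact: (ss_B (soc_ss mo mo1 _))|rewrite opB a2 b2 subrr].
  - move=> e i v _ [a1 a2]; split; first exact: (sub_X (soc_sub mo mo1)).
    have hv := SsC _ a1.
    rewrite -[op (restrict _) GX i v]/(op C GX i.+1 v); case: i => [|i].
      by rewrite AXs (X0_soc a1) op0 oppr0.
    by rewrite AX_hi // subn2 a2 op0.
  - move=> e r v _ [a1 a2].
    rewrite -[bub (restrict _) 0 r.+1 v]/(bub C 1 r.+1 v).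
    apply: (@slide _ _ C 0 m.+3 (fun _ v => soc m.+2 v /\ op C GCap 0 v = 0) isT _ _ _ _ _ 0) => //.
    + by move=> _ x y [b1 b2] [b3 b4]; split; [exact: (ss_B (soc_ss mo mo1 _))|rewrite opB b2 b4 subrr].
    + by move=> _ x [/SsC].
    + by move=> _ x [b1 _]; rewrite (X0_soc b1).
    + by move=> _ x r' [b1 _]; rewrite SsB.
have hev := polys_ev l1 l2 l3 l4 h5.
have [_] := hA _ _ hev.
rewrite -[ev _ _ s]/(ev (op R) (hitword q) s) h8 h4 => /(congr1 (sc c^-1)).
by rewrite scM mulVf // sc1 scv0; apply: lam_neq0.
Qed.
(** By [soc_descent] some crossing does not kill [s], and it lowers the degree by 2. Repetition
    gives nonzero vectors in infinitely many degrees of one weight space, against the upper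
    bound. *)
Lemma soc_neg d s : soc m.+2 s -> inL m.+3 d s -> d < 0 -> s = 0.
Proof.
move=> hs hd hd0; apply: contrapT => h0.
pose P d := exists s, [/\ soc m.+2 s, inL m.+3 d s & s <> 0].
have step e : e < 0 -> P e -> P (e - 2).
  move=> e0 [x [x1 x2 x3]].
  have [i hi] : exists i, op R GT i x <> 0.
    apply: contrapT => hn; apply: x3; apply: (soc_descent x1 x2 e0) => i.
    by apply: contrapT => hi; apply: hn; exists i.
  exists (op R GT i x); split=> //; first exact: (sub_T (soc_sub mo mo1)).
  case: (leqP (i + 2) m.+2) => hi2; last first.
    have hx : inw R m.+2 x by apply/inw_R/(inL_span x2).
    by case: hi; exact: (@op_out _ _ R m.+2 GT i x hx hi2).
  have := inL_evR [:: (i, GT)] x2; rewrite wdeg_cons wdeg_nil addr0 /=.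
  by rewrite subnK.
have hP i : P (d - 2 * i%:Z).
  elim: i => [|i IH]; first by rewrite mulr0 subr0; exists s.
  have -> : d - 2 * i.+1%:Z = d - 2 * i%:Z - 2 by lia.
  by apply: step => //; lia.
pose g (e : int) : nat := asbool (P e).
have hb e : indfam (inL m.+3 e) (fun v => v = 0) (g e).
  rewrite /g; case: asboolP => [[x [x1 x2 x3]]|_]; last exact: indfam0.
  exact: (indfam1 (subsp0 _ _) x2 x3).
suff ht : totge g (G m.+3).+1 by have := indfam_total hb ht; rewrite ltnn.
exists [seq d - 2 * i%:Z | i <- iota 0 (G m.+3).+1].
  by rewrite map_inj_uniq ?iota_uniq // => i j /eqP; lia.
rewrite big_map; under eq_bigr => i _ do rewrite /g asboolT //.
by rewrite sum1_size size_iota.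
Qed.

(** Take a word carrying some vector of [soc] to a multiple of [lam]. Its [hitword] brings that
    vector to degree 0, and crossings then land in degree [-2], where [soc_neg] applies. *)
Lemma socle_vec : exists v, [/\ soc m.+2 v, inL m.+3 0 v, v <> 0 & lowest (restrict (soc_sub mo mo1)) m.+2 v (fun _ v => v = 0)].
Proof.
have [k [v0 [h0 hv0]]] := soc_nonzero.
have [d [s0 [_ _]]] := soc_hom h0 hv0; set s := evs _ _ _ => hs hd hS.
have [q [h1 h2 h3 [c hc h4]]] := inL_hit hd hs.
have [h5 h6 h7 h8] := hitwordP hS hd h1 h2.
set v := ev _ _ _ in h6 h7 h8; rewrite h3 subrr in h7.
exists v; split=> //.
  move=> e; move: h8; rewrite e op0 h4 => /esym /(congr1 (sc c^-1)).
  by rewrite scM mulVf // sc1 scv0; apply: lam_neq0.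
split=> [||i|k' x hk [h]]; [|by constructor| |exact: soc_lower h].
  exact: zero_submod.
apply: (@soc_neg (-2)) => //; first exact: (sub_T (soc_sub mo mo1)).
case: (leqP (i + 2) m.+2) => hi2; last first.
  have hx : inw R m.+2 v by apply/inw_R/(inL_span h7).
  have -> : op (restrict (soc_sub mo mo1)) GT i v = 0 by exact: (@op_out _ _ R m.+2 GT i v hx hi2).
  exact: (ss_0 (inL_ss _ _ _)).
by have := inL_evR [:: (i, GT)] h7; rewrite wdeg_cons wdeg_nil addr0 add0r /= subnK.
Qed.
End Off.

(** * The filtration with copies of both L(n - 1) and L(n + 1) *)

Section OffChain.
Variables (K : fieldType) (t m : nat) (G G1 : nat -> nat) (mo : model K t m.+1 G) (mo1 : model K t m G1).
Variables (G2 : nat -> nat) (mo2 : model K t m.+2 G2).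
Local Notation inL2 := (inL mo2).
Local Notation C := (cofun t K).
Local Notation l := (lam mo).
Local Notation inL1 := (inL mo1).
Local Notation spanL1 := (spanL mo1).
Local Notation R1 := (R mo1).
Local Notation spanL := (spanL mo).
Local Notation inL := (inL mo).
Local Notation R := (R mo).
Local Notation uj := (uj mo).
Local Notation soc := (soc mo mo1).
Variable f : int -> nat.
Hypothesis hf : forall d, indfam (inL1 m d) (fun v => v = 0) (f d).
Hypothesis hft : totge f m`!.
Hypothesis hG : (G m.+1 <= (m.+1)`!)%N.
Hypothesis Hsub : forall S, submodule R1 S -> (forall k, subsp (S k)) ->
  (forall k v, (k <= m)%N -> S k v -> v = 0) -> forall d v, inL1 m.+2 d v -> S m.+1 v -> v = 0.
Hypothesis Hker : forall Z, subsp Z ->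
  (forall k u v, (k < m)%N -> spanL1 k.+1 u -> cyc R1 k u m.+1 v -> Z v) ->
  forall d v, inL1 m.+2 d v -> Z v.

Let SR : submodule R soc. Proof. exact: soc_sub. Qed.
Let Ssc k : subsp (soc k). Proof. exact: soc_ss. Qed.
Let S0 v : soc m v -> v = 0. Proof. exact: (soc_m hf hft hG). Qed.
Local Notation Cj := (Cj mo soc).

Definition Yj j := Xp C 0 j (op C GCup 0 l).
(** Refines [C_j] over [C_{j+1}]: the vector [uj j] accounts for the lower layer, with a copy of
    [L(m)], and [Yj j] for the upper layer, with a copy of [L(m + 2)]. *)
Definition Dj j k v := exists c g, [/\ Cj j.+1 k c, cyc R m (uj j) k g & v = c + g].

Lemma cycu_sub j : submodule R (cyc R m (uj j)).
Proof. exact: (cyc_sub (R_lin mo) (@R_sc _ _ _ _ mo) (uj_inw mo j)). Qed.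
Lemma Dj_ss j k : subsp (Dj j k).
Proof.
split=> [|v v' [r [w [h1 h2 ->]]] [r' [w' [h1' h2' ->]]]|c v [r [w [h1 h2 ->]]]].
- by exists 0, 0; rewrite addr0; split=> //; apply: ss_0; [apply: Cj_ss|apply: cyc_ss].
- exists (r - r'), (w - w'); split; [exact: (ss_B (Cj_ss _ Ssc _ _))|exact: (ss_B (cyc_ss _ _ _ _))|].
  by rewrite opprD addrACA.
- exists (sc c r), (sc c w); split; [exact: (ss_sc (Cj_ss _ Ssc _ _))|exact: (ss_sc (cyc_ss _ _ _ _))|].
  by rewrite scD.
Qed.
Lemma cycu_Cj j k g : cyc R m (uj j) k g -> Cj j k g.
Proof.
move=> [s hs ->]; rewrite (evsR_Xp _ _ (spanL_lam mo)).
exists (evs R s l), 0; rewrite addr0; split=> //; last exact: (ss_0 (Ssc _)).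
apply/inw_R; apply: (cyc_inw (@R_sc _ _ _ _ mo) (l_inwR mo)); by exists s.
Qed.
Lemma Dj_Cj j k v : Dj j k v -> Cj j k v.
Proof.
move=> [c [g [h1 h2 ->]]]; apply: (ss_D (Cj_ss _ Ssc _ _)); first exact: Cj_dec.
exact: cycu_Cj.
Qed.
Lemma Dj_sub j : submodule R (Dj j).
Proof.
split=> [k v /Dj_Cj h|k|k v v'|g i k v [c [x [h1 h2 ->]]]].
- exact: (sub_wt (Cj_sub SR Ssc j) h).
- exact: (ss_0 (Dj_ss _ _)).
- exact: (ss_B (Dj_ss _ _)).
- exists (op R g i c), (op R g i x); split; [exact: (sub_op (Cj_sub SR Ssc _))|exact: (sub_op (cycu_sub j))|].
  exact: opD.
Qed.

Lemma U0_in : inL m.+3 0 (op C GCup 0 l).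
Proof.
have := inL_ev [:: (0%N, GCup)] (inL_lam mo).
by rewrite wdeg_cons wdeg_nil /= !addr0 subn0 addn2.
Qed.
Lemma Yj_in j : inL m.+3 (2 * j%:Z) (Yj j).
Proof. by have := inL_Xp j U0_in; rewrite add0r. Qed.
Lemma A1_Yj j : op R GCap 0 (Yj j) = uj j.
Proof.
have hl : inw C m.+1 l by apply: spanL_inw; apply: spanL_lam.
rewrite -[LHS]/(op C GCap 1 (Xp C 0 j (op C GCup 0 l))) (op_Xp0 _ _ _ (inwU 0 hl)).
by rewrite zzr.
Qed.
Lemma shift2_Yj q j : ev (op C) q l = 0 -> ev (op R) (shiftw 1 q) (Yj j) = 0.
Proof.
move=> hq; have hl : inw C m.+1 l by apply: spanL_inw; apply: spanL_lam.
rewrite /Yj (evR_Xp _ _ (inL_span U0_in)) (evR_shift mo) (U_shift2 _ hl) hq op0; exact: raddf0.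
Qed.

(* If [y_j = g u_j] modulo [C_{j+1}], then [g lambda_{n-1}] generates in the restriction of
   [L(n - 1)] a module with no weight below [n], contradicting the upper bound. *)
Lemma Yj_Dj j : (j <= m)%N -> ~ Dj j m.+2 (Yj j).
Proof.
move=> hj [c [x [[v0 [s [hv0 hs ->]]] [g0 hg0 ->] e]]].
(* [Yj j] and [uj j] both have degree [2j], so the degree 0 part of [g0] suffices after
   projection. *)
pose g := [seq x <- g0 | wdeg x.2 == 0].
have hg : pres m m.+2 0 g by apply: pres_filter.
have {}e : Cj j.+1 m.+2 (Yj j - evs R g (uj j)).
  have : proj (2 * j%:Z) (Yj j) = Yj j by rewrite (proj_inL _ (Yj_in j)) eqxx.
  rewrite {1}e !projD.
  have -> : proj (2 * j%:Z) (evs R g0 (uj j)) = evs R g (uj j).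
    rewrite /evs /g big_filter [RHS]big_mkcond /=.
    elim: (g0) => [|y s' IH]; first by rewrite !big_nil proj0.
    rewrite !big_cons projD IH; congr (_ + _); rewrite proj_sc (evRE mo) proj_ev wdeg_shift (proj_inL _ (uj_in mo j)).
    case: eqP => [e1|ne]; case: eqP => // e'; try lia.
    by rewrite ev0 scv0.
  move=> <-; rewrite addrK; exists (proj (- 2) v0), (proj (2 * j%:Z) s); split.
  - exact: inL_span (proj_spanL _ hv0).
  - by case: (soc_proj (2 * j%:Z) hs).
  - congr (_ + _); rewrite !Xp_is_ev proj_ev wdeg_X; congr (ev _ _ (proj _ _)); lia.
have u0 : uj j <> 0 by apply: uj_neq0.
have hCss k : subsp (Cj j.+1 k) by apply: Cj_ss.
have hX := @lowest_Lvec _ _ _ _ mo1 _ R (R_lin mo) (uj j) _ (uj_low SR Ssc j) hCss (uj_Cj S0 u0).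
pose w := Lvec mo1 g.
have hw : inL1 m.+2 0 w by exists g.
(* The cap on the first two strands of [R] sends [Yj j] to [uj j]; through the comparison with
   [L(m)] the vector [w] is sent to the lowest vector, hence is not 0. *)
have hA : op C GCap 0 w = lam mo1.
  apply/subr0_eq; pose g' := rws g [:: (0%N, GCap)] ++ scs (-1) [:: (1 : K, [::])].
  have eL : Lvec mo1 g' = op C GCap 0 w - lam mo1.
    have e1 : Lvec mo1 [:: (1 : K, [::])] = lam mo1 by rewrite -evs_lam /evs big_seq1 sc1.
    rewrite /g' Lvec_cat Lvec_scs scN1 e1; congr (_ - _).
    by rewrite /w -!evs_lam evs_rws.
  rewrite -eL; apply: (hX m 0).
    rewrite /pres all_cat /= wdeg_nil !eqxx !andbT.
    apply/allP => _ /mapP[y /(allP hg) /and3P[h1 /eqP h2 /eqP h3] ->] /=.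
    by rewrite valid_cat wend_cat wdeg_cat h1 h2 h3 wdeg_cons wdeg_nil /= subn2 addn0 !addr0 !eqxx.
  rewrite /g' evs_cat evs_scs scN1 evs_rws // [evs R [:: _] _]big_seq1 sc1 -{2}(A1_Yj j).
  have h : Cj j.+1 m (op R GCap 0 (Yj j - evs R g (uj j))).
    by have := sub_op (Cj_sub SR Ssc j.+1) GCap 0 e; rewrite [(_ - _ + _)%N]/= subn2 addn0.
  by have := ss_N (hCss _) h; rewrite opB opprB.
(* A word killing [lam] kills [Yj j] when moved two strands to the right, hence kills [w] when moved
   one strand. In particular [w] generates nothing in restricted weight at most [m]. *)
have hp q : valid m.+1 q -> ev (op C) q l = 0 -> ev (op R1) q w = 0.
  move=> hq1 hq2; rewrite (evRE mo1) /w -evs_lam -evs_rws // evs_lam.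
  have v1 := valid_shift 1 hq1; have w1 := wend_shift 1 hq1; rewrite !add1n in v1 w1.
  apply: (hX (wend m.+1 q).+1 (wdeg q)).
    apply/allP => _ /mapP[y /(allP hg) /and3P[h1 /eqP h2 /eqP h3] ->] /=.
    by rewrite valid_cat wend_cat wdeg_cat h1 h2 h3 v1 w1 wdeg_shift add0r !eqxx.
  have := sub_ev (shiftw 1 q) (Cj_sub SR Ssc j.+1) e; rewrite w1 evB shift2_Yj // sub0r => h.
  by have := ss_N (hCss _) h; rewrite opprK evs_rws.
have hwR : inw R1 m.+1 w by apply/inw_R/(inL_span hw).
have h0 : w = 0.
  apply: (Hsub (S := cyc R1 m.+1 w) _ _ _ hw).
  - exact: (cyc_sub (R_lin mo1) (@R_sc _ _ _ _ mo1) hwR).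
  - by move=> k; apply: cyc_ss.
  - move=> k v hk [s1 /allP hs1 ->]; rewrite /evs big_seq big1 // => y /hs1 /andP[h1 /eqP h2].
    by rewrite hp ?scv0 //; apply: (lam_out mo h1 h2); lia.
  - exact: cyc_self.
by apply: (lam_neq0 (mo := mo1)); rewrite -hA h0 op0.
Qed.

(** In weight [m] this is [spanL_split] multiplied by [X_0^j]; weight [m + 1] has the wrong parity,
    and below [m] only the part from [soc] is left. *)
Lemma Cj_low j k v : (k < m.+2)%N -> Cj j k v -> Dj j k v.
Proof.
move=> hk [v0 [s [h1 h2 ->]]].
have [h|[h|h]] : (k < m \/ k = m \/ k = m.+1)%N by lia.
- rewrite (spanL_low h1) // raddf0 add0r; exists s, 0; rewrite addr0; split=> //; first exact: Cj_S.
  exact: (ss_0 (cyc_ss _ _ _ _)).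
- subst k; have [r [v2 [[sr hr ->] h4 ->]]] := spanL_split h1.
  exists (Xp C 0 j.+1 v2 + s), (evs R sr (uj j)); split.
  + by exists v2, s.
  + by exists sr.
  + by rewrite XpAdd -XpS (evsR_Xp _ _ (spanL_lam mo)) -addrA addrC.
- subst k; rewrite (spanL_parity h1); last by lia.
  rewrite raddf0 add0r; exists s, 0; rewrite addr0; split=> //; first exact: Cj_S.
  exact: (ss_0 (cyc_ss _ _ _ _)).
Qed.

Let Mj j := restrict (Cj_sub SR Ssc j).
Lemma Dj_subM j : submodule (Mj j) (Dj j).
Proof.
by case: (Dj_sub j) => h1 h2 h3 h4; split=> // k v; apply: Dj_Cj.
Qed.
Lemma Yj_Cj j : inw (Mj j) m.+2 (Yj j).
Proof.
constructor; exists (op C GCup 0 l), 0; rewrite addr0; split=> //; first exact: inL_span U0_in.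
exact: (ss_0 (Ssc _)).
Qed.
Lemma Yj_T j i : op R GT i.+1 (Yj j) = 0.
Proof.
have hl : inw C m.+1 l by apply: spanL_inw; apply: spanL_lam.
rewrite -[LHS]/(op C GT i.+2 (Xp C 0 j (op C GCup 0 l))) (op_Xp0 _ _ _ (inwU 0 hl)).
have -> : op C GT i.+2 (op C GCup 0 l) = 0.
  by rewrite (@far _ _ C GCup GT 0 i i.+2 m.+1 l hl) ?lamT ?op0 //= addn0 addn2.
exact: raddf0.
Qed.
(** The dot passes with a sign from the right leg of the cup to the left one, where it raises the
    power of [X_0]. *)
Lemma Yj_X j : Dj j m.+2 (op R GX 0 (Yj j)).
Proof.
have hl : inw C m.+1 l by apply: spanL_inw; apply: spanL_lam.
exists (op R GX 0 (Yj j)), 0; rewrite addr0; split=> //; last exact: (ss_0 (cyc_ss _ _ _ _)).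
exists (- op C GCup 0 l), 0; rewrite addr0; split; last 1 first.
- rewrite -[LHS]/(op C GX 1 (Xp C 0 j (op C GCup 0 l))) (op_Xp0 _ _ _ (inwU 0 hl)).
  by rewrite XUs XpS [in RHS]opN.
- by apply: (ss_N (spanL_ss _ _)); exact: inL_span U0_in.
- exact: (ss_0 (Ssc _)).
Qed.
(** The [m + 1] crossings make [Yj j] lowest modulo [D_j] and bring its degree to
    [2j - 2(m + 1)]. *)
Definition Yj' j := ev (op R) (Tword 0 m.+1) (Yj j).
Lemma Yj'_in j : inL m.+3 (2 * j%:Z - 2 * m.+1%:Z) (Yj' j).
Proof. by have := inL_evR (Tword 0 m.+1) (Yj_in j); rewrite wend_Tword ?wdeg_Tword. Qed.
Lemma Yj'_low j : lowest (Mj j) m.+2 (Yj' j) (Dj j).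
Proof.
have low' v : inw (Mj j) (m.+2 - 2) v -> Dj j (m.+2 - 2) v by case=> h; apply: Cj_low h; lia.
have hT i : Dj j m.+2 (op (Mj j) GT i.+1 (Yj j)).
  by rewrite [op _ _ _ _]Yj_T; apply: (ss_0 (Dj_ss _ _)).
split=> [||i|k v hk [h]]; [exact: Dj_subM| |exact: (head_T (Dj_subM j) (Yj_Cj j) hT)|exact: Cj_low h].
by have := @inw_ev _ _ (Mj j) m.+2 (Tword 0 m.+1) _ (Yj_Cj j); rewrite wend_Tword.
Qed.
Lemma Yj'_notin j : (j <= m)%N -> ~ Dj j m.+2 (Yj' j).
Proof.
move=> hj h; have low' v : inw (Mj j) (m.+2 - 2) v -> Dj j (m.+2 - 2) v by case=> h'; apply: Cj_low h'; lia.
have hT i : Dj j m.+2 (op (Mj j) GT i.+1 (Yj j)).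
  by rewrite [op _ _ _ _]Yj_T; apply: (ss_0 (Dj_ss _ _)).
apply: (Yj_Dj hj); exact: (head_notin (Dj_subM j) (Yj_Cj j) hT (Yj_X j) low' (ltnSn _) h).
Qed.

Variables (k : nat) (g1 g2 : int -> nat).
Hypothesis hg1 : forall d, indfam (inL1 k d) (fun v => v = 0) (g1 d).
Hypothesis hg2 : forall d, indfam (inL2 k d) (fun v => v = 0) (g2 d).

Lemma Y_step j d : (j <= m)%N ->
  indfam (fun v => inL k.+1 d v /\ Cj j k v) (Dj j k) (g2 (d - (2 * j%:Z - 2 * m.+1%:Z))).
Proof.
move=> hj; apply: (@lowest_indfam _ _ _ _ mo2 _ (Mj j) (fun _ _ _ _ => erefl) (Yj' j) (Dj j) (Yj'_low j) (Dj_ss j) (Yj'_notin hj) _ k _ _ (hg2 _)).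
move=> s hs; split; first by have := pres_R (Yj'_in j) hs; rewrite addrC subrK.
have hM k' c v : inw (Mj j) k' v -> inw (Mj j) k' (sc c v).
  by case=> h; constructor; apply: ss_sc => //; apply: Cj_ss.
have [_ inu _ _] := Yj'_low j.
have [] // := @cyc_inw _ _ _ (Mj j) hM m.+2 (Yj' j) inu k (evs R s (Yj' j)).
by exists s => //; apply/allP => x /(allP hs) /and3P[-> ->].
Qed.
Lemma chain2 J d : (J <= m.+1)%N -> indfam (inL k.+1 d) (Cj J k)
  (\sum_(j < J) (g2 (d - (2 * j%:Z - 2 * m.+1%:Z))%R + g1 (d - 2 * j%:Z)%R))%N.
Proof.
elim: J => [|J IH] hJ; first by rewrite big_ord0; apply: indfam0.
rewrite big_ord_recr /=; apply: (@indfamD _ _ _ (Cj J k)); [exact: Cj_ss|by move=> v; apply: Cj_dec|by apply: IH; lia|].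
apply: (@indfamD _ _ _ (Dj J k)); [exact: Dj_ss| |exact: Y_step|].
  move=> v h; exists v, 0; rewrite addr0; split=> //; exact: (ss_0 (cyc_ss _ _ _ _)).
have u0 : uj J <> 0 by apply: uj_neq0.
apply: indfamW (chain_step SR Ssc S0 u0 (hg1 _)) => // v [h1 h2 h3]; split=> //.
by exists 0, v; rewrite add0r; split=> //; apply: (ss_0 (Cj_ss _ Ssc _ _)).
Qed.
(** The last term is the copy of [L(m + 2)] in [soc], generated in degree 0: this is the value at
    [j = m + 1] of the shifts [2j - 2(m + 1)] occurring for [j <= m]. *)
Lemma off_bound d : indfam (inL k.+1 d) (fun v => v = 0)
  (\sum_(j < m.+1) (g2 (d - (2 * j%:Z - 2 * m.+1%:Z))%R + g1 (d - 2 * j%:Z)%R) + g2 d)%N.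
Proof.
apply: (@indfamD _ _ _ (Cj m.+1 k)); [exact: Cj_ss|by move=> v ->; apply: (ss_0 (Cj_ss _ Ssc _ _))|exact: chain2|].
have [v [h1 h2 h3 h4]] := socle_vec mo hf hft hG Hker.
apply: (@lowest_indfam _ _ _ _ mo2 _ (restrict (soc_sub mo mo1)) (fun _ _ _ _ => erefl) v (fun _ v => v = 0) h4 (fun _ => subsp0 _ _) h3 _ k d _ (hg2 d)).
move=> s hs; split; first by have := pres_R h2 hs; rewrite add0r.
apply: Cj_S; have hM k' c x : inw (restrict (soc_sub mo mo1)) k' x -> inw (restrict (soc_sub mo mo1)) k' (sc c x).
  by case=> h; constructor; apply: (ss_sc (soc_ss mo mo1 _) c h).
have [_ inu _ _] := h4.
have [] // := @cyc_inw _ _ _ (restrict (soc_sub mo mo1)) hM m.+2 v inu k (evs R s v).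
by exists s => //; apply/allP => x /(allP hs) /and3P[-> ->].
Qed.
End OffChain.

(** * Dimensions *)

Lemma walks_lt N k m : (k < m)%N -> walks N k m = 0%N.
Proof.
elim: k m => [|k IH] m /= h; first by case: m h.
by rewrite !IH ?muln0 //; lia.
Qed.
Lemma walks_diag N k : walks N k k = k`!.
Proof. by elim: k => //= k IH; rewrite IH (walks_lt N (leqnSn k.+1)) muln0 addn0 factS. Qed.
(** The exponential generating function of [walks N k m] in [k] is [sinh^m cosh^(N-m)], and the
    identity is [cosh^2 = 1 + sinh^2]. It makes the recursion agree with the upper bound in
    [cr_total]. *)
Lemma walks_step N k m : (m <= N)%N -> walks N.+2 k m = (walks N k m + walks N.+2 k m.+2)%N.
Proof.
elim: k m => [|k IH] m h; first by rewrite /= addn0.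
have e1 : (m * walks N.+2 k m.-1 = m * walks N k m.-1 + m * walks N.+2 k m.+1)%N.
  by case: m h => // m h; rewrite (IH m) ?mulnDr //; lia.
have e2 : ((N - m) * walks N.+2 k m.+1 = (N - m) * walks N k m.+1 + (N - m) * walks N.+2 k m.+3)%N.
  have [->|h'] : (m = N \/ m < N)%N by lia.
    by rewrite subnn.
  by rewrite IH ?mulnDr.
rewrite [LHS]/= [walks N k.+1 m]/= [walks _ k.+1 m.+2]/= e1 !subSS.
have -> : ((N.+2 - m) * walks N.+2 k m.+1 = (N - m) * walks N.+2 k m.+1 + 2 * walks N.+2 k m.+1)%N.
  by rewrite -mulnDl; congr (_ * _)%N; lia.
have -> : (m.+2 * walks N.+2 k m.+1 = m * walks N.+2 k m.+1 + 2 * walks N.+2 k m.+1)%N.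
  by rewrite -mulnDl addn2.
by rewrite e2; lia.
Qed.

Section Bound.
Variables (K : fieldType) (t : nat).
Hypotheses (two : (2%:R : K) != 0) (t1 : (t <= 1)%N).
Definition level n := if (n %% 2 == t)%N then n else n.+1.
Lemma level_mod n : (level n %% 2 = t)%N.
Proof. by rewrite /level; case: eqP => //; lia. Qed.
Lemma level_ge n : (n <= level n)%N.
Proof. by rewrite /level; case: ifP. Qed.
Definition mods n : model K t n (fun k => walks (level n) k n) :=
  projT1 (cid (model_ex two (level_ge n) (level_mod n))).

(** Dimension of [1_k L(n)] in degree [d] before the shift: the shifts [2j] are the degrees of the
    [uj], and the shifts [2j - 2n] those of the [Yj'] and of the socle vector. *)
Fixpoint cr (k n : nat) (d : int) : nat :=
  if k is k'.+1 then
    (\sum_(j < n) cr k' n.-1 (d - 2 * j%:Z)%R +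
     (if (n %% 2 == t)%N then 0 else \sum_(j < n.+1) cr k' n.+1 (d - (2 * j%:Z - 2 * n%:Z))%R))%N
  else ((n == 0%N) && (d == 0)).

Lemma cr_lt k n d : (k < n)%N -> cr k n d = 0%N.
Proof.
elim: k n d => [|k IH] n d h /=; first by case: n h.
rewrite big1 => [|j _]; last by rewrite IH; lia.
case: ifP => // _; rewrite big1 // => j _; rewrite IH; lia.
Qed.
Lemma cr_total k n : totge (cr k n) (walks (level n) k n).
Proof.
elim: k n => [|k IH] n.
  case: n => [|n]; last exact: totge0.
  exact: (totge1 0).
have h1 := totge_sum n (fun j => 2 * j%:Z) (IH n.-1).
have h2 := totge_sum n.+1 (fun j => 2 * j%:Z - 2 * n%:Z) (IH n.+1).
rewrite /=; case: (eqVneq (n %% 2)%N t) => hn.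
  have -> : (n * walks (level n) k n.-1 + (level n - n) * walks (level n) k n.+1 = n * walks (level n.-1) k n.-1)%N.
    have e : level n = n by rewrite /level hn eqxx.
    rewrite e subnn mul0n addn0; case: n hn {h1 h2 e} => // n hn.
    by have -> : level n.+1.-1 = n.+1 by rewrite /level /=; case: eqP => //; lia.
  by case: h1 => ds u1 u2; exists ds => //; under eq_bigr => d _ do rewrite addn0.
have -> : (n * walks (level n) k n.-1 + (level n - n) * walks (level n) k n.+1 =
   n * walks (level n.-1) k n.-1 + n.+1 * walks (level n.+1) k n.+1)%N.
  have e : level n = n.+1 by rewrite /level (negPf hn).
  have e' : level n.+1 = n.+1 by rewrite /level; case: eqP => //; lia.
  rewrite e e' subSnn mul1n; case: n hn {h1 h2 e e'} => [|n] hn; first by rewrite !mul0n mul1n.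
  have -> : level n.+1.-1 = n by rewrite /level /=; case: eqP => //; lia.
  by rewrite /= walks_step //; lia.
exact: totgeD h1 h2.
Qed.

(** For [t = 0] the cube has no coordinates, hence no walk of positive length. *)
Lemma low_zero d v : (0 %% 2 == t)%N -> inL (mods 0) 2 d v -> v = 0.
Proof.
move=> h0 hv; apply: contrapT => h.
have [w hw hi] := (indfam_indep _ _).1 (indfam1 (subsp0 _ _) hv h).
have := upper_bound (d := fun _ => d) hw hi.
by rewrite /level h0 /= !mul0n.
Qed.

Definition lower_at k := forall n d, indfam (inL (mods n) k d) (fun v => v = 0) (cr k n d).

Lemma lower_parity k m d : lower_at k -> indfam (inL (mods m.+1) k.+1 d) (fun v => v = 0)
  (\sum_(j < m.+1) cr k m (d - 2 * j%:Z)%R)%N.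
Proof.
move=> IH; have hb := @chain_f _ _ _ _ _ (mods m.+1) (mods m) k _ (IH m) _ (zero_submod _)
  (fun _ => subsp0 _ _) (fun v h => h) d.
by apply: indfamW hb => // v [].
Qed.

(** For [m] congruent to [t] the cube has exactly [m] coordinates: from distance [m] every first
    step leads closer, so the upper bound for [L(m)] is [m] times that for [L(m - 1)]. *)
Lemma mods_extra_sub m : (m %% 2 == t)%N -> (forall n d, indfam (inL (mods n) m.+1 d) (fun v => v = 0) (cr m.+1 n d)) ->
  forall S, submodule (R (mods m)) S -> (forall k, subsp (S k)) ->
  (forall k v, (k <= m)%N -> S k v -> v = 0) -> forall d v, inL (mods m) m.+2 d v -> S m.+1 v -> v = 0.
Proof.
case: m => [|m] hm IH S SR Ssc S0 d v hv hS; first exact: (low_zero hm hv).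
apply: (@extra_in_sub _ _ _ _ _ (mods m.+1) (mods m) m.+2 _ _ (IH m) (cr_total m.+2 m) _ S SR Ssc _ _ _ hv hS).
  have e : level m.+1 = m.+1 by rewrite /level hm.
  have e' : level m = m.+1 by rewrite /level; case: eqP => //; lia.
  rewrite -[walks _ m.+3 _]/(m.+1 * walks (level m.+1) m.+2 m
     + (level m.+1 - m.+1) * walks (level m.+1) m.+2 m.+2)%N.
  by rewrite e e' subnn mul0n addn0.
by move=> x; apply: S0.
Qed.
Lemma mods_extra_ker m : (m %% 2 == t)%N -> (forall n d, indfam (inL (mods n) m.+1 d) (fun v => v = 0) (cr m.+1 n d)) ->
  forall Z, subsp Z -> (forall k u v, (k < m)%N -> spanL (mods m) k.+1 u -> cyc (R (mods m)) k u m.+1 v -> Z v) ->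
  forall d v, inL (mods m) m.+2 d v -> Z v.
Proof.
case: m => [|m] hm IH Z hZ hc d v hv; first by rewrite (low_zero hm hv); apply: ss_0.
apply: (@extra_in_ker _ _ _ _ _ (mods m.+1) (mods m) m.+2 _ _ (IH m) (cr_total m.+2 m) _ Z hZ _ _ _ hv).
  have e : level m.+1 = m.+1 by rewrite /level hm.
  have e' : level m = m.+1 by rewrite /level; case: eqP => //; lia.
  rewrite -[walks _ m.+3 _]/(m.+1 * walks (level m.+1) m.+2 m
     + (level m.+1 - m.+1) * walks (level m.+1) m.+2 m.+2)%N.
  by rewrite e e' subnn mul0n addn0.
move=> j x; apply: hc => //; exact: inL_span (uj_in (mods m.+1) j).
Qed.

(** The single copy of [L(1)] is generated by a cup on [lam], which is nonzero because the bubble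
    has value [t = 1]. *)
Lemma lower_zero k d : (0 %% 2 != t)%N -> lower_at k -> indfam (inL (mods 0) k.+1 d) (fun v => v = 0) (cr k 1 d).
Proof.
move=> h0 IH; have t1' : t = 1%N by lia.
pose l := lam (mods 0); pose C := cofun t K.
have hl : inw C 0 l by apply: spanL_inw; apply: spanL_lam.
have hU : inL (mods 0) 2 0 (op C GCup 0 l).
  have := inL_ev [:: (0%N, GCup)] (inL_lam (mods 0)).
  by rewrite wdeg_cons wdeg_nil /= !addr0.
have hw : inw (R (mods 0)) 1 (op C GCup 0 l) by apply/inw_R/(inL_span hU).
have low : lowest (R (mods 0)) 1 (op C GCup 0 l) (fun _ v => v = 0).
  split=> [||i|k' v hk /inw_R h]; [|exact: hw| |].
  - exact: zero_submod.
  - by have hi : (1 < i + 2)%N by [lia]; exact: (@op_out _ _ (R (mods 0)) 1 GT i _ hw hi).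
  - by apply: (spanL_parity h); lia.
have hn0 : op C GCup 0 l <> 0.
  move=> e; have := AUt (hv := hl) (leqnn 0); rewrite e op0 t1' mulr1n => /esym.
  exact: lam_neq0.
apply: (lowest_indfam (R_lin (mods 0)) low (fun _ => subsp0 _ _) hn0 (IH 1%N d)).
by move=> s hs; have := pres_R hU hs; rewrite add0r.
Qed.

Lemma lower_bound k : lower_at k.
Proof.
elim/ltn_ind: k => [[|k]] IH n d.
  case: n => [|n]; last exact: indfam0.
  rewrite /=; case: eqP => [->|_]; last exact: indfam0.
  apply: (indfam1 (subsp0 _ _) (inL_lam _)); exact: lam_neq0.
have IHk : lower_at k by apply: IH.
case: n => [|m]; rewrite /=.
  rewrite big_ord0 add0n; case: (eqVneq (0 %% 2)%N t) => h0; first exact: indfam0.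
  by rewrite big_ord1 !mulr0 subrr subr0; apply: lower_zero.
case: (eqVneq (m.+1 %% 2)%N t) => hm.
  by rewrite addn0; apply: lower_parity.
(* Below weight [m + 2] the copies of [L(m + 2)] contribute 0. Otherwise the induction hypothesis
   covers weights [m] and [m + 1], as saturation of [L(m)] requires. *)
case: (ltnP k m.+2) => hk.
  rewrite [X in (_ + X)%N]big1 ?addn0; first exact: lower_parity.
  by move=> j _; apply: cr_lt.
have hm' : (m %% 2 == t)%N by apply/eqP; lia.
have IHm : forall n d, indfam (inL (mods n) m.+1 d) (fun v => v = 0) (cr m.+1 n d).
  by apply: IH; lia.
have ht : totge (cr m m) m`! by have := cr_total m m; rewrite walks_diag.
have hG : (walks (level m.+1) m.+1 m.+1 <= (m.+1)`!)%N by rewrite walks_diag.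
have hf : forall d, indfam (inL (mods m) m d) (fun v => v = 0) (cr m m d) by apply: IH; lia.
have := off_bound (mods m.+1) (mo1 := mods m) (mo2 := mods m.+2) hf ht hG
   (mods_extra_sub hm' IHm) (mods_extra_ker hm' IHm) (IHk m) (IHk m.+2) d.
rewrite big_split /= [X in indfam _ _ (X + _)%N -> _]addnC -addnA.
by rewrite [X in _ -> indfam _ _ (_ + X)%N]big_ord_recr /= subrr subr0.
Qed.
End Bound.

(** * The radical of the presented module *)

(** One more dimension in a single degree would push the total of the lower bounds above the upper
    bound. *)
Lemma exact_dim (K : fieldType) (t : nat) (two : (2%:R : K) != 0) (t1 : (t <= 1)%N) k n d r :
  indfam (inL (mods two t1 n) k d) (fun v => v = 0) r -> (r <= cr t k n d)%N.
Proof.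
move=> hr; rewrite leqNgt; apply/negP => h.
pose f e := if e == d then r else cr t k n e.
have hf e : indfam (inL (mods two t1 n) k e) (fun v => v = 0) (f e).
  by rewrite /f; case: eqP => [->|_] //; apply: lower_bound.
have ht : totge f (walks (level t n) k n).+1.
  rewrite -addn1; apply: totgeW (totgeD (cr_total two t1 k n) (totge1 d)) => e.
  by rewrite /f; case: eqP => [->|_]; rewrite ?addn0 // addn1.
by have := indfam_total hf ht; rewrite ltnn.
Qed.

(** * Quotient of an abelian group by a subgroup given as a predicate *)

Section QuotientGroup.
Variables (V : zmodType) (S : V -> Prop).
Hypotheses (S0 : S 0) (SB : forall x y, S x -> S y -> S (x - y)).
Definition qpred : {pred V} := fun x => asbool (S x).
Lemma qpred_closed : zmod_closed qpred.
Proof.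
split=> [|x y]; first exact/asboolP.
by rewrite -![_ \in qpred]/(asbool _) => /asboolP h /asboolP h'; apply/asboolP; apply: SB.
Qed.
HB.instance Definition _ := GRing.isZmodClosed.Build V qpred qpred_closed.
Lemma quotient_group : exists (Q : zmodType) (p : V -> Q),
  (forall x y, p (x - y) = p x - p y) /\ forall x, p x = 0 <-> S x.
Proof.
exists (Quotient.quot qpred), (\pi_(Quotient.quot qpred)%qT); split=> [x y|x]; first exact: raddfB.
rewrite -(raddf0 (\pi_(Quotient.quot qpred)%qT)); split.
  by move/eqP; rewrite -Quotient.idealrBE subr0 => /asboolP.
by move=> h; apply/eqP; rewrite -Quotient.idealrBE subr0; apply/asboolP.
Qed.
End QuotientGroup.

(** * Translation between paths and words *)

Definition wp (p : Defs.path) : word := [seq (e.1.1, e.1.2) | e <- p].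
(** Recovers from the source the number of strands on the right that [wp] forgets. *)
Fixpoint pw (k : nat) (q : word) : Defs.path :=
  if q is (i, g) :: q' then (i, g, (k - (i + gsrc g))%N) :: pw (k - gsrc g + gtgt g) q' else [::].
Lemma wp_pw k q : wp (pw k q) = q.
Proof. by elim: q k => [|[i g] q IH] k //=; rewrite IH. Qed.
Lemma wp_cat p p' : wp (p ++ p') = wp p ++ wp p'.
Proof. exact: map_cat. Qed.
Lemma wp_whisk a b p : wp (whisk a b p) = shiftw a (wp p).
Proof. by rewrite /wp /whisk /shiftw -!map_comp; apply: eq_map. Qed.
Lemma wdeg_wp p : wdeg (wp p) = pdeg p.
Proof. by rewrite /wdeg /pdeg big_map. Qed.
Lemma ptgt_wp s p k : ptgt s p = Some k -> valid s (wp p) /\ wend s (wp p) = k.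
Proof.
elim: p s => [|[[a g] b] p IH] s /=; first by case.
case: eqP => // -> /IH; rewrite leq_addr.
by have -> : (a + gsrc g + b - gsrc g + gtgt g = a + gtgt g + b)%N by lia.
Qed.
Lemma ptgt_pw s q : valid s q -> ptgt s (pw s q) = Some (wend s q).
Proof.
elim: q s => [|[i g] q IH] s //= /andP[h1 h2].
rewrite subnKC // eqxx -IH //; congr (ptgt _ _); lia.
Qed.
Lemma ptgt_cat s p p' : ptgt s (p ++ p') = obind (fun k => ptgt k p') (ptgt s p).
Proof. by elim: p s => [|[[a g] b] p IH] s //=; case: eqP. Qed.
Lemma pw_wp s p k : ptgt s p = Some k -> pw s (wp p) = p.
Proof.
elim: p s => [|[[a g] b] p IH] s //=; case: eqP => // -> h; rewrite addnC addnK //.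
congr (_ :: _); have -> : (b + (a + gsrc g) - gsrc g + gtgt g = a + gtgt g + b)%N by lia.
exact: IH.
Qed.
Lemma pw_cat s q q' : pw s (q ++ q') = pw s q ++ pw (wend s q) q'.
Proof. by elim: q s => [|[i g] q IH] s //=; rewrite IH. Qed.
Lemma pw_shift a b s q : valid s q -> pw (a + s + b) (shiftw a q) = whisk a b (pw s q).
Proof.
elim: q s => [|[i g] q IH] s //= /andP[h1 h2]; congr (_ :: _).
  by congr (_, _); lia.
rewrite -IH //; congr (pw _ _); lia.
Qed.

Lemma InP (T : eqType) (x : T) s : List.In x s <-> x \in s.
Proof.
elim: s => //= y s IH; rewrite inE; split=> [[->|/IH ->]|/orP[/eqP ->|/IH h]]; rewrite ?eqxx ?orbT //.
  by left.
by right.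
Qed.

Section Relations.
Variables (K : fieldType) (t : nat).
Definition torel (s : nat) (zr : seq (int * word)) : comb K := [seq (e.1%:~R, pw s e.2) | e <- zr].
Lemma zrel_isRel s zr : zrel t s zr -> isRel t s (torel s zr).
Proof.
have m1 : (-1)%:~R = -1 :> K by rewrite mulrN1z.
case; rewrite /torel /= ?m1 ?mulr1z.
- by left.
- by do 1 right; left.
- by do 2 right; left; rewrite mulrNz.
- by do 3 right; left.
- by do 4 right; left.
- by do 5 right; left.
- by do 6 right; left.
- by do 7 right; left.
- by do 8 right; left.
- move=> g h c; do 9 right; exists g, h, c; split=> //.
  by do !congr (_ :: _); congr (_, _); do !congr (_ :: _); congr (_, _); lia.
Qed.
Lemma isRel_zrel s r : isRel t s r -> exists2 zr, zrel t s zr & r = torel s zr.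
Proof.
have m1 : (-1)%:~R = -1 :> K by rewrite mulrN1z.
case=> [[e ->]|[[e ->]|[[e ->]|[[e ->]|[[e ->]|[[e ->]|[[e ->]|[[e ->]|[[e ->]|[g [h [c [e ->]]]]]]]]]]]]]; subst s.
- by eexists; [exact: ZTT|].
- by eexists; [exact: ZTTT|rewrite /torel /= m1].
- by eexists; [exact: ZAU|rewrite /torel /= mulrNz].
- by eexists; [exact: ZL|rewrite /torel /= m1].
- by eexists; [exact: ZR|rewrite /torel /= m1].
- by eexists; [exact: ZAT|].
- by eexists; [exact: ZP|rewrite /torel /= m1].
- by eexists; [exact: ZXT|rewrite /torel /= m1].
- by eexists; [exact: ZAX|].
- eexists; first exact: (ZI t g h c).
  rewrite /torel /= m1.
  by do !congr (_ :: _); congr (_, _); do !congr (_ :: _); congr (_, _); lia.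
Qed.
End Relations.

Section Dips.
Variable n : nat.
(** Recognises the words that pass through an object below [n], which are 0 in [NB_{>=n}]. *)
Fixpoint dips (k : nat) (q : word) : bool :=
  (k < n)%N || (if q is e :: q' then dips (k - gsrc e.2 + gtgt e.2) q' else false).
Lemma dips_pobjs k p k' : ptgt k p = Some k' -> has (fun m => m < n)%N (pobjs k p) = dips k (wp p).
Proof.
elim: p k => [|[[a g] b] p IH] k //=; case: eqP => // -> /IH ->.
by congr (_ || dips _ _); lia.
Qed.
Lemma dips_split k q : valid k q -> dips k q -> exists q1 q2, [/\ q = q1 ++ q2, valid k q1 & (wend k q1 < n)%N].
Proof.
elim: q k => [|[i g] q IH] k /=; first by rewrite orbF => _ h; exists [::], [::].
move=> /andP[h1 h2] /orP[h|h]; first by exists [::], ((i, g) :: q).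
have [q1 [q2 [-> h3 h4]]] := IH _ h2 h.
by exists ((i, g) :: q1), q2; rewrite /= h1 h3.
Qed.
End Dips.

(** * The kernel of lambda is a proper graded submodule *)

Section Rad.
Variables (K : fieldType) (t n : nat) (G : nat -> nat) (mo : model K t n G).
Implicit Types (v w : comb K).
Definition toS v : seq (K * word) := [seq (e.1, wp e.2) | e <- v].
Definition Ev v := Lvec mo (toS v).
Lemma EvE v q : Ev v q = \sum_(e <- v) e.1 * lam mo (wp e.2 ++ q).
Proof. by rewrite /Ev /Lvec big_map. Qed.
Lemma Ev_cat v w : Ev (v ++ w) = Ev v + Ev w.
Proof. by rewrite /Ev /toS map_cat Lvec_cat. Qed.
Lemma Ev_scale c v : Ev (scale c v) = sc c (Ev v).
Proof.
apply/funext => q; rewrite EvE /scale big_map /sc EvE mulr_sumr.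
by apply: eq_bigr => e _; rewrite mulrA.
Qed.
Lemma sum_cf (F : Defs.path -> K) v ps : uniq ps -> {subset [seq e.2 | e <- v] <= ps} ->
  \sum_(e <- v) e.1 * F e.2 = \sum_(p <- ps) cf v p * F p.
Proof.
move=> hu; elim: v => [|e v IH] hs.
  by rewrite big_nil big1 // => p _; rewrite /cf big_nil mul0r.
rewrite big_cons IH; last by move=> p hp; apply: hs; rewrite inE hp orbT.
rewrite -[RHS](eq_bigr _ (fun p _ => erefl)).
have -> : \sum_(p <- ps) cf (e :: v) p * F p =
    \sum_(p <- ps) ((if e.2 == p then e.1 else 0) * F p + cf v p * F p).
  by apply: eq_bigr => p _; rewrite /cf big_cons; case: eqP => _; rewrite ?add0r ?mul0r -?mulrDl ?add0r.
rewrite big_split /=; congr (_ + _).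
rewrite (bigD1_seq e.2) //=; last by apply: hs; rewrite mem_head.
rewrite eqxx big1 ?addr0 // => p; rewrite eq_sym => /negPf ->; exact: mul0r.
Qed.
Lemma Ev_ceq v w : ceq v w -> Ev v = Ev w.
Proof.
move=> h; apply/funext => q; rewrite !EvE.
pose ps := undup ([seq e.2 | e <- v] ++ [seq e.2 | e <- w]).
rewrite !(@sum_cf (fun p => lam mo (wp p ++ q)) _ ps) ?undup_uniq //.
- by apply: eq_bigr => p _; rewrite h.
- by move=> p hp; rewrite mem_undup mem_cat hp orbT.
- by move=> p hp; rewrite mem_undup mem_cat hp.
Qed.
Lemma Ev_flatten ws : Ev (flatten ws) = \sum_(w <- ws) Ev w.
Proof.
elim: ws => [|w ws IH] /=; last by rewrite Ev_cat big_cons IH.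
by rewrite big_nil; apply/funext => q; rewrite EvE big_nil.
Qed.
Lemma typed_all k v : typed n k v <-> all (fun e => ptgt n e.2 == Some k) v.
Proof.
split=> [h|/allP h e /InP /h /eqP //].
by apply/allP => e /InP /h ->.
Qed.
Lemma typed_toS k v : typed n k v -> all (fun x => valid n x.2 && (wend n x.2 == k)) (toS v).
Proof.
move=> h; apply/allP => _ /mapP[e /InP /h he ->] /=.
by have [-> ->] := ptgt_wp he; rewrite eqxx.
Qed.
Lemma Ev_hcomp k v e : typed n k v -> Ev (hcomp v e) = proj e (Ev v).
Proof.
move=> h; rewrite /Ev Lvec_filter; last by apply/allP => x /(allP (typed_toS h)) /andP[].
rewrite /toS /hcomp filter_map; congr (Lvec mo (map _ _)).
by apply: eq_filter => x /=; rewrite wdeg_wp.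
Qed.
Lemma Ev_act v p : Ev (act v p) = ev (op (cofun t K)) (wp p) (Ev v).
Proof.
apply/funext => q; rewrite ev_co !EvE /act big_map; apply: eq_bigr => e _.
by rewrite /= wp_cat -catA.
Qed.
Lemma Ev_one : Ev [:: (1, [::])] = lam mo.
Proof. by apply/funext => q; rewrite EvE big_seq1 mul1r. Qed.

Lemma Ev_Rgen k w : Rgen t n k w -> Ev w = 0.
Proof.
case=> [[c [r [s [a [b [p' [p [hr [hp' [-> _]]]]]]]]]]|[[c [p [hp [hl ->]]]]|[c [i [p [hi [hp ->]]]]]]].
- have [zr hz ->] := isRel_zrel hr; have [h1 h2] := ptgt_wp hp'.
  apply/funext => q; rewrite EvE.
  transitivity (c * \sum_(e <- zr) lam mo (wp p' ++ shiftw a e.2 ++ (wp p ++ q)) *~ e.1).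
    rewrite !big_map mulr_sumr; apply: eq_bigr => e _ /=.
    by rewrite !wp_cat wp_whisk wp_pw -!catA -mulrA mulrzl.
  by rewrite (lam_rel mo _ hz) ?mulr0 // h2 leq_addr.
- have [h1 h2] := ptgt_wp hp; rewrite (dips_pobjs _ hp) in hl.
  have [q1 [q2 [e h3 h4]]] := dips_split h1 hl.
  have := lam_out mo h3 erefl h4 => h5.
  apply/funext => q; rewrite EvE big_seq1 /= e -catA.
  by move/(congr1 (fun f => f (q2 ++ q))): h5; rewrite ev_co => ->; exact: mulr0.
- apply/funext => q.
  rewrite EvE big_seq1 -[lam mo _]/(op (cofun t K) GT (i - 1) (lam mo) (wp p ++ q)) lamT.
  exact: mulr0.
Qed.
Definition kerW k v := typed n k v /\ Ev v = 0.
Lemma kerW_proper : proper_graded_submod t n kerW.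
Proof.
have tcat k v w : typed n k v -> typed n k w -> typed n k (v ++ w).
  by move=> /typed_all h1 /typed_all h2; apply/typed_all; rewrite all_cat h1.
refine (conj _ (conj _ (conj _ (conj _ (conj _ (conj _ (conj _ _))))))).
- move=> k v [h1 [ws [h2 h3]]]; split=> //; rewrite (Ev_ceq h3) Ev_flatten big_seq big1 // => w /InP /h2.
  exact: Ev_Rgen.
- by move=> k v [].
- by move=> k v w [h1 h2] [h3 h4]; split; [exact: tcat|rewrite Ev_cat h2 h4 addr0].
- move=> k c v [/typed_all h1 h2]; split; last by rewrite Ev_scale h2 scv0.
  by apply/typed_all; rewrite /scale all_map.
- by move=> k v w h1 h2 [h3 h4]; split=> //; rewrite -(Ev_ceq h2).
- move=> k k' v p [/typed_all h1 h2] hp; split; last by rewrite Ev_act h2 ev0.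
  apply/typed_all; rewrite all_map; apply/allP => e /(allP h1) /eqP /= he.
  by rewrite ptgt_cat he /= hp.
- move=> k v e [h1 h2]; split; last by rewrite (Ev_hcomp _ h1) h2 proj0.
  move/typed_all/allP: h1 => h1; apply/typed_all/allP => x; rewrite mem_filter => /andP[_].
  exact: h1.
- by case=> _; rewrite Ev_one; apply: lam_neq0.
Qed.
Lemma ker_rad k v : kerW k v -> Defs.rad t n k v.
Proof.
move=> h; split; first by case: h.
exists [:: (kerW, v)]; split=> [x [<-|[]]|p]; first by split; [exact: kerW_proper|].
by rewrite /= cats0.
Qed.
End Rad.

(** * Every proper graded submodule lies in the kernel of lambda *)

Section Proper.
Variables (K : fieldType) (t n : nat) (G : nat -> nat) (mo : model K t n G).
Implicit Types (v w : comb K).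
Variable W : nat -> comb K -> Prop.
Hypothesis Wp : proper_graded_submod t n W.
Let W_R k v : Rsub t n k v -> W k v. Proof. by case: Wp => h _; apply: h. Qed.
Let W_typed k v : W k v -> typed n k v. Proof. by case: Wp => _ [h _]; apply: h. Qed.
Let W_cat k v w : W k v -> W k w -> W k (v ++ w). Proof. by case: Wp => _ [_ [h _]]; apply: h. Qed.
Let W_scale k c v : W k v -> W k (scale c v). Proof. by case: Wp => _ [_ [_ [h _]]]; apply: h. Qed.
Let W_ceq k v w : typed n k w -> ceq v w -> W k v -> W k w.
Proof. by case: Wp => _ [_ [_ [_ [h _]]]]; apply: h. Qed.
Let W_act k k' v p : W k v -> ptgt k p = Some k' -> W k' (act v p).
Proof. by case: Wp => _ [_ [_ [_ [_ [h _]]]]]; apply: h. Qed.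
Let W_hcomp k v e : W k v -> W k (hcomp v e).
Proof. by case: Wp => _ [_ [_ [_ [_ [_ [h _]]]]]]; apply: h. Qed.
Let W_one : ~ W n [:: (1, [::])].
Proof. by case: Wp => _ [_ [_ [_ [_ [_ [_ h]]]]]]. Qed.

Lemma cf_cat v w p : cf (v ++ w) p = cf v p + cf w p.
Proof. by rewrite /cf big_cat. Qed.
Lemma cf_cons e v p : cf (e :: v) p = (if e.2 == p then e.1 else 0) + cf v p.
Proof. by rewrite /cf big_cons; case: eqP; rewrite ?add0r. Qed.
Lemma cf_nil p : cf ([::] : comb K) p = 0. Proof. by rewrite /cf big_nil. Qed.
Lemma cfE v p : cf v p = \sum_(e <- v) (if e.2 == p then e.1 else 0).
Proof. by rewrite /cf big_mkcond. Qed.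
Lemma cf_scale c v p : cf (scale c v) p = c * cf v p.
Proof. by rewrite /cf big_map mulr_sumr. Qed.
Lemma Rgen_W k w : typed n k w -> Rgen t n k w -> W k w.
Proof.
move=> ht h; apply: W_R; split=> //; exists [:: w]; split=> [x [<-|[]] //|p].
by rewrite /= cats0.
Qed.
Lemma W_nil k : W k [::].
Proof. by apply: W_R; split=> //; exists [::]; split. Qed.

(** Combinations are lists and do not form a group; through their coefficient functions [W n]
    becomes a subgroup of the functions on paths, and the quotient [Q] can be formed. *)
Definition Scf (f : Defs.path -> K) := exists2 v, W n v & f = cf v.
Lemma Scf0 : Scf 0.
Proof. by exists [::]; [exact: W_nil|apply/funext => p; rewrite /cf big_nil]. Qed.
Lemma ScfB f g : Scf f -> Scf g -> Scf (f - g).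
Proof.
move=> [v hv ->] [w hw ->]; exists (v ++ scale (-1) w); first by apply: W_cat => //; apply: W_scale.
by apply/funext => p; rewrite cf_cat cf_scale mulN1r.
Qed.

Variables (Q : zmodType) (pr : (Defs.path -> K) -> Q).
Hypothesis prB : forall x y, pr (x - y) = pr x - pr y.
Hypothesis pr0 : forall x, pr x = 0 <-> Scf x.
HB.instance Definition _ := GRing.isZmodMorphism.Build _ _ pr prB.

(** The class of a word in the weight [n] part of [Delta(n)/W], viewed as a vector of the module of
    functions on words with values in [Q]. *)
Definition clsfun (q : word) : Q := if valid n q && (wend n q == n) then pr (cf [:: (1, pw n q)]) else 0.
Lemma typed1 k p (c : K) : ptgt n p = Some k -> typed n k [:: (c, p)].
Proof. by move=> h e [<-|[]]. Qed.

Lemma clsfun_rel p q s r a : zrel t s r -> valid n p -> (a + s <= wend n p)%N ->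
  \sum_(e <- r) clsfun (p ++ shiftw a e.2 ++ q) *~ e.1 = 0.
Proof.
move=> hr hp ha; have [k [d /allP hrd]] := zrel_homog hr.
pose b := (wend n p - (a + s))%N.
have hb : wend n p = (a + s + b)%N by rewrite subnKC.
have hv e : e \in r -> valid (a + s + b) (shiftw a e.2) /\ wend (a + s + b) (shiftw a e.2) = (a + k + b)%N.
  move=> /hrd /and3P[h1 /eqP h2 _].
  have [v1 v2] := valid_widen b h1; rewrite -!addnA; split; first exact: valid_shift.
  by rewrite wend_shift // v2 h2.
pose c := valid (a + k + b) q && (wend (a + k + b) q == n).
have hc e : e \in r -> valid n (p ++ shiftw a e.2 ++ q) && (wend n (p ++ shiftw a e.2 ++ q) == n) = c.
  by move=> /hv[h1 h2]; rewrite !valid_cat !wend_cat hp hb h1 h2.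
case hcc: c; last first.
  by rewrite big_seq big1 // => e he; rewrite /clsfun hc // hcc mul0rz.
pose w : comb K := [seq (1 * e.1, pw n p ++ whisk a b e.2 ++ pw (a + k + b) q) | e <- torel K s r].
have hpath e : e \in r -> pw n (p ++ shiftw a e.2 ++ q) = pw n p ++ whisk a b (pw s e.2) ++ pw (a + k + b) q.
  move=> he; have [h1 h2] := hv e he; have /and3P[h3 _ _] := hrd e he.
  by rewrite !pw_cat hb h2 pw_shift.
have ht : typed n n w.
  apply/typed_all; rewrite /w all_map; apply/allP => x /mapP[e he ->] /=.
  by have /andP[h1 /eqP h2] := etrans (hc e he) hcc; rewrite -hpath // ptgt_pw // h2.
have hw : W n w.
  apply: Rgen_W => //; left; exists 1, (torel K s r), s, a, b, (pw n p), (pw (a + k + b) q).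
  by split; [exact: zrel_isRel|split; [rewrite ptgt_pw // hb|]].
transitivity (pr (cf w)); last by apply/pr0; exists w.
have -> : cf w = \sum_(e <- r) cf [:: (1, pw n (p ++ shiftw a e.2 ++ q))] *~ e.1.
  apply/funext => z; rewrite fun_sumE cfE /w /torel !big_map big_seq [RHS]big_seq.
  apply: eq_bigr => e he /=; rewrite fun_MzE cf_cons cf_nil hpath //= mul1r addr0.
  by case: eqP => _; rewrite ?mul0rz.
rewrite raddf_sum big_seq [RHS]big_seq; apply: eq_bigr => e he.
by rewrite raddfMz /clsfun hc // hcc.
Qed.

(** Vanishing on words that pass below [n] removes all weights below [n], so that [clsfun] is lowest
    with zero [D]. *)
Definition Nd k (x : word -> Q) := wt (cofun t Q) k x /\ forall p, dips n k p -> x p = 0.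
Lemma Nd_sub : submodule (cofun t Q) Nd.
Proof.
split=> [k x [] //|k|k x y [h1 h2] [h3 h4]|g i k x [h1 h2]].
- by split=> //; apply: wt_0.
- split; first exact: wt_B.
  by move=> p hp; rewrite -[LHS]/(x p - y p) h2 // h4 // subrr.
- split; last by move=> p hp; apply: h2; rewrite /= hp orbT.
  have hi : inw (cofun t Q) k x by constructor.
  by case: (inw_op g i hi).
Qed.
Lemma clsfun_low : lowest (restrict Nd_sub) n clsfun (fun _ x => x = 0).
Proof.
split=> [||i|k x hk [[h1 h2]]].
- exact: zero_submod.
- constructor; split; first split=> [p hp|p q s r a hr hp ha]; [|exact: (clsfun_rel q hr hp ha)|].
    by rewrite /clsfun (negPf hp).
  move=> p hp; rewrite /clsfun; case: ifP => // /andP[h1 /eqP h2].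
  have hq : ptgt n (pw n p) = Some n by rewrite ptgt_pw // h2.
  apply/pr0; exists [:: (1, pw n p)] => //; apply: Rgen_W; first exact: typed1.
  by right; left; exists 1, (pw n p); rewrite (dips_pobjs _ hq) wp_pw.
- apply/funext => q; rewrite -[LHS]/(clsfun ((i, GT) :: q)) /clsfun; case: ifP => // /andP[h1 /eqP h2].
  have hi : (i + 2 <= n)%N by case/andP: h1.
  have hq := ptgt_pw h1; rewrite h2 in hq.
  apply/pr0; exists [:: (1, pw n ((i, GT) :: q))] => //; apply: Rgen_W; first exact: typed1.
  right; right; exists 1, i.+1, (pw (n - 2 + 2) q).
  have e1 : (i.+1 - 1 = i)%N by lia.
  have e2 : (n - i.+1 - 1 = n - (i + 2))%N by lia.
  by rewrite e1 e2 -[_ :: _]/(pw n ((i, GT) :: q)) hq; split=> //; lia.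
- by apply/funext => p; apply: h2; case: p => [|e p]; rewrite /= hk.
Qed.
(** [joint_ev_zero] for [clsfun] and the explicit module: a closed word of degree 0 acts on the
    generator of [Delta(n)/W] by the integer that defines [lam]. *)
Lemma W_lam p : closed0 n p -> W n [:: (1, pw n p); (- lam mo p, [::])].
Proof.
move=> hp; have /and3P[h1 /eqP h2 /eqP h3] := hp.
have [z [h4 h5]] := joint_ev_zero clsfun_low (md_low mo) h2 h3.
have hl : lam mo p = z%:~R.
  apply: (fmorph_inj (md_iota mo)); rewrite iota_lam // rmorph_int.
  move/subr0_eq: h5 => ->; by rewrite fun_MzE md_one.
have h6 : pr (cf [:: (1, pw n p); (- lam mo p, [::])]) = 0.
  move/subr0_eq/(congr1 (fun f => f [::])): h4; rewrite ev_co fun_MzE cats0 /clsfun h1 h2 !eqxx /= => h4.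
  have -> : cf [:: (1, pw n p); (- lam mo p, [::])] = cf [:: (1, pw n p)] - cf [:: (1, [::])] *~ z.
    apply/funext => x; rewrite -[RHS]/(cf _ x - (cf [:: (1, [::])] *~ z) x) fun_MzE.
    rewrite !cf_cons !cf_nil hl /= !addr0; congr (_ + _).
    by case: eqP => _; rewrite ?mul0rz ?oppr0.
  by rewrite raddfB /= raddfMz h4 subrr.
have [v hv e] := (pr0 _).1 h6; apply: W_ceq hv; last by move=> x; rewrite -e.
move=> y [<-|[<-|[]]] //=; by rewrite ptgt_pw // h2.
Qed.

(** If [Ev x] is nonzero at [q], the degree 0 part of [q x] lies in [W n] and is congruent modulo
    [W n] to a nonzero multiple of the empty path, so [W] is not proper. *)
Lemma proper_ker k x : W k x -> Ev mo x = 0.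
Proof.
move=> hx; apply: contrapT => hne.
have [q hq] : exists q, Ev mo x q != 0.
  by apply: contrapT => hn; apply: hne; apply/funext => q; apply/eqP; apply: contraT => h; case: hn; exists q.
have hs : spanL mo k (Ev mo x) by exists (toS x) => //; apply: typed_toS; apply: W_typed.
have hin := proj_spanL (- wdeg q) hs.
have hq' : proj (- wdeg q) (Ev mo x) q != 0 by rewrite /proj opprK eqxx.
have [q1 q2 _] := inL_supp hin hq'.
pose y := hcomp (act x (pw k q)) 0.
have hp : ptgt k (pw k q) = Some n by rewrite ptgt_pw // q2.
have hy : W n y by apply: W_hcomp; apply: W_act hx hp.
have hEy : Ev mo y [::] != 0.
  rewrite /y (@Ev_hcomp _ _ _ _ _ n); last by apply: W_typed; apply: W_act hx hp.
  by rewrite /proj wdeg_nil oppr0 eqxx Ev_act wp_pw ev_co cats0.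
have hdeg e : e \in y -> closed0 n (wp e.2) /\ pw n (wp e.2) = e.2.
  move=> he; have /InP/(W_typed hy) h := he; have [h1 h2] := ptgt_wp h.
  rewrite (pw_wp h) /closed0 h1 h2 wdeg_wp eqxx; split=> //.
  by move: he; rewrite mem_filter => /andP[].
(* Subtracting this element from [y] replaces each path by its value under [lam] times the empty
   path. *)
have hz : W n (flatten [seq scale e.1 [:: (1, e.2); (- lam mo (wp e.2), [::])] | e <- y]).
  elim: (y) hdeg => [|e z IH] hd; first exact: W_nil.
  apply: (@W_cat n (scale e.1 [:: (1, e.2); (- lam mo (wp e.2), [::])])); last by apply: IH => e' he'; apply: hd; rewrite inE he' orbT.
  by apply: W_scale; have [h1 {1}<-] := hd e (mem_head _ _); apply: W_lam.
have : W n (scale (Ev mo y [::])^-1 [:: (Ev mo y [::], [::])]).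
  apply: W_scale; apply: W_ceq (W_cat hy (W_scale (-1) hz)); first exact: typed1.
  move=> z; rewrite cf_cat cf_scale EvE cf_cons cf_nil addr0 /=.
  elim: (y) => [|e y' IH]; first by rewrite /= !cf_nil big_nil mulr0 addr0 if_same.
  rewrite map_cons -[flatten (_ :: _)]/(scale e.1 [:: (1, e.2); (- lam mo (wp e.2), [::])] ++
    flatten [seq scale e.1 [:: (1, e.2); (- lam mo (wp e.2), [::])] | e <- y']).
  rewrite cf_cat cf_scale !cf_cons cf_nil big_cons cats0 mulrDr addrACA IH /=.
  by case: (e.2 == z); case: eqP => _; ring.
by rewrite /scale /= mulVf //; apply: W_one.
Qed.
End Proper.

Lemma rad_iff (K : fieldType) (t n : nat) (G : nat -> nat) (mo : model K t n G) k (v : comb K) :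
  Defs.rad t n k v <-> typed n k v /\ Ev mo v = 0.
Proof.
split=> [[ht [l [h1 h2]]]|]; last exact: ker_rad.
split=> //; rewrite (Ev_ceq mo h2) Ev_flatten big_map big_seq big1 // => x /InP /h1 [Wp hx].
have [Q [pr [prB pr0]]] := quotient_group (Scf0 Wp) (ScfB Wp).
exact: (proper_ker mo Wp prB pr0 hx).
Qed.

(** * Generating functions *)

Local Notation Fq := {fraction {poly int}}.
Lemma qF_neq0 : qF != 0.
Proof. by rewrite tofrac_eq0 polyX_eq0. Qed.
Lemma qF_den : qF - qF^-1 != 0.
Proof.
rewrite subr_eq0; apply: contraTneq isT => h.
have h2 : qF ^+ 2 = 1 by rewrite expr2 {2}h mulfV // qF_neq0.
move/eqP: h2; rewrite -rmorphXn -(rmorph1 (@FracField.tofrac _)) tofrac_eq => /eqP.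
by move/(congr1 (fun p : {poly int} => size p)); rewrite size_polyXn size_poly1.
Qed.
Lemma qintE n : qint n = \sum_(j < n) qF ^ (n%:Z - 1 - 2 * j%:Z).
Proof.
apply: (mulIf qF_den); rewrite /qint divfK ?qF_den //.
elim: n => [|n IH]; first by rewrite big_ord0 mul0r expr0 invr1 subrr.
rewrite big_ord_recl /= mulr0 subr0.
have -> : \sum_(i < n) qF ^ (n.+1%:Z - 1 - 2 * (bump 0 i)%:Z) = qF^-1 * \sum_(j < n) qF ^ (n%:Z - 1 - 2 * j%:Z).
  rewrite mulr_sumr; apply: eq_bigr => i _.
  by rewrite -[qF^-1]/(qF ^ (-1)) -expfzDr ?qF_neq0 //; congr (_ ^ _); rewrite /bump /=; lia.
rewrite mulrDl -mulrA -IH.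
have -> : n.+1%:Z - 1 = n%:Z by lia.
rewrite -exprnP exprSr invfM.
by move: (qF ^+ n) (qF ^- n) (qF^-1) => x y z; ring.
Qed.

Lemma sum_support (f : int -> nat) (ds ds' : seq int) : uniq ds -> uniq ds' ->
  (forall d, f d != 0%N -> d \in ds) -> (forall d, f d != 0%N -> d \in ds') ->
  \sum_(d <- ds) (f d)%:R * qF ^ (- d) = \sum_(d <- ds') (f d)%:R * qF ^ (- d).
Proof.
move=> u u' h h'.
have red e : \sum_(d <- e) (f d)%:R * qF ^ (- d) = \sum_(d <- [seq d <- e | f d != 0%N]) (f d)%:R * qF ^ (- d).
  rewrite big_filter [LHS](bigID (fun d => f d != 0%N)) /= [X in _ + X]big1 ?addr0 // => d.
  by rewrite negbK => /eqP ->; rewrite mul0r.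
rewrite red [RHS]red; apply: perm_big; apply: uniq_perm; rewrite ?filter_uniq // => d.
rewrite !mem_filter; case: (f d =P 0%N) => //= /eqP hd; by rewrite h ?h'.
Qed.
(** The list may be larger than the support, so that two characters can be compared or added over a
    common list. *)
Definition isch (f : int -> nat) (c : Fq) := exists ds : seq int,
  [/\ uniq ds, forall d, f d != 0%N -> d \in ds & c = \sum_(d <- ds) (f d)%:R * qF ^ (- d)].
Lemma isch_uniq f c c' : isch f c -> isch f c' -> c = c'.
Proof. by move=> [ds [h1 h2 ->]] [ds' [h1' h2' ->]]; apply: sum_support. Qed.
Lemma isch_ext f g c : f =1 g -> isch f c -> isch g c.
Proof.
move=> h [ds [h1 h2 ->]]; exists ds; split=> // [d|]; first by rewrite -h; apply: h2.
by apply: eq_bigr => d _; rewrite h.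
Qed.
Lemma isch_shift f e c : isch f c -> isch (fun d => f (d - e)) (qF ^ (- e) * c).
Proof.
move=> [ds [h1 h2 ->]]; exists [seq d + e | d <- ds]; split.
- by rewrite map_inj_uniq //; apply: addIr.
- by move=> d /h2 h; apply/mapP; exists (d - e); rewrite ?subrK.
- rewrite big_map mulr_sumr; apply: eq_bigr => d _.
  by rewrite addrK opprD expfzDr ?qF_neq0 // mulrCA [qF ^ (- e) * _]mulrC.
Qed.
Lemma isch_add f g c c' : isch f c -> isch g c' -> isch (fun d => f d + g d)%N (c + c').
Proof.
move=> [ds [h1 h2 ->]] [ds' [h3 h4 ->]].
pose e := undup (ds ++ ds'); have ue : uniq e by apply: undup_uniq.
have s1 d : f d != 0%N -> d \in e by move=> /h2 h; rewrite mem_undup mem_cat h.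
have s2 d : g d != 0%N -> d \in e by move=> /h4 h; rewrite mem_undup mem_cat h orbT.
exists e; split=> // [d|].
  case: (eqVneq (f d) 0%N) => [->|/s1 //]; rewrite add0n; exact: s2.
rewrite (sum_support h1 ue h2 s1) (sum_support h3 ue h4 s2) -big_split.
by apply: eq_bigr => d _; rewrite natrD mulrDl.
Qed.
Lemma isch0 : isch (fun _ => 0%N) 0. Proof. by exists [::]; rewrite big_nil. Qed.
Lemma isch_sum (e : nat -> int) J f c : isch f c ->
  isch (fun d => \sum_(j < J) f (d - e j)%R)%N (\sum_(j < J) qF ^ (- e j) * c).
Proof.
move=> h; elim: J => [|J IH].
  by rewrite big_ord0; apply: isch_ext isch0 => d; rewrite big_ord0.
rewrite big_ord_recr /=; apply: isch_ext (isch_add IH (isch_shift (e J) h)) => d.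
by rewrite big_ord_recr.
Qed.

Lemma bump0 i : bump 0 i = i.+1. Proof. by []. Qed.

(** * Coefficients of a power series times a polynomial *)

Section Conv.
Variable F : fieldType.
Definition conv (a : nat -> F) (p : {poly F}) m := \sum_(i < m.+1) a i * p`_(m - i).
Lemma conv_X2 a (p : {poly F}) c m :
  conv a (p * (1 - c *: 'X^2)) m.+2 = conv a p m.+2 - c * conv a p m.
Proof.
have e i : (p * (1 - c *: 'X^2))`_i = p`_i - c * (if (i < 2)%N then 0 else p`_(i - 2)).
  by rewrite mulrBr mulr1 coefB -scalerAr coefZ coefMXn.
rewrite /conv; under eq_bigr => i _ do rewrite e mulrBr mulrCA.
rewrite sumrB; congr (_ - _); rewrite -mulr_sumr; congr (_ * _).
rewrite 2!big_ord_recr /= subnn subSnn /= !mulr0 !addr0; apply: eq_bigr => i _.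
have hi := ltn_ord i; have -> : (m.+2 - i < 2)%N = false by lia.
by congr (_ * p`_ _); lia.
Qed.
(** The recurrence says that [1 - c X^2] times the series of [a] equals [x X] times the series of
    [b]. *)
Lemma conv_step a b (p : {poly F}) x c :
  a 0%N = 0 -> a 1%N = x * b 0%N -> (forall k, a k.+2 = x * b k.+1 + c * a k) ->
  forall m, conv a (p * (1 - c *: 'X^2)) m.+1 = x * conv b p m.
Proof.
move=> a0 a1 a2 [|m].
  rewrite /conv !big_ord_recl !big_ord0 /= !addr0 a0 a1 mul0r add0r mulrA; congr (_ * _).
  by rewrite mulrBr mulr1 coefB -scalerAr coefZ coefMXn mulr0 subr0.
rewrite conv_X2 /conv 2!big_ord_recl a0 mul0r add0r a1 /= [in RHS]big_ord_recl /= mulrDr.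
have -> : \sum_(i < m.+1) a (bump 0 (bump 0 i)) * p`_(m.+2 - bump 0 (bump 0 i)) =
    x * (\sum_(i < m.+1) b (bump 0 i) * p`_(m.+1 - bump 0 i)) + c * \sum_(i < m.+1) a i * p`_(m - i).
  rewrite !mulr_sumr -big_split; apply: eq_bigr => i _.
  by rewrite !bump0 !subSS a2 mulrDl !mulrA.
by rewrite !bump0 subn1 !subn0 addrA addrK mulrA.
Qed.
Lemma conv_shift a b (p : {poly F}) x : a 0%N = 0 -> (forall k, a k.+1 = x * b k) ->
  forall m, conv a p m.+1 = x * conv b p m.
Proof.
move=> a0 a1 m; rewrite /conv big_ord_recl a0 mul0r add0r mulr_sumr.
by apply: eq_bigr => i _; rewrite lift0 a1 subSS mulrA.
Qed.
Lemma conv0 a (p : {poly F}) : conv a p 0 = a 0%N * p`_0.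
Proof. by rewrite /conv big_ord1. Qed.
Lemma conv1 a (p : {poly F}) : conv a p 1 = a 0%N * p`_1 + a 1%N * p`_0.
Proof. by rewrite /conv big_ord_recr big_ord1. Qed.
Lemma conv_one a m : conv a 1 m = a m.
Proof.
rewrite /conv big_ord_recr /= subnn coef1 eqxx mulr1 big1 ?add0r // => i _.
by have hi := ltn_ord i; rewrite coef1 subn_eq0 leqNgt hi mulr0.
Qed.
Lemma conv_even a m : a 1%N = 0 -> (forall k, a k.+2 = a k) ->
  conv a (1 - 'X^2) m = if m == 0%N then a 0%N else 0.
Proof.
move=> a1 a2; rewrite -[1 - 'X^2]mul1r -(scale1r 'X^2).
case: m => [|[|m]]; last by rewrite conv_X2 !conv_one a2 mul1r subrr.
  by rewrite conv0 mul1r scale1r coefB coef1 coefXn subr0 mulr1.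
by rewrite conv1 a1 mul0r addr0 mul1r scale1r coefB coef1 coefXn subrr mulr0.
Qed.
End Conv.

(** * The recursion for characters and its solution *)

Section Character.
Variables (t : nat).
Hypothesis t1 : (t <= 1)%N.
Fixpoint chr (k n : nat) : Fq :=
  if k is k'.+1 then
    qint n * chr k' n.-1 + (if (n %% 2 == t)%N then 0 else qint n.+1 * chr k' n.+1)
  else (n == 0%N)%:R.
Lemma chrS k n : chr k.+1 n = qint n * chr k n.-1 +
  (if (n %% 2 == t)%N then 0 else qint n.+1 * chr k n.+1).
Proof. by []. Qed.
(** Passing from the shift of [n] to those of [n - 1] and [n + 1] turns [2j] into [2j - (n - 1)] and
    [2j - 2n] into [2j - n]: both ranges become symmetric and sum to [[n]] and [[n + 1]]. *)
Lemma isch_cr k n : isch (fun d => cr t k n (d + shiftn n)) (chr k n).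
Proof.
elim: k n => [|k IH] n.
  case: n => [|n] /=; last by rewrite mulr0n; apply: isch_ext isch0.
  have s0 : shiftn 0 = 0 by [].
  exists [:: 0]; split=> // [d|]; first by rewrite /= s0 addr0 inE; case: (d == 0).
  by rewrite big_seq1 s0 addr0 eqxx oppr0 expr0z mulr1.
have sh m : (shiftn m.+1 = shiftn m + m%:Z)%R by rewrite /shiftn binS bin1 PoszD addrC.
rewrite /=.
have h1 : isch (fun d => \sum_(j < n) cr t k n.-1 (d + shiftn n - 2 * j%:Z)%R)%N (qint n * chr k n.-1).
  rewrite qintE mulr_suml.
  pose e j : int := 2 * j%:Z + 1 - n%:Z.
  have -> : \sum_(j < n) qF ^ (n%:Z - 1 - 2 * j%:Z) * chr k n.-1 = \sum_(j < n) qF ^ (- e j) * chr k n.-1.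
    by apply: eq_bigr => j _; congr (_ ^ _ * _); rewrite /e; lia.
  apply: isch_ext (isch_sum e n (IH n.-1)) => d; apply: eq_bigr => j _; congr (cr _ _ _ _).
  have hn : (0 < n)%N by apply: leq_ltn_trans (ltn_ord j).
  have hs : shiftn n = shiftn n.-1 + n.-1%:Z by rewrite -sh prednK.
  by rewrite hs /e; lia.
have h2 : isch (fun d => \sum_(j < n.+1) cr t k n.+1 (d + shiftn n - (2 * j%:Z - 2 * n%:Z))%R)%N (qint n.+1 * chr k n.+1).
  rewrite qintE mulr_suml.
  pose e j : int := 2 * j%:Z - n%:Z.
  have -> : \sum_(j < n.+1) qF ^ (n.+1%:Z - 1 - 2 * j%:Z) * chr k n.+1 = \sum_(j < n.+1) qF ^ (- e j) * chr k n.+1.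
    by apply: eq_bigr => j _; congr (_ ^ _ * _); rewrite /e; lia.
  apply: isch_ext (isch_sum e n.+1 (IH n.+1)) => d; apply: eq_bigr => j _; congr (cr _ _ _ _).
  by rewrite sh /e; lia.
case: eqP => _; last exact: isch_add.
by rewrite addr0; apply: isch_ext h1 => d; rewrite addn0.
Qed.

Lemma chr_lt k n : (k < n)%N -> chr k n = 0.
Proof.
elim: k n => [|k IH] [|n] //= h; rewrite !IH ?mulr0; [|lia..].
by case: ifP; rewrite addr0.
Qed.
Lemma qint1 : qint 1 = 1.
Proof. by rewrite /qint !expr1 mulfV // qF_den. Qed.
Lemma qint0 : qint 0 = 0.
Proof. by rewrite /qint !expr0 invr1 subrr mul0r. Qed.
Lemma denomS n : denom t n.+1 = denom t n * (if (n.+2 %% 2 == t)%N then 1 - qint n.+2 ^+ 2 *: 'X^2 else 1).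
Proof. by rewrite /denom [LHS]big_mkcond [X in X * _]big_mkcond big_nat_recr. Qed.

(** If [n + 2] is congruent to [t], a step from [n + 1] up to [n + 2] and back multiplies by
    [[n + 2]^2], the new factor of the denominator. Otherwise [n + 1] is congruent to [t], the
    recursion only steps down to [n], and the denominator is unchanged. *)
Lemma chr_conv n m : conv (chr^~ n) (denom t n) m = if m == n then qfact n else 0.
Proof.
have fS k : qfact k.+1 = qint k.+1 * qfact k by rewrite /qfact big_nat_recr //= mulrC.
elim: n m => [|n IH] m.
  have clsfun : qfact 0 = 1 by rewrite /qfact big_nil.
  have d0 : denom t 0 = if (1 %% 2 == t)%N then 1 - qint 1 ^+ 2 *: 'X^2 else 1.
    by rewrite /denom [LHS]big_mkcond big_nat1.
  rewrite clsfun d0; case: (eqVneq (1 %% 2)%N t) => h.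
    rewrite qint1 expr1n scale1r conv_even //.
      by rewrite /= -h /= qint0 mulr0 mul0r add0r.
    by move=> k; rewrite /= -h /= qint0 qint1 mul0r add0r mul1r addr0 !mul1r.
  have h0 : t = 0%N by lia.
  by rewrite conv_one; case: m => [|m] //=; rewrite h0 /= qint0 mul0r addr0.
rewrite fS denomS; case: (eqVneq (n.+2 %% 2)%N t) => h.
  have ho : (n.+1 %% 2 == t)%N = false by lia.
  have ho' : (n.+2 %% 2 == t)%N by rewrite h.
  case: m => [|m].
    by rewrite /conv big_ord1 /= mul0r.
  have step k : chr k.+1 n.+1 = qint n.+1 * chr k n + qint n.+2 * chr k n.+2.
    by rewrite chrS ho.
  rewrite (@conv_step _ _ (chr^~ n) _ (qint n.+1)).
  - by rewrite IH eqSS; case: eqP => // _; rewrite mulr0.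
  - by rewrite /= mulr0n.
  - by rewrite step (@chr_lt 0 n.+2) // mulr0 addr0.
  - by move=> k; rewrite step (chrS k n.+2) ho' addr0 expr2 mulrA.
have ho : (n.+1 %% 2 == t)%N by lia.
rewrite mulr1; case: m => [|m]; first by rewrite /conv big_ord1 /= mul0r.
rewrite (@conv_shift _ _ (chr^~ n) _ (qint n.+1)).
- by rewrite IH eqSS; case: eqP => // _; rewrite mulr0.
- by rewrite /= mulr0n.
- by move=> k; rewrite chrS ho addr0.
Qed.
End Character.

(** * Dimensions of the graded pieces of L(n) *)

Section HasDim.
Variables (K : fieldType) (t : nat) (two : (2%:R : K) != 0) (t1 : (t <= 1)%N) (n : nat).
Local Notation mo := (mods two t1 n).
Lemma Ev_lincomb N c (vs : seq (comb K)) : size c = N -> size vs = N ->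
  Ev mo (lincomb c vs) = \sum_(i < N) sc (nth 0 c i) (Ev mo (nth [::] vs i)).
Proof.
elim: vs c N => [|v vs IH] [|x c] [|N] //=.
  by rewrite big_ord0 => _ _; apply/funext => q; rewrite EvE big_nil.
move=> [h1] [h2]; rewrite big_ord_recl /= -(IH _ _ h1 h2) -Ev_scale -Ev_cat.
by [].
Qed.
Lemma typed_lincomb k c (vs : seq (comb K)) : (forall v, List.In v vs -> typed n k v) ->
  typed n k (lincomb c vs).
Proof.
move=> h e /InP /flattenP[w /mapP[x hx ->] /mapP[y hy ->]] /=.
have hv : x.2 \in vs by have := map_f snd hx; elim: (c) (vs) {hx h} => [|a c' IH] [|b vs'] //=; rewrite !inE => /orP[->//|/IH ->]; rewrite orbT.
by apply: (h _ ((InP _ _).2 hv)); apply/InP.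
Qed.
Lemma homog_Ev k d v : homog n k d v -> inL mo k (d + shiftn n) (Ev mo v).
Proof.
move=> [h1 h2]; exists (toS v) => //; apply/allP => x hx.
have /andP[-> ->] := allP (typed_toS h1) x hx.
by case/mapP: hx => e /InP /h2 <- ->; rewrite wdeg_wp eqxx.
Qed.
Lemma inL_homog k d f : inL mo k (d + shiftn n) f -> exists2 v, homog n k d v & Ev mo v = f.
Proof.
move=> [s /allP hs ->]; exists [seq (x.1, pw n x.2) | x <- s].
  split=> e /InP /mapP[x /hs /and3P[h1 /eqP h2 /eqP h3] ->] /=; first by rewrite ptgt_pw // h2.
  by rewrite -wdeg_wp wp_pw.
by apply/funext => q; rewrite EvE big_map; apply: eq_bigr => x _; rewrite /= wp_pw.
Qed.
Lemma has_dim_cr k d : has_dim K t n k d (cr t k n (d + shiftn n)).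
Proof.
split.
- have [v [h1 h2]] := lower_bound two t1 k n (d + shiftn n).
  have hex i : exists w, homog n k d w /\ Ev mo w = v i by have [w] := inL_homog (h1 i); exists w.
  have [w hw] := boolp.choice hex.
  pose vs := [seq w i | i <- enum 'I_(cr t k n (d + shiftn n))].
  have sv : size vs = cr t k n (d + shiftn n) by rewrite size_map size_enum_ord.
  exists vs; split=> //; split=> [_ /InP /mapP[i _ ->]|c hc /(rad_iff mo) [_]]; first by case: (hw i).
  rewrite (Ev_lincomb (etrans hc sv) sv) => e i.
  case: (ltnP i (cr t k n (d + shiftn n))) => hi; last by rewrite nth_default // hc sv.
  apply: (h2 (fun i => nth 0 c i) _ (Ordinal hi)); rewrite -[RHS]e.
  by apply: eq_bigr => j _; rewrite (nth_map j) ?size_enum_ord // nth_ord_enum (proj2 (hw j)).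
- move=> ws hs hh hi.
  suff hb : indfam (inL mo k (d + shiftn n)) (fun v => v = 0) (cr t k n (d + shiftn n)).+1.
    by have := exact_dim hb; rewrite ltnn.
  exists (fun i => Ev mo (nth [::] ws i)); split=> [i|c hc i].
    by apply: homog_Ev; apply: hh; apply/InP; apply: mem_nth; rewrite hs.
  pose c' := [seq c i | i <- enum 'I_(cr t k n (d + shiftn n)).+1].
  have hsz : size c' = size ws by rewrite size_map size_enum_ord hs.
  have := hi c' hsz _ i; rewrite (nth_map i) ?size_enum_ord // nth_ord_enum; apply.
  apply/(rad_iff mo); split; first by apply: typed_lincomb => v /hh[].
  rewrite (Ev_lincomb (etrans hsz hs) hs) -[RHS]hc; apply: eq_bigr => j _.
  by rewrite (nth_map j) ?size_enum_ord // nth_ord_enum.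
Qed.
End HasDim.

(** Along [k] steps the index stays at most [n + k], so each step shifts the degree by at most
    [2(n + k)]. *)
Lemma cr_support t k n d : (2 * k * (n + k) < absz d)%N -> cr t k n d = 0%N.
Proof.
elim: k n d => [|k IH] n d h /=.
  by case: eqP => // _; have -> : (d == 0) = false by apply/eqP => e; move: h; rewrite e.
rewrite big1 => [|j _].
  case: ifP => // _; rewrite big1 // => j _; apply: IH; have := ltn_ord j; nia.
by apply: IH; have := ltn_ord j; nia.
Qed.

Lemma chcoef_chr t n (D : nat -> nat) k : (t <= 1)%N ->
  (forall d, (D k < absz d)%N -> cr t k n (d + shiftn n) = 0%N) ->
  chcoef (fun k d => cr t k n (d + shiftn n)) D k = chr t k n.
Proof.
move=> t1 hD; apply: (isch_uniq (f := fun d => cr t k n (d + shiftn n))); last exact: isch_cr.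
exists [seq i%:Z - (D k)%:Z | i <- index_iota 0 (D k).*2.+1]; split.
- by rewrite map_inj_uniq ?iota_uniq // => i j /eqP; lia.
- move=> d hd; have h : (absz d <= D k)%N by rewrite leqNgt; apply: contra hd => /hD ->.
  by apply/mapP; exists (absz (d + (D k)%:Z)); rewrite ?mem_index_iota; lia.
- by rewrite /chcoef big_map big_mkord.
Qed.

Theorem theoremE (K : fieldType) (t n : nat) :
  (2%:R : K) != 0 -> (t <= 1)%N ->
  exists dimf : nat -> int -> nat,
    (forall k d, has_dim K t n k d (dimf k d)) /\
    exists D : nat -> nat,
      (forall k d, (D k < absz d)%N -> dimf k d = 0%N) /\
      (* (ch L(n)) * prod_k (1 - [k]^2 xi^2) = [n]! xi^n  as power series in xi *)
      forall m : nat,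
        \sum_(i < m.+1) chcoef dimf D i * (denom t n)`_(m - i)
          = (if m == n then qfact n else 0).
Proof.
move=> two t1; exists (fun k d => cr t k n (d + shiftn n)).
split=> [k d|]; first exact: has_dim_cr.
(* The bound of [cr_support], enlarged by the shift [shiftn n]. *)
pose D k := (2 * k * (n + k) + 'C(n, 2))%N.
have hD k d : (D k < absz d)%N -> cr t k n (d + shiftn n) = 0%N.
  by move=> h; apply: cr_support; move: h; rewrite /D /shiftn; lia.
exists D; split=> // m; rewrite -(chr_conv t1 n m); apply: eq_bigr => i _.
by rewrite chcoef_chr //; apply: hD.
Qed.
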